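(* Let $T>0$. Consider the system $$\begin{cases}\dot u-u''=0, & t>0,\ x\in\omega_1=(-1,0),\\ \dot v-v''=0, & t>0,\ x\in\omega_2=(0,1),\\ \dot z(t)=v'(t,0)-u'(t,0), & t>0,\\ u(t,0)=v(t,0)=z(t), & t>0,\\ u(t,-1)=0, & t>0,\end{cases}$$ with initial data $u(0,\cdot)=u^0$, $v(0,\cdot)=v^0$, $z(0)=z^0$, together with either (D) the Dirichlet control $v(t,1)=f(t)$, $t>0$, or (N) the Neumann control $v'(t,1)=f(t)$, $t>0$. Then, in each of the cases (D) and (N), the system is null controllable in time $T$: for every initial datum $(u^0,v^0,z^0)\in L^2(\omega_1)\times L^2(\omega_2)\times\mathbb{R}$ there is a control $f\in L^2(0,T)$ such that the solution (by transposition, as defined in the context) satisfies $(u(T,\cdot),v(T,\cdot),z(T))=(0,0,0)$.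
   Context: A prime denotes $\partial_x$ and a dot denotes $\partial_t$. Spaces. $\omega_1=(-1,0)$, $\omega_2=(0,1)$. $\mathcal{H}=L^2(\omega_1)\times L^2(\omega_2)\times\mathbb{R}$ with norm $\|(u,v,z)\|_{\mathcal H}^2=\|u\|_{L^2(\omega_1)}^2+\|v\|_{L^2(\omega_2)}^2+|z|^2$ and the corresponding inner product. $\mathcal{W}$ is the space of $(u,v,z)\in H^1(\omega_1)\times H^1(\omega_2)\times\mathbb{R}$ with $u(-1)=0$, $u(0)=v(0)=z$ and, in the Dirichlet case (D) only, also $v(1)=0$; its norm is $\|(u,v,z)\|_{\mathcal W}^2=\|u'\|_{L^2(\omega_1)}^2+\|v'\|_{L^2(\omega_2)}^2$. Operator. $\mathcal{A}:D(\mathcal{A})\subset\mathcal{H}\to\mathcal{H}$, $\mathcal{A}(u,v,z)=(u'',v'',v'(0)-u'(0))$, with $D(\mathcal{A})=\{(u,v,z)\in\mathcal{W}: u\in H^2(\omega_1), v\in H^2(\omega_2)\}$ in case (D), and $D(\mathcal{A})=\{(u,v,z)\in\mathcal{W}: u\in H^2(\omega_1), v\in H^2(\omega_2), v'(1)=0\}$ in case (N). $\mathcal{A}$ is self-adjoint with $-\mathcal{A}$ positive and has compact inverse; it generates an analytic semigroup $(\mathbb{T}_t)_{t\ge0}$ on $\mathcal{H}$. One has $X_{1/2}:=D((-\mathcal{A})^{1/2})=\mathcal{W}$, and $X_{-1/2}$ denotes the dual of $X_{1/2}$ with respect to the pivot space $\mathcal{H}$; $\langle\cdot,\cdot\rangle$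 denotes the duality pairing on $X_{-1/2}\times X_{1/2}$. Solutions by transposition, for $y^0=(u^0,v^0,z^0)\in\mathcal{H}$ and $f\in L^2(0,T)$. For terminal data $\eta$ at time $s\in[0,T]$, write $(\tilde u(t),\tilde v(t),\tilde z(t))=\mathbb{T}_{s-t}\eta$, $0\le t\le s$. Case (N): the solution is the unique $y=(u,v,z)\in C([0,T];\mathcal{H})$ such that for all $s\in[0,T]$ and all $\eta\in\mathcal{H}$, $$\langle y(s),\eta\rangle_{\mathcal H}=\langle y^0,\mathbb{T}_s\eta\rangle_{\mathcal H}+\int_0^s f(t)\,\tilde v(t,1)\,dt .$$ Case (D): the solution is the unique $y=(u,v,z)\in C([0,T];X_{-1/2})$ such that for all $s\in[0,T]$ and all $\eta\in X_{1/2}$, $$\langle y(s),\eta\rangle=\langle y^0,\mathbb{T}_s\eta\rangle_{\mathcal H}-\int_0^s f(t)\,\tilde v'(t,1)\,dt .$$ The condition $(u(T,\cdot),v(T,\cdot),z(T))=(0,0,0)$ means $y(T)=0$. *)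

(* Defs.v *)
From HB Require Import structures.
From mathcomp Require Import all_boot all_order all_algebra.
From mathcomp Require Import all_classical all_reals all_analysis.

Set Implicit Arguments.
Unset Strict Implicit.
Unset Printing Implicit Defensive.

Import Order.TTheory GRing.Theory Num.Theory.
Import numFieldNormedType.Exports.

Local Open Scope classical_set_scope.
Local Open Scope ring_scope.

Section L2.
Context {R : realType}.

Definition mu_oo (a b : R) : {measure set (measurableTypeR R) -> \bar R} :=
  mrestr lebesgue_measure (measurable_itv `]a, b[).

(** Elements of [L2 a b] are square-integrable representatives, not classes
    modulo a.e. equality: all notions below are invariant under a.e. equality,
    and equality in the Hilbert space is [Heq]. *)
Definition L2 (a b : R) := LfunType (mu_oo a b) (lee1n 2).

Definition L2dot (a b : R) (u v : L2 a b) : R :=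
  \int[mu_oo a b]_x (u x * v x).

(** [C_c^\infty(]a, b[)] *)
Definition test_fun (a b : R) (phi : R -> R) : Prop :=
  (forall n (x : R), derivable (derive1n n phi) x 1) /\
  (exists c d, [/\ a < c, d < b & forall x, x \notin `[c, d] -> phi x = 0]).

Definition weak_deriv (a b : R) (u g : L2 a b) : Prop :=
  forall phi, test_fun a b phi ->
    \int[mu_oo a b]_x (u x * derive1 phi x) = - \int[mu_oo a b]_x (g x * phi x).

Definition H1 (a b : R) (u : L2 a b) : Prop := exists g, weak_deriv u g.

(** A representative of the weak derivative; meaningful when [H1 u]. *)
Definition wderiv (a b : R) (u : L2 a b) : L2 a b := xget 0 (weak_deriv u).

Definition H2 (a b : R) (u : L2 a b) : Prop := H1 u /\ H1 (wderiv u).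

(** The pointwise value, at [x] in the closed interval, of the continuous
    representative of [u]; meaningful when [u] has one (e.g. when [H1 u]). *)
Definition trace (a b : R) (u : L2 a b) (x : R) : R :=
  xget 0 [set c | exists U : R -> R,
    [/\ {within `[a, b], continuous U}, u = U %[ae mu_oo a b] & U x = c]].

End L2.

Section Operator.
Context {R : realType}.

Definition H : Type := (L2 (-1 : R) 0 * L2 (0 : R) 1 * R^o)%type.
HB.instance Definition _ := GRing.Lmodule.on H.

Definition Hu (y : H) : L2 (-1 : R) 0 := y.1.1.
Definition Hv (y : H) : L2 (0 : R) 1 := y.1.2.
Definition Hz (y : H) : R := y.2.

Definition Hdot (x y : H) : R :=
  L2dot (Hu x) (Hu y) + L2dot (Hv x) (Hv y) + Hz x * Hz y.

Definition Hnorm (x : H) : R := Num.sqrt (Hdot x x).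

Definition Heq (x y : H) : Prop :=
  [/\ Hu x = Hu y %[ae mu_oo (-1 : R) 0],
      Hv x = Hv y %[ae mu_oo (0 : R) 1] & Hz x = Hz y].

Variant boundary := Dirichlet | Neumann.

Definition inW (bc : boundary) (x : H) : Prop :=
  [/\ H1 (Hu x) /\ H1 (Hv x),
      trace (Hu x) (-1) = 0,
      trace (Hu x) 0 = Hz x,
      trace (Hv x) 0 = Hz x
    & bc = Dirichlet -> trace (Hv x) 1 = 0].

Definition Wnorm (x : H) : R :=
  Num.sqrt (L2dot (wderiv (Hu x)) (wderiv (Hu x)) +
            L2dot (wderiv (Hv x)) (wderiv (Hv x))).

Definition domA (bc : boundary) (x : H) : Prop :=
  [/\ inW bc x, H2 (Hu x), H2 (Hv x)
    & bc = Neumann -> trace (wderiv (Hv x)) 1 = 0].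

Definition opA (x : H) : H :=
  (wderiv (wderiv (Hu x)), wderiv (wderiv (Hv x)),
   trace (wderiv (Hv x)) 0 - trace (wderiv (Hu x)) 0).

(** [S] is a strongly continuous semigroup of bounded operators on the Hilbert
    space whose infinitesimal generator (graph and domain) is [opA] on
    [domA bc]; this determines [S t x] up to [Heq] for [0 <= t]. *)
Record generated_semigroup (bc : boundary) (S : R -> H -> H) : Prop := {
  sg_linear : forall t a x y, 0 <= t ->
    Heq (S t (a *: x + y)) (a *: S t x + S t y);
  sg_bounded : forall t, 0 <= t ->
    exists C, forall x, Hnorm (S t x) <= C * Hnorm x;
  sg_0 : forall x, Heq (S 0 x) x;
  sg_D : forall s t x, 0 <= s -> 0 <= t -> Heq (S (s + t) x) (S s (S t x));
  sg_continuous : forall x, Hnorm (S t x - x) @[t --> 0^'+] --> (0 : R);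
  sg_generator : forall x y,
    (Hnorm (t^-1 *: (S t x - x) - y) @[t --> 0^'+] --> (0 : R)) <->
    domA bc x /\ Heq y (opA x)
}.

(** The dual of [X_{1/2}], that is of [W] with its norm.  A functional on [W]
    is represented by a function on [H] whose values outside [W] are
    irrelevant; [x : H] is identified with [Hdot x], [H] being the pivot. *)
Definition in_dual (bc : boundary) (l : H -> R) : Prop :=
  (forall a x y, inW bc x -> inW bc y -> l (a *: x + y) = a * l x + l y) /\
  (exists C, forall x, inW bc x -> `|l x| <= C * Wnorm x).

Definition dual_norm (bc : boundary) (l : H -> R) : R :=
  sup [set `|l x| | x in [set x | inW bc x /\ Wnorm x <= 1]].

(** Solutions by transposition.  For [t < s], [S (s - t) eta] lies in the
    domain of the generator, so that the traces are genuine; at [t = s] they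
    may take the default value, which does not affect the integrals. *)

Definition solution_Neumann (S : R -> H -> H) (T : R) (y0 : H)
    (f : L2 (0 : R) T) (y : R -> H) : Prop :=
  (forall s : R, s \in `[0, T] ->
    Hnorm (y t - y s) @[t --> within `[0, T] (nbhs s)] --> (0 : R)) /\
  (forall (s : R) (eta : H), s \in `[0, T] ->
    Hdot (y s) eta = Hdot y0 (S s eta) +
      \int[lebesgue_measure]_(t in `[0, s]) (f t * trace (Hv (S (s - t) eta)) 1)).

Definition solution_Dirichlet (S : R -> H -> H) (T : R) (y0 : H)
    (f : L2 (0 : R) T) (y : R -> H -> R) : Prop :=
  [/\ forall s : R, s \in `[0, T] -> in_dual Dirichlet (y s),
      forall s : R, s \in `[0, T] ->
        dual_norm Dirichlet (y t \- y s) @[t --> within `[0, T] (nbhs s)]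
          --> (0 : R)
    & forall (s : R) (eta : H), s \in `[0, T] -> inW Dirichlet eta ->
        y s eta = Hdot y0 (S s eta) -
          \int[lebesgue_measure]_(t in `[0, s])
            (f t * trace (wderiv (Hv (S (s - t) eta))) 1)].

End Operator.

Arguments H : clear implicits.

(* Main.v *)
(** The generator has eigenfunctions [Ef m], explicit combinations of sines, whose frequencies
    [m] solve a scalar equation.  They are complete: an element of the energy space orthogonal
    to the first [2M+1] of them can be combined with them so as to vanish at [2M+1] nodes, and
    Wirtinger's inequality between consecutive nodes then bounds its norm by its energy.  This
    identifies the semigroup with its spectral series.

    The control comes from flatness.  With [Q i] the polynomials generated by inverting the
    generator, [sum_i g^(i)(t) Q i] formally solves the equation, and the free evolution is of
    this form with [g0(t) = u'(t, -1) = sum_k c_k exp(- m_k^2 t)], analytic for [t > 0].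
    Multiplying [g0] by a Gevrey cutoff of order 2 with a small constant, equal to 1 up to time
    [t1] and to 0 after [t2], keeps the series convergent and steers the state to 0; the control
    is the trace of the series at [1].  The transposition identity is checked on each
    eigenfunction, where it is a scalar linear equation, and then summed. *)

From HB Require Import structures.
From mathcomp Require Import all_boot all_order all_algebra.
From mathcomp Require Import all_classical all_reals all_analysis.
From mathcomp Require Import measurable_realfun.
From mathcomp Require Import zify ring lra.
Require Import Defs.

Set Implicit Arguments.
Unset Strict Implicit.
Unset Printing Implicit Defensive.

Import Order.TTheory GRing.Theory Num.Theory.
Import numFieldNormedType.Exports.

Local Open Scope classical_set_scope.
Local Open Scope ring_scope.

(** The semigroup is given only through its generator, so every spectral fact about it is derived:
    [opA] is inverted explicitly, which carries results from the energy space to all of [H], and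
    [S t] commutes with [opA], which forces it to act diagonally on the eigenfunctions. The scale of
    the control comes from the polynomials: [Q i] has size [8 ^ i / (2i)!], so the derivatives of
    the flat output must be bounded by [r ^ i (2i)!] with [r] small, and with room for two more time
    derivatives. No analytic function passes from 1 to 0, but dilating the argument of [e^(-1/t)],
    the support being kept, makes the Gevrey ratio [r] as small as desired. The free output, being
    analytic, meets the bound for every [r]. Free evolution and flat series are compared only
    through their coefficients on the [e_ n]. The control obtained is bounded, and this makes the
    transposition integral sum absolutely even when the dual datum is merely in [H]. In the
    Dirichlet case too the state stays in [H], so continuity in the dual follows from continuity in
    [H]. *)

Section RealSeries.
Context {R : realType}.
Implicit Types a b c : R^nat.

Lemma seriesSE a n : series a n.+1 = series a n + a n.
Proof. by rewrite /series /= big_nat_recr. Qed.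

Lemma series0E a : series a 0%N = 0.
Proof. by rewrite /series /= big_geq. Qed.

Lemma ler_series a b n : (forall k, a k <= b k) -> series a n <= series b n.
Proof. by move=> ab; apply: ler_sum => k _; exact: ab. Qed.

Lemma ler_series_lim a n : (forall k, 0 <= a k) -> cvgn (series a) ->
  series a n <= limn (series a).
Proof.
move=> a0 ca; apply: nondecreasing_cvgn_le => //.
by apply/nondecreasing_seqP => k; rewrite seriesSE lerDl.
Qed.

Lemma bounded_cvg_series a B : (forall k, 0 <= a k) ->
  (forall n, series a n <= B) -> cvgn (series a).
Proof.
move=> a0 aB; apply: nondecreasing_is_cvgn.
  by apply/nondecreasing_seqP => k; rewrite seriesSE lerDl.
by exists B => _ [n _ <-].
Qed.

Lemma abs_cvg_series a b : (forall k, `|a k| <= b k) -> cvgn (series b) ->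
  cvgn (series a).
Proof.
move=> ab cb; apply: normed_cvg; apply: series_le_cvg cb => //= k.
exact: le_trans (ab k).
Qed.

Lemma series_tail a b n : (forall k, `|a k| <= b k) -> cvgn (series b) ->
  `|limn (series a) - series a n| <= limn (series b) - series b n.
Proof.
move=> ab cb; have ca := abs_cvg_series ab cb.
have le_tail m : (n <= m)%N ->
    `|series a m - series a n| <= series b m - series b n.
  move=> nm; rewrite !sub_series_geq //; apply: le_trans (ler_norm_sum _ _ _) _.
  by apply: ler_sum => k _; exact: ab.
apply: (ler_cvg_to (cvg_norm (cvgB ca (cvg_cst (series a n))))
  (cvgB cb (cvg_cst (series b n)))).
by near=> m; apply: le_tail; near: m; exists n.
Unshelve. all: by end_near. Qed.

Lemma lim_series_norm_le a b : (forall k, `|a k| <= b k) -> cvgn (series b) ->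
  `|limn (series a)| <= limn (series b).
Proof. by move=> ab /(series_tail 0 ab); rewrite !series0E !subr0. Qed.

Lemma lim_seriesMl a (l : R) : cvgn (series a) ->
  series (fun k => l * a k) @ \oo --> l * limn (series a).
Proof.
move=> ca; rewrite (_ : series _ = fun n => l * series a n).
  exact: (cvgM (cvg_cst _) ca).
by apply/funext => n; rewrite /series /= mulr_sumr.
Qed.

Lemma cvg_series_S' a : cvgn (series a) ->
  series (fun k => a k.+1) @ \oo --> limn (series a) - a 0%N.
Proof.
move=> ca; have -> : series (fun k => a k.+1) = fun n => series a n.+1 - a 0%N.
  by apply/funext => n; rewrite /series /= big_nat_recl // addrC addKr.
have {}ca : (fun n => series a n.+1) @ \oo --> limn (series a) by rewrite cvg_shiftS.
exact: (cvgB ca (cvg_cst _)).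
Qed.

End RealSeries.

(** * Integration on closed intervals and integration by parts *)

HB.lock Definition Int {R : realType} (a b : R) (f : R -> R) : R :=
  \int[@lebesgue_measure R]_(x in `[a, b]) f x.

Section Integral.
Context {R : realType}.
Implicit Types (a b c x : R) (f g h F G : R -> R).

Notation leb := (@lebesgue_measure R).

Definition itg a b f := leb.-integrable `[a, b] (EFin \o f).

Lemma eq_I a b f g : (forall x, a <= x <= b -> f x = g x) -> Int a b f = Int a b g.
Proof. by move=> fg; rewrite Int.unlock; apply: eq_Rintegral => x; rewrite inE /= in_itv /=; exact: fg. Qed.

Lemma eq_itg a b f g : (forall x, a <= x <= b -> f x = g x) -> itg a b f -> itg a b g.
Proof.
move=> fg; apply: eq_integrable => // x; rewrite inE /= in_itv /= => /fg.
by move=> ->.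
Qed.

Lemma itg_meas a b f : itg a b f -> measurable_fun `[a, b] f.
Proof. by move=> /(measurable_int leb)/measurable_EFinP. Qed.

Lemma itgD a b f g : itg a b f -> itg a b g -> itg a b (fun x => f x + g x).
Proof. by move=> fi gi; exact: (integrableD _ fi gi). Qed.

Lemma itgB a b f g : itg a b f -> itg a b g -> itg a b (fun x => f x - g x).
Proof. by move=> fi gi; exact: (integrableB _ fi gi). Qed.

Lemma itgZ a b (k : R) f : itg a b f -> itg a b (fun x => k * f x).
Proof. by move=> fi; exact: (integrableZl _ _ fi). Qed.

Lemma itg_norm a b f : itg a b f -> itg a b (fun x => `|f x|).
Proof. by move=> fi; exact: integrable_norm. Qed.

Lemma le_itg a b f g : measurable_fun `[a, b] f ->
  (forall x, a <= x <= b -> `|f x| <= g x) -> itg a b g -> itg a b f.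
Proof.
move=> mf fg; apply: le_integrable => //; first exact/measurable_EFinP.
move=> x /=; rewrite in_itv /= => /fg fgx.
by rewrite lee_fin (le_trans fgx) // ler_norm.
Qed.

Lemma itg_sub a b c d f : a <= c -> d <= b -> itg a b f -> itg c d f.
Proof.
move=> ac db; apply: integrableS => //; apply: subset_itv; rewrite bnd_simp //.
Qed.

Lemma itg_cst a b (k : R) : itg a b (fun=> k).
Proof.
apply: continuous_compact_integrable; first exact: segment_compact.
exact: cst_continuous.
Qed.

Lemma ID a b f g : itg a b f -> itg a b g ->
  Int a b (fun x => f x + g x) = Int a b f + Int a b g.
Proof. by move=> fi gi; rewrite Int.unlock; exact: RintegralD. Qed.

Lemma IB a b f g : itg a b f -> itg a b g ->
  Int a b (fun x => f x - g x) = Int a b f - Int a b g.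
Proof. by move=> fi gi; rewrite Int.unlock; exact: RintegralB. Qed.

Lemma IZ a b k f : itg a b f -> Int a b (fun x => k * f x) = k * Int a b f.
Proof. by move=> fi; rewrite Int.unlock; exact: RintegralZl. Qed.

Lemma I0 a b : Int a b (fun=> 0) = 0.
Proof. by rewrite Int.unlock /Rintegral integral0. Qed.

Lemma I_ge0 a b f : (forall x, a <= x <= b -> 0 <= f x) -> 0 <= Int a b f.
Proof. by move=> f0; rewrite Int.unlock; apply: Rintegral_ge0 => x /=; rewrite in_itv /=; exact: f0. Qed.

Lemma le_I a b f g : itg a b f -> itg a b g ->
  (forall x, a <= x <= b -> f x <= g x) -> Int a b f <= Int a b g.
Proof. by move=> fi gi fg; rewrite Int.unlock; apply: le_Rintegral => // x /=; rewrite in_itv; exact: fg. Qed.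

Lemma I_norm a b f : itg a b f -> `|Int a b f| <= Int a b (fun x => `|f x|).
Proof. by move=> fi; rewrite Int.unlock; exact: le_normr_Rintegral. Qed.

Lemma I_point a f : Int a a f = 0.
Proof. by rewrite Int.unlock set_itv1 Rintegral_set1. Qed.

Lemma I_cst a b (k : R) : a <= b -> Int a b (fun=> k) = k * (b - a).
Proof.
rewrite le_eqVlt => /predU1P[->|ab]; first by rewrite I_point subrr mulr0.
by rewrite Int.unlock Rintegral_cst //= lebesgue_measure_itv /= lte_fin ab.
Qed.

Lemma I_split c a b f : a <= c -> c <= b -> itg a b f ->
  Int a b f = Int a c f + Int c b f.
Proof.
move=> ac cb fi; have /(_ _ _)/eqP := @Rintegral_itvB R f (BLeft a) (BRight b) c fi.
rewrite !bnd_simp subr_eq addrC => /(_ ac cb) /eqP.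
rewrite {1}Int.unlock => ->; rewrite Int.unlock; congr (_ + _); apply: Rintegral_itv_obnd_cbnd; apply: integrableS fi => //.
by apply: subset_itv; rewrite bnd_simp.
Qed.

Lemma I_empty a b f : b <= a -> Int a b f = 0.
Proof.
rewrite le_eqVlt => /predU1P[->|ba]; first exact: I_point.
by rewrite Int.unlock set_itv_ge ?Rintegral_set0 // bnd_simp -ltNge.
Qed.

Lemma itg_bnd a b f K : measurable_fun `[a, b] f ->
  (forall x, a <= x <= b -> `|f x| <= K) -> itg a b f.
Proof. by move=> mf fK; apply: le_itg fK _ => //; exact: itg_cst. Qed.

Definition sqi a b f := measurable_fun `[a, b] f /\ itg a b (fun x => f x ^+ 2).

Lemma sqiM a b f g : sqi a b f -> sqi a b g -> itg a b (fun x => f x * g x).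
Proof.
move=> [mf fi] [mg gi]; apply: (@le_itg _ _ _ (fun x => f x ^+ 2 + g x ^+ 2)).
- exact: measurable_funM.
- by move=> x _; rewrite ler_norml; apply/andP; split; nra.
- exact: itgD.
Qed.

Lemma sqi_cst a b k : sqi a b (fun=> k).
Proof. by split; [exact: measurable_cst|exact: itg_cst]. Qed.

Lemma sqi_itg a b f : sqi a b f -> itg a b f.
Proof.
move=> /sqiM /(_ (sqi_cst a b 1)); apply: eq_itg => x _; exact: mulr1.
Qed.

Lemma sqiD a b f g : sqi a b f -> sqi a b g -> sqi a b (fun x => f x + g x).
Proof.
move=> sf sg; split; first by apply: measurable_funD; [case: sf|case: sg].
have := itgD (itgD (proj2 sf) (proj2 sg)) (itgZ 2 (sqiM sf sg)).
by apply: eq_itg => x _; ring.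
Qed.

Lemma sqiZ a b k f : sqi a b f -> sqi a b (fun x => k * f x).
Proof.
move=> [mf fi]; split; first exact: (measurable_funM (measurable_cst _)).
by have := itgZ (k ^+ 2) fi; apply: eq_itg => x _; ring.
Qed.

Lemma sqiB a b f g : sqi a b f -> sqi a b g -> sqi a b (fun x => f x - g x).
Proof.
move=> sf sg; have := sqiD sf (sqiZ (-1) sg).
by rewrite (_ : (fun x => _) = fun x => f x - g x) //; apply/funext => x; ring.
Qed.

Lemma sqi_sub a b c d f : a <= c -> d <= b -> sqi a b f -> sqi c d f.
Proof.
move=> ac db [mf fi]; split; last exact: itg_sub fi.
by apply: measurable_funS mf => //; apply: subset_itv; rewrite bnd_simp.
Qed.

Lemma eq_sqi a b f g : (forall x, a <= x <= b -> f x = g x) -> sqi a b f -> sqi a b g.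
Proof.
move=> fg [mf fi]; split.
  apply: eq_measurable_fun mf => x; rewrite inE /= in_itv /=; exact: fg.
by apply: eq_itg fi => x /fg ->.
Qed.

Lemma cts_meas a b f : {within `[a, b], continuous f} -> measurable_fun `[a, b] f.
Proof. by move=> cf; apply: subspace_continuous_measurable_fun. Qed.

Lemma cts_itg a b f : {within `[a, b], continuous f} -> itg a b f.
Proof.
by move=> cf; apply: continuous_compact_integrable => //; exact: segment_compact.
Qed.

Lemma cts_sqi a b f : {within `[a, b], continuous f} -> sqi a b f.
Proof.
move=> cf; split; first exact: cts_meas.
by apply: cts_itg => x; apply: cvgM; exact: cf.
Qed.

Lemma I_primitive_cts a b f : a <= b -> itg a b f ->
  {within `[a, b], continuous (fun x => Int a x f)}.
Proof. by rewrite Int.unlock; exact: parameterized_integral_continuous. Qed.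

Lemma FTC2 a b F f : a <= b -> {within `[a, b], continuous f} ->
  (forall x, is_derive x 1 F (f x)) -> Int a b f = F b - F a.
Proof.
rewrite le_eqVlt => /predU1P[->|ab]; first by rewrite I_point subrr.
move=> cf dF; rewrite Int.unlock /Rintegral (@continuous_FTC2 R f F) //=.
- have cF x : {for x, continuous F}.
    by apply: differentiable_continuous; apply/derivable1_diffP; case: (dF x).
  split; first by move=> x _; case: (dF x).
  + exact: (cvg_at_right_filter (cF a)).
  + exact: (cvg_at_left_filter (cF b)).
- by move=> x _; rewrite derive1E; case: (dF x).
Qed.

Lemma FTC1c a f x u : a < x -> x < u -> {within `[a, u], continuous f} ->
  {for x, continuous f} -> is_derive x 1 (fun y => Int a y f) (f x).
Proof.
move=> ax xu cf fx.
have [d e] : derivable (fun y => Int a y f) x 1 /\ derive1 (fun y => Int a y f) x = f x.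
  by rewrite Int.unlock; exact: (continuous_FTC1_closed xu (cts_itg cf) ax fx).
exact: (DeriveDef d (etrans (esym (derive1E _ _)) e)).
Qed.

Lemma I_CauchySchwarz a b f : a <= b -> sqi a b f ->
  Int a b (fun x => `|f x|) ^+ 2 <= (b - a) * Int a b (fun x => f x ^+ 2).
Proof.
rewrite le_eqVlt => /predU1P[->|ab] sf.
  by rewrite !I_point subrr mul0r expr0n.
have fi := itg_norm (sqi_itg sf); have f2 := proj2 sf.
set A := Int a b _; have ba : 0 < b - a by rewrite subr_gt0.
(* The integrand is the expanded square of [|f x|] minus its mean value. *)
have : 0 <= Int a b (fun x => (f x ^+ 2 + (A / (b - a)) ^+ 2) -
                            (2 * (A / (b - a))) * `|f x|).
  apply: I_ge0 => x _; rewrite -(real_normK (num_real (f x))).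
  by have := sqr_ge0 (`|f x| - A / (b - a)); rewrite sqrrB; lra.
rewrite IB; [|by apply: itgD => //; exact: itg_cst|exact: itgZ].
rewrite ID //; last exact: itg_cst.
rewrite (IZ (2 * (A / (b - a)))) // I_cst -/A; last exact: ltW.
set B := Int a b (fun x => f x ^+ 2) => h.
have -> : A ^+ 2 = (b - a) * (A ^+ 2 / (b - a)) by field; lra.
rewrite ler_pM2l // -subr_ge0; apply: le_trans h _.
by rewrite le_eqVlt; apply/orP; left; apply/eqP; field; lra.
Qed.

(** Over [n] equal pieces the bounds telescope to [(b - a) / n * (Gam b - Gam a)], which is
    arbitrarily small. It replaces an argument by derivatives, which for primitives of
    square-integrable functions exist only almost everywhere. *)
Lemma constant_of_superlinear_increments (D Gam : R -> R) a b : a <= b ->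
  (forall x y, a <= x -> x <= y -> y <= b ->
    `|D y - D x| <= (y - x) * (Gam y - Gam x)) -> D b = D a.
Proof.
move=> ab DG; apply/eqP; rewrite -subr_eq0 -normr_le0; apply/ler_addgt0Pr => e e0.
rewrite add0r; set C := (b - a) * (Gam b - Gam a).
have [n nC] : exists n : nat, C / e < n.+1%:R.
  have [n] := @archimedean.Num.Theory.archi_boundP R `|C / e| (normr_ge0 _).
  exists (archimedean.Num.bound `|C / e|); apply: le_lt_trans (ler_norm _) _.
  rewrite (lt_trans (archimedean.Num.Theory.archi_boundP (normr_ge0 _))) //.
  by rewrite ltr_nat.
pose p k := a + k%:R * ((b - a) / n.+1%:R).
have n0 : (0 : R) < n.+1%:R by rewrite ltr0n.
have q0 : 0 <= (b - a) / n.+1%:R by rewrite divr_ge0 ?subr_ge0 // ltW.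
have pa k : a <= p k by rewrite lerDl mulr_ge0.
have pb k : (k <= n.+1)%N -> p k <= b.
  move=> kn; rewrite -lerBrDl mulrCA -{2}(mulr1 (b - a)) ler_wpM2l ?subr_ge0 //.
  by rewrite ler_pdivrMr // mul1r ler_nat.
have pS k : p k.+1 - p k = (b - a) / n.+1%:R by rewrite /p -natr1; ring.
have h k : (k <= n.+1)%N ->
    `|D (p k) - D a| <= (b - a) / n.+1%:R * (Gam (p k) - Gam a).
  elim: k => [|k IH] kn; first by rewrite /p mul0r addr0 !subrr normr0 mulr0.
  have pk : p k <= p k.+1 by rewrite -subr_ge0 pS.
  have := DG _ _ (pa k) pk (pb _ kn); rewrite pS; set q := (b - a) / _ in IH * => h1.
  have := IH (ltnW kn) => h2.
  have := ler_normD (D (p k.+1) - D (p k)) (D (p k) - D a).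
  by rewrite addrA subrK => h3; lra.
have pn : p n.+1 = b by rewrite /p; field; lra.
have := h _ (leqnn _); rewrite pn => /le_trans; apply.
rewrite mulrAC ler_pdivrMr // -ler_pdivrMl // mulrC -/C; exact: ltW.
Qed.

(** The difference of the two sides, as a function of [b], satisfies
    [constant_of_superlinear_increments]. *)
Lemma I_by_parts a b c d f g : a <= b -> sqi a b f -> sqi a b g ->
  Int a b (fun x => f x * (d + Int a x g)) + Int a b (fun x => (c + Int a x f) * g x) =
  (c + Int a b f) * (d + Int a b g) - c * d.
Proof.
move=> ab sf sg; set F := fun x => c + Int a x f; set G := fun x => d + Int a x g.
have sF : sqi a b F.
  apply: cts_sqi => x; apply: cvgD; first exact: cvg_cst.
  exact: (I_primitive_cts ab (sqi_itg sf)).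
have sG : sqi a b G.
  apply: cts_sqi => x; apply: cvgD; first exact: cvg_cst.
  exact: (I_primitive_cts ab (sqi_itg sg)).
pose D x := F x * G x - (Int a x (fun t => f t * G t) + Int a x (fun t => F t * g t)).
pose Gam x := Int a x (fun t => f t ^+ 2) + Int a x (fun t => g t ^+ 2).
have inc (h : R -> R) x y : a <= x -> x <= y -> y <= b -> itg a b h ->
    Int a y h - Int a x h = Int x y h.
  move=> ax xy yb hi; rewrite (@I_split x a y) //; [ring|exact: itg_sub hi].
have DE : D b = D a.
  apply: (@constant_of_superlinear_increments D Gam) => // x y ax xy yb.
  have sfx : sqi x y f by apply: sqi_sub sf.
  have sgx : sqi x y g by apply: sqi_sub sg.
  have sFx : sqi x y F by apply: sqi_sub sF.
  have sGx : sqi x y G by apply: sqi_sub sG.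
  have FE t : a <= t -> t <= y -> F y - F t = Int t y f.
    by move=> at_ ty; rewrite -(inc f t y) //; [rewrite /F; ring|exact: sqi_itg].
  have GE t : a <= t -> t <= y -> G y - G t = Int t y g.
    by move=> at_ ty; rewrite -(inc g t y) //; [rewrite /G; ring|exact: sqi_itg].
  have FxE t : x <= t -> t <= y -> F t - F x = Int x t f.
    move=> xt ty; rewrite -(inc f x t) //; [rewrite /F; ring|lra|exact: sqi_itg].
  (* The increment is of second order: [f] meets an increment of [G], and [g] an increment of
     [F]. *)
  have -> : D y - D x =
      Int x y (fun t => f t * (G y - G t)) + Int x y (fun t => g t * (F x - F t)).
    have -> : Int x y (fun t => f t * (G y - G t)) =
        G y * Int x y f - Int x y (fun t => f t * G t).
      rewrite -IZ -?IB; [|exact: itgZ (sqi_itg sfx)|exact: sqiM|exact: sqi_itg].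
      by apply: eq_I => t _; ring.
    have -> : Int x y (fun t => g t * (F x - F t)) =
        F x * Int x y g - Int x y (fun t => F t * g t).
      rewrite -IZ -?IB; [|exact: itgZ (sqi_itg sgx)|exact: sqiM|exact: sqi_itg].
      by apply: eq_I => t _; ring.
    rewrite /D -(FE x) // -(GE x) //.
    rewrite -(inc (fun t => f t * G t) x y) //; last exact: sqiM.
    rewrite -(inc (fun t => F t * g t) x y) //; last exact: sqiM.
    ring.
  pose A := Int x y (fun t => `|f t|); pose B := Int x y (fun t => `|g t|).
  have bound1 (h k : R -> R) : sqi x y h -> itg x y (fun t => h t * k t) ->
      forall K, (forall t, x <= t <= y -> `|k t| <= K) ->
      `|Int x y (fun t => h t * k t)| <= K * Int x y (fun t => `|h t|).
    move=> sh shk K kK; apply: le_trans (I_norm shk) _.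
    rewrite -IZ; last exact: itg_norm (sqi_itg sh).
    apply: le_I; [exact: itg_norm|exact: itgZ (itg_norm (sqi_itg sh))|].
    by move=> t tx; rewrite normrM mulrC ler_wpM2r // kK.
  have K1 t : x <= t <= y -> `|G y - G t| <= B.
    move=> /andP[xt ty]; rewrite GE //; last lra.
    have si : sqi t y g by apply: sqi_sub sg => //; lra.
    apply: le_trans (I_norm (sqi_itg si)) _.
    rewrite /B (@I_split t x y) // ?lerDr; last exact: itg_norm (sqi_itg sgx).
    by apply: I_ge0 => ? _.
  have K2 t : x <= t <= y -> `|F x - F t| <= A.
    move=> /andP[xt ty]; rewrite distrC FxE //.
    have si : sqi x t f by apply: sqi_sub sf => //; lra.
    apply: le_trans (I_norm (sqi_itg si)) _.
    rewrite /A (@I_split t x y) // ?lerDl; last exact: itg_norm (sqi_itg sfx).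
    by apply: I_ge0 => ? _.
  have b1 := bound1 f (fun t => G y - G t) sfx
    (sqiM sfx (sqiB (sqi_cst _ _ _) sGx)) _ K1.
  have b2 := bound1 g (fun t => F x - F t) sgx
    (sqiM sgx (sqiB (sqi_cst _ _ _) sFx)) _ K2.
  (* The increment is at most [2 A B <= A^2 + B^2], and Cauchy-Schwarz extracts the factor [y - x]
     from both squares. *)
  have cA := I_CauchySchwarz xy sfx; have cB := I_CauchySchwarz xy sgx.
  rewrite /Gam; have -> : forall u v w z : R, u + v - (w + z) = (u - w) + (v - z).
    by move=> *; ring.
  rewrite !inc //; [|exact: (proj2 sg)|exact: (proj2 sf)].
  apply: le_trans (ler_normD _ _) _; apply: le_trans (lerD b1 b2) _.
  rewrite -/A -/B mulrDr; apply: le_trans (lerD cA cB); rewrite -/A -/B.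
  by have := sqr_ge0 (A - B); rewrite sqrrB; lra.
have := DE; rewrite /D !I_point /F /G !I_point !addr0 => /eqP.
rewrite subr_eq => /eqP ->; ring.
Qed.

End Integral.

(** * Termwise integration of series *)

Section SeriesIntegral.
Context {R : realType}.
Implicit Types (a b : R).
Notation leb := (@lebesgue_measure R).

Lemma itg_ooP a b f : itg a b f <-> leb.-integrable `]a, b[ (EFin \o f).
Proof.
split; first by apply: integrableS => //; exact: subset_itv_oo_cc.
move=> /integrableP[mf foo].
have mc : measurable_fun `[a, b] (EFin \o f) by exact: emeasurable_fun_itv_cc mf.
apply/integrableP; split => //.
by rewrite integral_itv_bndoo //; exact: measurableT_comp.
Qed.

Lemma Int_oo a b f : measurable_fun `]a, b[ f ->
  Int a b f = \int[leb]_(x in `]a, b[) f x.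
Proof.
move=> mf; rewrite Int.unlock /Rintegral integral_itv_bndoo //.
exact/measurable_EFinP.
Qed.

(** Dominated convergence with the sum of the [|h k|] as majorant. Pointwise convergence is asked
    only inside the interval: in [control_integral] the series of traces is controlled only before
    the final time. *)
Lemma Int_series a b (h : nat -> R -> R) (H : R -> R) (A : R^nat) :
  (forall k, itg a b (h k)) ->
  (forall k, Int a b (fun x => `|h k x|) <= A k) -> cvgn (series A) ->
  (forall x, a < x < b -> series (fun k => h k x) @ \oo --> H x) ->
  itg a b H /\ series (fun k => Int a b (h k)) @ \oo --> Int a b H.
Proof.
move=> hi hA cA hH; pose D := `]a, b[%classic.
have mD : measurable D by exact: measurable_itv.
have A0 k : 0 <= A k by apply: le_trans (hA k); apply: I_ge0.
have hiD k : leb.-integrable D (EFin \o h k).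
  by apply: (integrableS _ _ _ (hi k)) => //; exact: subset_itv_oo_cc.
have mh k : measurable_fun D (h k).
  by have /(measurable_int leb)/measurable_EFinP := hiD k.
pose f_ n x := (series (fun k => h k x) n)%:E.
pose g x := (\sum_(k <oo) `|h k x|%:E)%E.
have mf_ n : measurable_fun D (f_ n).
  by apply/measurable_EFinP; apply: measurable_sum.
have mH : measurable_fun D H.
  apply: (@measurable_fun_cvg _ _ _ _ (fun n x => series (fun k => h k x) n)).
    by move=> n; apply: measurable_sum.
  by move=> x; rewrite /D /= in_itv /=; exact: hH.
have mn k : measurable_fun D (fun x => `|h k x|%:E).
  by apply/measurable_EFinP; exact: measurableT_comp.
have mg : measurable_fun D g.
  apply: ge0_emeasurable_sum => [k x _ _|k _]; first by rewrite lee_fin.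
  by apply/measurable_EFinP; exact: measurableT_comp.
have gi : leb.-integrable D g.
  apply/integrableP; split => //.
  under eq_integral => x _ do rewrite gee0_abs ?nneseries_ge0 //.
  rewrite (@integral_nneseries _ _ _ leb D mD (fun k x => `|h k x|%:E));
    [|exact: mn|by move=> k x _; rewrite lee_fin].
  apply: (@le_lt_trans _ _ (\sum_(k <oo) (A k)%:E)%E).
    apply: lee_nneseries => [k _ _|k _]; first by apply: integral_ge0 => x _; rewrite lee_fin.
    have := hA k; rewrite Int.unlock /Rintegral -lee_fin; apply: le_trans.
    rewrite fineK; last first.
      by apply: integrable_fin_num => //; exact: itg_norm (hi k).
    apply: ge0_subset_integral => //; last exact: subset_itv_oo_cc.
    by have /(measurable_int leb) := itg_norm (hi k).
  rewrite (_ : (fun n => _) = EFin \o series A); last first.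
    by apply/funext => n /=; rewrite sumEFin.
  by rewrite EFin_lim // ltry.
have dom : {ae leb, forall x n, D x -> (`|f_ n x| <= g x)%E}.
  apply: aeW => x n Dx; apply: (@le_trans _ _ (\sum_(0 <= k < n) `|h k x|%:E)%E).
    by rewrite sumEFin lee_fin ler_norm_sum.
  by apply: nneseries_lim_ge => k _; rewrite lee_fin.
have cvf : {ae leb, forall x, D x -> f_ ^~ x @ \oo --> (H x)%:E}.
  apply: aeW => x; rewrite /D /= in_itv /= => /hH cx.
  by apply: cvg_EFin; [exact: nearW|exact: cx].
have mEH : measurable_fun D (EFin \o H) by exact/measurable_EFinP.
have [HiD _ cI] := @dominated_convergence _ _ _ leb D mD f_ (EFin \o H) g mf_ mEH cvf gi dom.
have Hi : itg a b H by exact/itg_ooP.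
split => //; rewrite Int_oo // /Rintegral.
have -> : series (fun k => Int a b (h k)) = fine \o
    (fun n => \int[leb]_(x in D) f_ n x)%E.
  apply/funext => n /=; rewrite /f_ /series /=.
  under eq_integral => x _ do rewrite -sumEFin.
  rewrite integral_sum //.
  transitivity (\sum_(0 <= k < n) fine (\int[leb]_(x in D) (h k x)%:E)%E).
    by apply: eq_bigr => k _; rewrite Int_oo.
  rewrite sum_fine // => k _; apply: integrable_fin_num => //; exact: hiD.
apply: (@cvg_comp _ _ _ _ _ _ _ _ cI); apply: fine_cvg.
rewrite fineK; last exact: integrable_fin_num.
exact: cvg_id.
Qed.

End SeriesIntegral.

(** * The restricted Lebesgue measure and almost everywhere equality *)

Section Restriction.
Context {R : realType}.
Implicit Types (a b : R) (f g h : R -> R).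
Notation leb := (@lebesgue_measure R).

Lemma ae_impl (P Q : R -> Prop) : (forall x, P x -> Q x) ->
  {ae leb, forall x, P x} -> {ae leb, forall x, Q x}.
Proof.
by move=> PQ; apply: filterS PQ; exact: (ae_filter_ringOfSetsType leb).
Qed.

Lemma ae_impl2 (P1 P2 Q : R -> Prop) : (forall x, P1 x -> P2 x -> Q x) ->
  {ae leb, forall x, P1 x} -> {ae leb, forall x, P2 x} -> {ae leb, forall x, Q x}.
Proof.
by move=> PQ; apply: filterS2 PQ; exact: (ae_filter_ringOfSetsType leb).
Qed.

Lemma integral_mu_oo a b (f : R -> \bar R) : measurable_fun setT f ->
  (forall x, (0 <= f x)%E) ->
  (\int[mu_oo a b]_x f x = \int[leb]_(x in `]a, b[) f x)%E.
Proof.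
move=> mf f0; pose D := `]a, b[%classic.
have mD : measurable D by exact: measurable_itv.
have null : mu_oo a b (~` D) = 0%E.
  by rewrite /mu_oo /= /mrestr setICl measure0.
rewrite (@ge0_negligible_integral _ _ _ (mu_oo a b) setT (~` D)) //; last exact: measurableC.
rewrite setTD setCK; apply: eq_measure_integral => A mA AD.
by rewrite /mu_oo /= /mrestr setIidl.
Qed.

Lemma Rintegral_mu_oo a b (f : R -> R) : measurable_fun setT f ->
  \int[mu_oo a b]_x f x = Int a b f.
Proof.
move=> mf; rewrite Int_oo; last exact: measurable_funTS.
rewrite /Rintegral; congr fine.
have mE : measurable_fun setT (EFin \o f) by exact/measurable_EFinP.
rewrite integralE [RHS]integralE; congr (_ - _)%E;
  by apply: integral_mu_oo => //; [exact: measurable_funepos || exact: measurable_funeneg].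
Qed.

Lemma integrable_mu_oo a b (f : R -> R) : measurable_fun setT f ->
  (mu_oo a b).-integrable setT (EFin \o f) <-> itg a b f.
Proof.
move=> mf; rewrite itg_ooP; have mE : measurable_fun setT (EFin \o f).
  exact/measurable_EFinP.
have e : (\int[mu_oo a b]_x `|(EFin \o f) x| =
    \int[leb]_(x in `]a, b[) `|(EFin \o f) x|)%E.
  by apply: integral_mu_oo => //; exact: measurableT_comp.
split=> /integrableP[_ h]; apply/integrableP; split => //.
- exact: measurable_funTS.
- by rewrite -e.
- by rewrite e.
Qed.

Lemma ae_mu_ooP a b (P : R -> Prop) :
  {ae mu_oo a b, forall x, P x} <-> {ae leb, forall x, a < x < b -> P x}.
Proof.
pose D := `]a, b[%classic; have mD : measurable D by exact: measurable_itv.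
split=> -[A [mA A0 PA]].
- exists (A `&` D); split => //; first exact: measurableI.
  move=> x /= /not_implyP[xab nP]; split; first exact: PA.
  by rewrite /D /= in_itv.
- exists (A `|` ~` D); split.
  + by apply: measurableU => //; exact: measurableC.
  + rewrite /mu_oo /= /mrestr setIUl setICl setU0.
    apply/eqP; rewrite eq_le measure_ge0 andbT -A0.
    by apply: le_measure; rewrite ?inE //; exact: measurableI.
  + move=> x /= nP; have [xD|] := pselect (D x); last by right.
    left; apply: PA => /= h; apply: nP; apply: h.
    by move: xD; rewrite /D /= in_itv.
Qed.

Definition aeq a b f g := {ae leb, forall x, a < x < b -> f x = g x}.

Lemma aeqP a b f g : f = g %[ae mu_oo a b] <-> aeq a b f g.
Proof.
rewrite /aeq -(ae_mu_ooP a b (fun x => f x = g x)).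
by split=> -[A [mA A0 PA]]; exists A; split=> // x /= nP; apply: PA => h;
  apply: nP; [exact: h|move=> _; exact: h].
Qed.

Lemma aeq_refl a b f : aeq a b f f.
Proof. by apply: aeW => x _. Qed.

Lemma aeq_sym a b f g : aeq a b f g -> aeq a b g f.
Proof. by apply: ae_impl => x h /h. Qed.

Lemma aeq_trans a b f g h : aeq a b f g -> aeq a b g h -> aeq a b f h.
Proof. by apply: ae_impl2 => x h1 h2 xab; rewrite h1 // h2. Qed.

Lemma eq_aeq a b f g : (forall x, a < x < b -> f x = g x) -> aeq a b f g.
Proof. by move=> fg; apply: aeW. Qed.

Lemma aeq2 a b (j : R -> R -> R) f g f' g' : aeq a b f f' -> aeq a b g g' ->
  aeq a b (fun x => j (f x) (g x)) (fun x => j (f' x) (g' x)).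
Proof. by apply: ae_impl2 => x h1 h2 xab; rewrite h1 // h2. Qed.

Lemma Int_aeq a b f g : measurable_fun `[a, b] f -> measurable_fun `[a, b] g ->
  aeq a b f g -> Int a b f = Int a b g.
Proof.
move=> mf mg fg; have sub := @subset_itv_oo_cc _ R a b.
have mf' : measurable_fun `]a, b[ f by exact: measurable_funS mf.
have mg' : measurable_fun `]a, b[ g by exact: measurable_funS mg.
rewrite !Int_oo // /Rintegral; congr fine; apply: ae_eq_integral => //.
- exact/measurable_EFinP.
- exact/measurable_EFinP.
- by apply: ae_impl fg => x h /=; rewrite in_itv /= => /h ->.
Qed.

Lemma Int_sqr_eq0 a b f : sqi a b f -> Int a b (fun x => f x ^+ 2) = 0 ->
  aeq a b f (fun=> 0).
Proof.
move=> [mf fi] f0; have sub := @subset_itv_oo_cc _ R a b.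
have fi' : leb.-integrable `]a, b[ (fun x => (f x ^+ 2)%:E) by apply/itg_ooP.
have mf2 := measurable_int _ fi'.
have : (\int[leb]_(x in `]a, b[) `|(f x ^+ 2)%:E| = 0)%E.
  move: f0; rewrite Int_oo; last exact/measurable_EFinP.
  have -> : (\int[leb]_(x in `]a, b[) `|(f x ^+ 2)%:E| = \int[leb]_(x in `]a, b[) (f x ^+ 2)%:E)%E.
    by apply: eq_integral => x _; rewrite /= ger0_norm // sqr_ge0.
  rewrite /Rintegral => h.
  rewrite -[LHS]fineK ?h //; exact: integrable_fin_num.
move=> /(ae_eq_integral_abs _ _ _) => /(_ _ mf2) h.
have := h (measurable_itv _); apply: ae_impl => x /= + xab.
by rewrite in_itv /= xab => /(_ isT) [] /eqP; rewrite sqrf_eq0 => /eqP.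
Qed.

End Restriction.

(** * Square-integrable representatives *)

Section L2Elements.
Context {R : realType}.
Implicit Types (a b : R) (f g h : R -> R).

Lemma L2_meas a b (u : L2 a b) : measurable_fun setT u.
Proof. exact: measurable_funPT. Qed.

Lemma L2_sqi a b (u : L2 a b) : sqi a b u.
Proof.
have mu : measurable_fun setT u := L2_meas u.
split; first exact: measurable_funTS.
apply/integrable_mu_oo; first exact: measurable_funX.
exact: Lfun2_integrable_sqr (LfunP u).
Qed.

Lemma L2_of_sqi a b f : sqi a b f ->
  exists u : L2 a b, forall x, a <= x <= b -> u x = f x.
Proof.
move=> [mf fi]; pose D := `[a, b]%classic; pose g := f \_ D.
have mD : measurable D by exact: measurable_itv.
have mg : measurable_fun setT g by apply/(measurable_restrictT _ mD).
have gE x : a <= x <= b -> g x = f x.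
  by move=> xab; rewrite /g patchE mem_set //= /D /= in_itv.
have gi : itg a b (fun x => g x ^+ 2).
  by apply: eq_itg fi => x /gE ->.
have Lg : g \in Lfun (mu_oo a b) 2%:E.
  rewrite inE; apply/andP; split; rewrite inE //= /finite_norm Lnorm.unlock.
  apply: poweR_lty.
  have /integrable_mu_oo : measurable_fun setT (fun x => g x ^+ 2) by exact: measurable_funX.
  move=> /(_ a b) [_ /(_ gi) /integrableP[_]]; apply: le_lt_trans.
  rewrite le_eqVlt; apply/orP; left; apply/eqP; apply: eq_integral => x _ /=.
  by rewrite normrX powR_mulrn.
by exists (Lfun_Sub (lee1n 2) Lg) => x /gE <-.
Qed.

(** For square-integrable [f] the agreement is at every point of the closed interval, so that
    integrals rewrite pointwise; otherwise the value is 0. *)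
Definition toL2 a b f : L2 a b :=
  xget 0 [set u : L2 a b | forall x, a <= x <= b -> u x = f x].

Lemma toL2E a b f x : sqi a b f -> a <= x <= b -> toL2 a b f x = f x.
Proof.
move=> /L2_of_sqi [u uf] xab; rewrite /toL2.
by case: xgetP => [v -> vf|/(_ u)]; [exact: vf|case/(_ uf)].
Qed.

Lemma L2dotE a b (u v : L2 a b) : L2dot u v = Int a b (fun x => u x * v x).
Proof.
by rewrite /L2dot Rintegral_mu_oo //; apply: measurable_funM; exact: L2_meas.
Qed.

Lemma L2M_itg a b (u v : L2 a b) : itg a b (fun x => u x * v x).
Proof. by apply: sqiM; exact: L2_sqi. Qed.

Lemma L2dotC a b (u v : L2 a b) : L2dot u v = L2dot v u.
Proof. by rewrite !L2dotE; apply: eq_I => x _; rewrite mulrC. Qed.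

Lemma L2dot_linear a b k (u v w : L2 a b) :
  L2dot (k *: u + v) w = k * L2dot u w + L2dot v w.
Proof.
rewrite !L2dotE -IZ -?ID; [|exact: itgZ (L2M_itg _ _)|exact: L2M_itg|exact: L2M_itg].
by apply: eq_I => x _; transitivity ((k * u x + v x) * w x); [|ring].
Qed.

Lemma L2dot_ge0 a b (u : L2 a b) : 0 <= L2dot u u.
Proof. by rewrite L2dotE; apply: I_ge0 => x _; rewrite -expr2 sqr_ge0. Qed.

Lemma L2dot_eq0 a b (u : L2 a b) : L2dot u u = 0 -> aeq a b u (fun=> 0).
Proof. by rewrite L2dotE; exact: (Int_sqr_eq0 (L2_sqi u)). Qed.

Lemma L2dot_aeq a b (u u' v : L2 a b) : aeq a b u u' -> L2dot u v = L2dot u' v.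
Proof.
move=> uu; rewrite !L2dotE; apply: Int_aeq.
- by apply: measurable_funM; apply: measurable_funTS; exact: L2_meas.
- by apply: measurable_funM; apply: measurable_funTS; exact: L2_meas.
- by apply: (aeq2 (fun x y => x * y) uu); exact: aeq_refl.
Qed.

End L2Elements.

(** * Jets of derivatives, flat functions and Gevrey bounds *)

Section Jets.
Context {R : realType}.
Implicit Types (F G : nat -> R -> R) (P : R -> Prop).

(** A quadratic Taylor remainder is the form in which both flatness at 0 and differentiation of
    series become available. *)
Lemma is_derive_quadratic (f : R -> R) (x : R) l C d : 0 < d ->
  (forall h, `|h| < d -> `|f (x + h) - f x - h * l| <= C * h ^+ 2) ->
  is_derive x 1 f l.
Proof.
move=> d0 H.
suff cv : h^-1 *: (f (h *: 1 + x) - f x) @[h --> 0^'] --> l.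
  apply: DeriveDef; first by apply/cvg_ex; exists l; exact: cv.
  exact: cvg_lim cv.
apply/cvgrPdist_le => e e0.
near=> h.
have h0 : h != 0 by near: h; exact: nbhs_dnbhs_neq.
have hd : `|h| < d.
  near: h; apply: dnbhs0_lt; exact: d0.
have hC : `|h| <= e / (`|C| + 1).
  by near: h; apply: dnbhs0_le; rewrite divr_gt0 // ltr_wpDl.
rewrite -[h%:A]/(h * 1) mulr1 (addrC h).
have -> : l - h^-1 *: (f (x + h) - f x) = - (h^-1 * (f (x + h) - f x - h * l)).
  by rewrite -[h^-1 *: _]/(h^-1 * _); field.
rewrite normrN normrM normfV ler_pdivrMl ?normr_gt0 //.
apply: le_trans (H _ hd) _; rewrite -real_normK ?num_real // expr2 mulrCA.
rewrite ler_wpM2l //; apply: le_trans (_ : (`|C| + 1) * `|h| <= _).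
  rewrite ler_wpM2r //; apply: le_trans (ler_norm _) _; lra.
by rewrite -ler_pdivlMl ?ltr_wpDl // mulrC.
Unshelve. all: by end_near. Qed.

(** A smooth function travels with the explicit sequence of its derivatives, so that bounds on every
    order can be stated without iterating a derivation operator. *)
Definition jet P F := forall n t, P t -> is_derive t 1 (F n) (F n.+1 t).

Lemma is_derive_cvg (f : R -> R) (x : R) l :
  is_derive x 1 f l -> {for x, continuous f}.
Proof.
by case=> d _; apply: differentiable_continuous; apply/derivable1_diffP.
Qed.

Lemma dD (f g : R -> R) (x : R) a b : is_derive x 1 f a -> is_derive x 1 g b ->
  is_derive x 1 (fun t => f t + g t) (a + b).
Proof. exact: is_deriveD. Qed.

Lemma dN (f : R -> R) (x : R) a : is_derive x 1 f a ->
  is_derive x 1 (fun t => - f t) (- a).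
Proof. exact: is_deriveN. Qed.

Lemma dB (f g : R -> R) (x : R) a b : is_derive x 1 f a -> is_derive x 1 g b ->
  is_derive x 1 (fun t => f t - g t) (a - b).
Proof. exact: is_deriveB. Qed.

Lemma dM (f g : R -> R) (x : R) a b : is_derive x 1 f a -> is_derive x 1 g b ->
  is_derive x 1 (fun t => f t * g t) (f x * b + g x * a).
Proof. exact: is_deriveM. Qed.

Lemma dZ (f : R -> R) (x : R) k a : is_derive x 1 f a ->
  is_derive x 1 (fun t => k * f t) (k * a).
Proof. exact: is_deriveZ. Qed.

Lemma dC (x : R) k : is_derive x 1 (fun=> k : R) 0.
Proof. exact: is_derive_cst. Qed.

Lemma dI (x : R) : is_derive x 1 (fun t : R => t) 1.
Proof. exact: is_derive_id. Qed.

Lemma dX (f : R -> R) (x : R) n a : is_derive x 1 f a ->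
  is_derive x 1 (fun t => f t ^+ n) (n%:R * f x ^+ n.-1 * a).
Proof.
move=> df; elim: n => [|n IH]; first by rewrite !mul0r; exact: dC.
have -> : (fun t => f t ^+ n.+1) = (fun t => f t * f t ^+ n).
  by apply/funext => t; rewrite exprS.
apply: is_derive_eq (dM df IH) _; case: n {IH} => [|n] /=; first by ring.
by rewrite -(natr1 n.+1) exprS; ring.
Qed.

Lemma dcomp (f g : R -> R) (x : R) a b :
  is_derive (g x) 1 f a -> is_derive x 1 g b ->
  is_derive x 1 (fun t => f (g t)) (a * b).
Proof. exact: is_derive1_comp. Qed.

Lemma dinv (x : R) : x != 0 -> is_derive x 1 (fun t : R => t^-1) (- x ^- 2).
Proof.
move=> x0; apply: is_derive_eq; first exact: is_deriveV.
by rewrite -[_ *: _]/(_ * _) mulr1.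
Qed.

Lemma daffine (c d x : R) : is_derive x 1 (fun t : R => c * t + d) c.
Proof. by apply: is_derive_eq (dD (dZ c (dI x)) (dC x d)) _; ring. Qed.

Lemma jet_affine F c d : jet (fun=> True) F ->
  jet (fun=> True) (fun n t => c ^+ n * F n (c * t + d)).
Proof.
move=> jF n t _.
have := @dcomp (F n) (fun t => c * t + d) t _ _ (jF n _ Logic.I) (daffine c d t).
by move=> /(dZ (c ^+ n)) h; apply: is_derive_eq h _; rewrite exprS; ring.
Qed.

Definition jetM F G n t := \sum_(i < n.+1) 'C(n, i)%:R * (F i t * G (n - i)%N t).

(** Pascal's rule, giving the Leibniz formula one order at a time. *)
Lemma jetM_S F G n t : jetM F G n.+1 t =
  jetM (fun n => F n.+1) G n t + jetM F (fun n => G n.+1) n t.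
Proof.
rewrite /jetM big_ord_recl /= bin0 mul1r subn0.
under eq_bigr => i _ do rewrite /bump /= add1n binS natrD mulrDl subSS.
rewrite big_split /= addrA addrC; congr (_ + _); last first.
  rewrite [in RHS]big_ord_recl bin0 mul1r subn0; congr (_ + _).
  rewrite big_ord_recr /= (@bin_small n n.+1) // mul0r addr0.
  by apply: eq_bigr => i _; rewrite /bump /= add1n -subSn // subSS.
Qed.

Lemma jetM_jet P F G : jet P F -> jet P G -> jet P (jetM F G).
Proof.
move=> jF jG n t Pt; rewrite jetM_S /jetM -big_split /=.
rewrite (_ : (fun t => _) = \sum_(i < n.+1) (fun t =>
    'C(n, i)%:R * (F i t * G (n - i)%N t))); last first.
  by apply/funext => s; rewrite fct_sumE.
apply: is_derive_sum => i.
have h := dZ ('C(n, i)%:R) (dM (jF i t Pt) (jG (n - i)%N t Pt)).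
by apply: is_derive_eq h _; ring.
Qed.

(** [s ^ j e^(-s) / j!] at [s = 1 / t]; these functions are stable under
    differentiation, which gives the derivatives of [e^(-1/t)]. *)
Definition bump0 (j : nat) (t : R) : R :=
  if 0 < t then t^-1 ^+ j * expR (- t^-1) / j`!%:R else 0.

Lemma fact_gt0R n : 0 < n`!%:R :> R.
Proof. by rewrite ltr0n fact_gt0. Qed.

Lemma natrD_neq0 k j : k.+1%:R + j%:R != 0 :> R.
Proof. by rewrite -natrD pnatr_eq0. Qed.

Lemma ler_exprn_fact (x : R) n : 0 <= x -> x ^+ n / n`!%:R <= expR x.
Proof.
case: n => [|n] x0; first by rewrite expr0 fact0 divr1 -expR0 ler_expR.
by have := expR_ge1Dxn n x0; lra.
Qed.

Lemma bump0_ge0 j t : 0 <= bump0 j t.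
Proof.
rewrite /bump0; case: ifP => // t0.
by rewrite divr_ge0 ?mulr_ge0 ?exprn_ge0 ?invr_ge0 ?expR_ge0 // ltW // fact_gt0R.
Qed.

Lemma bump0_le1 j t : bump0 j t <= 1.
Proof.
rewrite /bump0; case: ifP => // t0; rewrite expRN.
rewrite mulrAC ler_pdivrMr ?expR_gt0 // mul1r ler_exprn_fact // invr_ge0 ltW //.
Qed.

Lemma bump0_norm_le1 j t : `|bump0 j t| <= 1.
Proof. by rewrite ger0_norm ?bump0_ge0 ?bump0_le1. Qed.

(** The factor [t ^+ 2] taken out is the quadratic remainder that gives the derivative at 0. *)
Lemma bump0_shift j t : bump0 j t = t ^+ 2 * ((j.+1 * j.+2)%:R * bump0 j.+2 t).
Proof.
rewrite /bump0; case: ifP => [t0|_]; last by rewrite !mulr0.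
rewrite !factS !natrM !exprS.
have t0' : t != 0 by rewrite gt_eqF.
have := fact_gt0R j; move=> ?; field.
by rewrite ?t0' ?gt_eqF //; repeat split; rewrite ?gt_eqF.
Qed.

Lemma bump0_deriv j (t : R) : is_derive t 1 (bump0 j)
  (- (j * j.+1)%:R * bump0 j.+1 t + (j.+1 * j.+2)%:R * bump0 j.+2 t).
Proof.
have [t0|t0|->] := ltgtP t 0.
- have -> : - (j * j.+1)%:R * bump0 j.+1 t + (j.+1 * j.+2)%:R * bump0 j.+2 t = 0.
    by rewrite /bump0 ltNge (ltW t0) /= !mulr0 addr0.
  apply: near_eq_is_derive (dC t 0).
  near=> s; have s0 : s < 0 by near: s; exact: lt_nbhsl.
  by rewrite /bump0 ltNge (ltW s0).
- pose f := fun s : R => s^-1 ^+ j * expR (- s^-1) * (j`!%:R)^-1.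
  apply: (@near_eq_is_derive _ _ _ f).
    near=> s; rewrite /bump0 ifT //; near: s; exact: lt_nbhsr.
  have t0' : t != 0 by rewrite gt_eqF.
  have de := @dcomp expR (fun s => - s^-1) t _ _ (is_derive_expR _)
    (dN (dinv t0')).
  have h := dZ (j`!%:R)^-1 (dM (dX j (dinv t0')) de).
  rewrite (_ : f = fun s => (j`!%:R)^-1 * (s^-1 ^+ j * expR (- s^-1))); last first.
    by apply/funext => s; rewrite /f mulrC.
  apply: is_derive_eq h _; rewrite /bump0 t0 -exprVn; move: (t^-1) => s.
  have jf := fact_gt0R j; case: j jf {f} => [|j] jf.
    by rewrite /= !factS fact0 !(mul0n, muln1) oppr0 !mul0r mulr0 add0r !expr0; field.
  rewrite /= !factS !natrM !exprS; have := fact_gt0R j => ?; field.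
  by apply/and4P; split; [rewrite gt_eqF|exact: (natrD_neq0 0)|exact: (natrD_neq0 1)|exact: (natrD_neq0 2)].
- have -> : - (j * j.+1)%:R * bump0 j.+1 0 + (j.+1 * j.+2)%:R * bump0 j.+2 0 = 0 :> R.
    by rewrite /bump0 ltxx !mulr0 addr0.
  apply: (@is_derive_quadratic _ _ _ (j.+1 * j.+2)%:R 1) => // h _.
  rewrite add0r mulr0 !subr0 {2}/bump0 ltxx subr0 bump0_shift normrM ger0_norm ?sqr_ge0 //.
  rewrite mulrC ler_wpM2r ?sqr_ge0 // normrM normr_nat -[leRHS]mulr1 ler_wpM2l //.
  exact: bump0_norm_le1.
Unshelve. all: by end_near. Qed.

(** The [n]-th derivative of [bump0 j], by iteration of [bump0_deriv]. *)
Fixpoint bump (n j : nat) (t : R) : R :=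
  if n is m.+1 then
    - (j * j.+1)%:R * bump m j.+1 t + (j.+1 * j.+2)%:R * bump m j.+2 t
  else bump0 j t.

Lemma bump_jet j : jet (fun=> True) (fun n => bump n j).
Proof.
move=> n t _; elim: n j => [|n IH] j /=; first exact: bump0_deriv.
exact: dD (dZ _ (IH j.+1)) (dZ _ (IH j.+2)).
Qed.

(** The weights of the recursion turn [(j+1)!] and [(j+2)!] in the denominators back into [j!]; both
    terms are then at most [2^n (2n+j+2)! / j!], and there are two of them. *)
Lemma bump_le n j t : `|bump n j t| <= 2 ^+ n * (n.*2 + j)`!%:R / j`!%:R.
Proof.
elim: n j => [|n IH] j.
  by rewrite expr0 mul1r add0n divff ?bump0_norm_le1 // gt_eqF // fact_gt0R.
apply: le_trans (ler_normD _ _) _; rewrite !normrM normrN !normr_nat.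
apply: le_trans (lerD (ler_wpM2l _ (IH j.+1)) (ler_wpM2l _ (IH j.+2))) _ => //.
have -> : (j * j.+1)%:R * (2 ^+ n * (n.*2 + j.+1)`!%:R / j.+1`!%:R) =
    2 ^+ n * (j%:R * (n.*2 + j.+1)`!%:R) / j`!%:R :> R.
  rewrite factS !natrM; have := fact_gt0R j => ?; field.
  by rewrite gt_eqF //= addrC natr1 pnatr_eq0.
have -> : (j.+1 * j.+2)%:R * (2 ^+ n * (n.*2 + j.+2)`!%:R / j.+2`!%:R) =
    2 ^+ n * (n.*2 + j.+2)`!%:R / j`!%:R :> R.
  rewrite !factS !natrM; have := fact_gt0R j => ?; field.
  by rewrite gt_eqF //= addrC natr1 pnatr_eq0 /= -[2]/(2%:R) -natrD pnatr_eq0.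
rewrite -mulrDl -mulrDr ler_wpM2r ?invr_ge0 ?(ltW (fact_gt0R _)) //.
rewrite exprS -mulrA mulrCA ler_wpM2l ?exprn_ge0 //.
rewrite doubleS !addSn !addnS mulr2n mulrDl mul1r lerD2r -natrM ler_nat.
by rewrite factS leq_mul2r; apply/orP; right; lia.
Qed.


(** Gevrey estimates of order 2, with [(2n)!] in place of [n! ^ 2]. *)
Definition gev P A r F := forall n t, P t -> `|F n t| <= A * r ^+ n * n.*2`!%:R.

Lemma gev_ge0 P A r F t : gev P A r F -> P t -> 0 <= A.
Proof.
move=> gF /(gF 0%N); rewrite expr0 mulr1 fact0 mulr1.
exact: le_trans.
Qed.

(** This is [C(i+j, i) <= C(2i+2j, 2i)] cleared of denominators: it absorbs the binomial
    coefficients of the Leibniz formula. *)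
Lemma double_fact_binom i j :
  (i.*2`! * j.*2`! * (i + j)`! <= (i + j).*2`! * (i`! * j`!))%N.
Proof.
elim: j => [|j IH]; first by rewrite double0 fact0 !addn0 !muln1 mulnC.
rewrite addnS !doubleS !factS.
set p := (i.*2)`! in IH *; set q := (j.*2)`! in IH *; set u := (i + j)`! in IH *.
set v := ((i + j).*2)`! in IH *; set w := i`! in IH *; set z := j`! in IH *.
have h : (j.*2.+1 * j.*2.+2 * (i + j).+1 <= (i + j).*2.+1 * (i + j).*2.+2 * j.+1)%N.
  nia.
have := leq_mul h IH; nia.
Qed.

(** Each of the [n + 1] Leibniz terms obeys the bound with the same ratio [r]; the doubling comes
    from [n + 1 <= 2 ^ n]. *)
Lemma jetM_gev P A B r F G : 0 <= r -> gev P A r F -> gev P B r G ->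
  gev P (A * B) (2 * r) (jetM F G).
Proof.
move=> r0 gF gG n t Pt; have A0 := gev_ge0 gF Pt; have B0 := gev_ge0 gG Pt.
apply: le_trans (ler_norm_sum _ _ _) _.
apply: (@le_trans _ _ (\sum_(i < n.+1) A * B * r ^+ n * n.*2`!%:R)).
  apply: ler_sum => i _; rewrite !normrM normr_nat.
  have ni : (i <= n)%N by rewrite -ltnS.
  apply: (@le_trans _ _ ('C(n, i)%:R * ((A * r ^+ i * i.*2`!%:R) *
      (B * r ^+ (n - i) * (n - i).*2`!%:R)))).
    by rewrite ler_wpM2l // ler_pM // ?gF ?gG.
  have -> : 'C(n, i)%:R * ((A * r ^+ i * i.*2`!%:R) *
      (B * r ^+ (n - i) * (n - i).*2`!%:R)) =
      A * B * r ^+ n * ('C(n, i)%:R * i.*2`!%:R * (n - i).*2`!%:R).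
    have -> : r ^+ n = r ^+ i * r ^+ (n - i) by rewrite -exprD subnKC.
    by ring.
  rewrite ler_wpM2l ?mulr_ge0 ?exprn_ge0 // -!natrM ler_nat.
  have := double_fact_binom i (n - i); rewrite subnKC // -(bin_fact ni).
  have : (0 < i`! * (n - i)`!)%N by rewrite muln_gt0 !fact_gt0.
  set c := 'C(n, i); set w := (i`! * _)%N; set p := (i.*2)`!; set q := (_.*2)`!.
  move=> w0 h; rewrite -(leq_pmul2r w0); nia.
rewrite sumr_const card_ord exprMn -[leLHS]mulr_natl.
have -> : A * B * (2 ^+ n * r ^+ n) * n.*2`!%:R = 2 ^+ n * (A * B * r ^+ n * n.*2`!%:R).
  by ring.
rewrite ler_wpM2r ?mulr_ge0 ?exprn_ge0 // -natrX ler_nat.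
exact: ltn_expl.
Qed.

(** An analytic bound is a Gevrey bound of order 2 with any ratio, since
    [(c / r)^n / n! <= e^(c / r)] and [n! n! <= (2n)!]. *)
Lemma gev_of_fact P A c r F : 0 <= c -> 0 < r ->
  (forall n t, P t -> `|F n t| <= A * c ^+ n * n`!%:R) ->
  gev P (A * expR (c / r)) r F.
Proof.
move=> c0 r0 AF n t Pt; have A0 : 0 <= A.
  by have := AF 0%N t Pt; rewrite expr0 mulr1 fact0 mulr1; exact: le_trans.
apply: le_trans (AF n t Pt) _.
have cr : 0 <= c / r by rewrite divr_ge0 // ltW.
have := ler_exprn_fact n cr; rewrite expr_div_n.
rewrite ler_pdivrMr ?fact_gt0R // ler_pdivrMr ?exprn_gt0 // => h.
have ff : (n`! * n`! <= n.*2`!)%N.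
  have := double_fact_binom n 0; rewrite -addnn => _.
  have := @bin_fact (n + n) n (leq_addr _ _); rewrite addnK => <-.
  by rewrite leq_pmull // bin_gt0 leq_addr.
have -> : A * c ^+ n * n`!%:R = A * n`!%:R * c ^+ n by ring.
have -> : A * expR (c / r) * r ^+ n * n.*2`!%:R = A * (expR (c / r) * r ^+ n * n.*2`!%:R).
  by ring.
rewrite -mulrA ler_wpM2l //.
apply: le_trans (_ : n`!%:R * (expR (c / r) * n`!%:R * r ^+ n) <= _).
  by rewrite ler_wpM2l.
have -> : n`!%:R * (expR (c / r) * n`!%:R * r ^+ n) =
   expR (c / r) * r ^+ n * (n`! * n`!)%:R by rewrite natrM; ring.
by rewrite ler_wpM2l ?ler_nat // mulr_ge0 ?expR_ge0 // exprn_ge0 // ltW.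
Qed.

End Jets.

(** * Differentiation of series and Gevrey cutoffs *)

Section SeriesDerivative.
Context {R : realType}.

Lemma taylor1_bound (F F1 F2 : R -> R) (A x h d : R) : `|h| < d ->
  (forall t, `|t - x| < d -> is_derive t 1 F (F1 t)) ->
  (forall t, `|t - x| < d -> is_derive t 1 F1 (F2 t)) ->
  (forall t, `|t - x| < d -> `|F2 t| <= A) ->
  `|F (x + h) - F x - h * F1 x| <= A * h ^+ 2.
Proof.
move=> hd dF dF1 bF2; have d0 : 0 < d by apply: le_lt_trans hd.
have A0 : 0 <= A by apply: le_trans (bF2 x _); rewrite ?subrr ?normr0.
(* The mean value theorem for end points in either order. The intermediate point is recorded to be
   no farther from [x] than they are, which gives the second factor [|h|] below. *)
have mvt (G G1 : R -> R) (u v : R) : `|u - x| < d -> `|v - x| < d ->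
    (forall t, `|t - x| < d -> is_derive t 1 G (G1 t)) ->
    exists2 c, (`|c - x| < d /\ `|c - x| <= Num.max `|u - x| `|v - x|) &
      G v - G u = G1 c * (v - u).
  move=> ud vd dG; wlog uv : u v ud vd / u <= v.
    move=> H; have [uv|/ltW vu] := leP u v; first exact: H.
    have [c] := H v u vd ud vu; rewrite maxC => hc e; exists c => //.
    by rewrite -opprB e; ring.
  have inx t : u <= t -> t <= v -> `|t - x| <= Num.max `|u - x| `|v - x|.
    move=> ut tv; have := ler_norm (v - x); have := ler_norm (x - u).
    rewrite distrC le_max => h1 h2; case: (lerP 0 (t - x)) => h3.
      by rewrite ger0_norm //; apply/orP; right; lra.
    by rewrite ltr0_norm //; apply/orP; left; lra.
  have ind t : u <= t -> t <= v -> `|t - x| < d.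
    by move=> ut tv; apply: le_lt_trans (inx t ut tv) _; rewrite gt_max ud vd.
  have [||c cuv e] := @MVT_segment _ G G1 u v uv.
  - by move=> t; rewrite in_itv /= => /andP[ut tv]; apply: dG; apply: ind; exact: ltW.
  - apply: derivable_within_continuous => t; rewrite in_itv /= => /andP[ut tv].
    by have [] := dG _ (ind t ut tv).
  by exists c => //; split; [apply: ind|apply: inx]; rewrite (itvP cuv).
have xd : `|x - x| < d by rewrite subrr normr0.
have xhd : `|x + h - x| < d by rewrite addrAC subrr add0r.
have [c [cd cm] e] := mvt F F1 x (x + h) xd xhd dF.
have [c' [cd' _] e'] := mvt F1 F2 x c xd cd dF1.
rewrite e [x + h - x]addrAC subrr add0r [F1 c * h]mulrC -mulrBr e'.
move: cm; rewrite subrr normr0 addrAC subrr add0r max_r // => cm.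
rewrite !normrM mulrCA -(real_normK (num_real h)) expr2.
by apply: ler_pM => //; [exact: bF2|rewrite ler_wpM2l].
Qed.

(** A summable bound is required on the second derivatives only: the Taylor remainders of the terms,
    at most [A k * h ^+ 2], sum to a quadratic remainder. *)
Lemma is_derive_series (F F1 F2 : nat -> R -> R) (A : R^nat) (x d : R) : 0 < d ->
  (forall k t, `|t - x| < d -> is_derive t 1 (F k) (F1 k t)) ->
  (forall k t, `|t - x| < d -> is_derive t 1 (F1 k) (F2 k t)) ->
  (forall k t, `|t - x| < d -> `|F2 k t| <= A k) -> cvgn (series A) ->
  (forall t, `|t - x| < d -> cvgn (series (fun k => F k t))) ->
  cvgn (series (fun k => F1 k x)) ->
  is_derive x 1 (fun t => limn (series (fun k => F k t)))
    (limn (series (fun k => F1 k x))).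
Proof.
move=> d0 dF dF1 bF2 cA cF cF1.
apply: (@is_derive_quadratic _ _ _ _ (limn (series A)) d) => // h hd.
have xd : `|x - x| < d by rewrite subrr normr0.
have xhd : `|x + h - x| < d by rewrite addrAC subrr add0r.
pose r k := F k (x + h) - F k x - h * F1 k x.
have rE : series r @ \oo --> limn (series (fun k => F k (x + h))) -
    limn (series (fun k => F k x)) - h * limn (series (fun k => F1 k x)).
  rewrite (_ : series r = fun n => series (fun k => F k (x + h)) n -
      series (fun k => F k x) n - h * series (fun k => F1 k x) n).
    exact: (cvgB (cvgB (cF _ xhd) (cF _ xd)) (cvgM (cvg_cst _) cF1)).
  by apply/funext => n; rewrite /series /= mulr_sumr -!sumrB.
rewrite -(cvg_lim _ rE) // mulrC.
have hA : series (fun k => h ^+ 2 * A k) @ \oo --> h ^+ 2 * limn (series A).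
  exact: lim_seriesMl.
rewrite -(cvg_lim _ hA) //; apply: lim_series_norm_le.
  move=> k; rewrite mulrC; apply: (taylor1_bound hd (dF k) (dF1 k) (bF2 k)).
by apply/cvg_ex; eexists; exact: hA.
Qed.

(** [Int a y] is 0 for [y <= a]; since [chi] vanishes up to a point beyond [a], the primitive is
    differentiable on the whole line, across [a] included. *)
Lemma is_derive_primitive (a c : R) (chi : R -> R) : continuous chi -> a < c ->
  (forall x, x < c -> chi x = 0) ->
  forall x : R, is_derive x 1 (fun y => Int a y chi) (chi x).
Proof.
move=> cc ac chi0 x; have [xc|cx] := ltP x c.
  rewrite chi0 //; apply: near_eq_is_derive (dC x 0); near=> y.
  have yc : y < c by near: y; exact: lt_nbhsl.
  by rewrite -(I0 a y); apply: eq_I => t /andP[_ ty]; rewrite chi0 // (le_lt_trans ty).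
apply: (@FTC1c _ a chi x (x + 1)).
- exact: lt_le_trans cx.
- by rewrite ltrDl.
- exact: continuous_subspaceT.
- exact: cc.
Unshelve. all: by end_near. Qed.

Lemma jet_continuous (F : nat -> R -> R) n : jet (fun=> True) F -> continuous (F n).
Proof. by move=> jF x; exact: is_derive_cvg (jF n x Logic.I). Qed.

Lemma bump_le0 n j (t : R) : t <= 0 -> bump n j t = 0.
Proof.
move=> t0; elim: n j => [|n IH] j /=; last by rewrite !IH !mulr0 addr0.
by rewrite /bump0 ltNge t0.
Qed.

Lemma bump0_gt0 j (t : R) : 0 < t -> 0 < bump0 j t.
Proof.
by move=> t0; rewrite /bump0 t0 divr_gt0 ?mulr_gt0 ?exprn_gt0 ?invr_gt0 ?expR_gt0 ?fact_gt0R.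
Qed.

(** The jet of [e^(-K/(t-p)) e^(-K/(q-t))], extended by 0 outside []p, q[]. The support does not
    depend on [K]: large [K] gives the small Gevrey ratio [4 / K], while small [K] brings the hump
    close to 1 inside, which approximates an indicator. *)
Definition hump (K p q : R) : nat -> R -> R :=
  jetM (fun n t => K^-1 ^+ n * bump n 0 (K^-1 * t + - p / K))
       (fun n t => (- K^-1) ^+ n * bump n 0 (- K^-1 * t + q / K)).

Lemma hump_jet K p q : jet (fun=> True) (hump K p q).
Proof. exact: jetM_jet (jet_affine _ _ (bump_jet 0)) (jet_affine _ _ (bump_jet 0)). Qed.

Lemma hump_gev K p q : 0 < K -> gev (fun=> True) 1 (4 / K) (hump K p q).
Proof.
move=> K0; have -> : 4 / K = 2 * (2 / K) by field; lra.
rewrite -[X in gev _ X](mulr1 1).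
have h (s : R) (u : R -> R) : `|s| = K^-1 ->
    gev (fun=> True) 1 (2 / K) (fun n t => s ^+ n * bump n 0 (u t)).
  move=> sK n t _; rewrite normrM normrX sK mul1r exprMn.
  have := bump_le n 0 (u t); rewrite addn0 fact0 divr1 => hb.
  rewrite [2 ^+ n * _]mulrC -mulrA ler_wpM2l // exprn_ge0 // invr_ge0 ltW //.
apply: jetM_gev; first by rewrite divr_ge0 // ltW.
- by apply: h; rewrite ger0_norm // invr_ge0 ltW.
- by apply: h; rewrite normrN ger0_norm // invr_ge0 ltW.
Qed.

Lemma hump_eq0 K p q n t : 0 < K -> t <= p \/ q <= t -> hump K p q n t = 0.
Proof.
move=> K0 h; rewrite /hump /jetM big1 // => i _; case: h => h.
- rewrite (@bump_le0 i) ?mulr0 ?mul0r ?mulr0 //.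
  by rewrite mulrC -mulrDl mulr_le0_ge0 ?invr_ge0 ?(ltW K0) //; lra.
- rewrite (@bump_le0 (n - i)) ?mulr0 //.
  by rewrite mulNr addrC mulrC -mulrBr mulr_ge0_le0 ?invr_ge0 ?(ltW K0) //; lra.
Qed.

Lemma hump0E K p q t : hump K p q 0%N t =
  bump0 0 (K^-1 * t + - p / K) * bump0 0 (- K^-1 * t + q / K).
Proof. by rewrite /hump /jetM big_ord1 /= bin0 !expr0 !mul1r. Qed.

Lemma hump0_gt0 K p q t : 0 < K -> p < t -> t < q -> 0 < hump K p q 0%N t.
Proof.
move=> K0 pt tq; rewrite hump0E mulr_gt0 // bump0_gt0 //.
- by rewrite mulrC -mulrDl mulr_gt0 ?invr_gt0 //; lra.
- by rewrite mulNr addrC mulrC -mulrBr mulr_gt0 ?invr_gt0 //; lra.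
Qed.

Lemma cutoff (K p q : R) : 0 < K -> p < q -> exists F : nat -> R -> R,
  [/\ jet (fun=> True) F, exists A, gev (fun=> True) A (4 / K) F,
      forall t, t <= p -> F 0%N t = 1, forall n t, t <= p -> F n.+1 t = 0
    & forall n t, q <= t -> F n t = 0].
Proof.
move=> K0 pq; pose b := hump K p q; pose J t := Int (p - 1) t (b 0%N).
have cb : continuous (b 0%N) by exact: jet_continuous (hump_jet K p q).
have dJ (t : R) : is_derive t 1 J (b 0%N t).
  apply: (@is_derive_primitive _ p) => //; first by lra.
  by move=> x xp; apply: hump_eq0 => //; left; exact: ltW.
have ib u v : itg u v (b 0%N) by apply: cts_itg; exact: continuous_subspaceT.
have b0 t : 0 <= b 0%N t.
  have [tp|pt] := leP t p; first by rewrite /b hump_eq0 //; left.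
  have [qt|tq] := leP q t; first by rewrite /b hump_eq0 //; right.
  by apply: ltW; exact: hump0_gt0.
have Jle u v : u <= v -> J u <= J v.
  move=> uv; have [up|pu] := leP u (p - 1).
    by rewrite /J (I_empty _ up); apply: I_ge0.
  rewrite /J (@I_split _ u (p - 1) v) //; last exact: ltW.
  by rewrite lerDl; apply: I_ge0.
have Jp t : t <= p -> J t = 0.
  move=> tp; rewrite -(I0 (p - 1) t) /J; apply: eq_I => x /andP[_ xt].
  by rewrite /b hump_eq0 //; left; exact: le_trans tp.
have Jq t : q <= t -> J t = J q.
  move=> qt; rewrite /J (@I_split _ q (p - 1) t) //; last by lra.
  rewrite -[RHS]addr0; congr (_ + _); rewrite -(I0 q t); apply: eq_I => x /andP[qx _].
  by rewrite /b hump_eq0 //; right.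
have Z0 : 0 < J q.
  have cJ : {within `[p, q], continuous J}.
    by apply: derivable_within_continuous => x _; have [] := dJ x.
  have [c cpq e] := MVT pq (fun x _ => dJ x) cJ.
  move: e; rewrite (Jp p) // subr0 => ->; rewrite mulr_gt0 ?subr_gt0 //.
  by move: cpq; rewrite in_itv /= => /andP[? ?]; exact: hump0_gt0.
pose F n t := if n is m.+1 then - (J q)^-1 * b m t else 1 - (J q)^-1 * J t.
exists F; split.
- move=> [|n] t _ /=; first by apply: is_derive_eq (dB (dC t 1) (dZ _ (dJ t))) _; ring.
  exact: dZ (hump_jet K p q n Logic.I).
- exists (1 + (J q)^-1 * (4 / K)^-1) => n t _.
  have K4 : 0 < 4 / K by rewrite divr_gt0.
  case: n => [|n] /=.
    rewrite expr0 mulr1 fact0 mulr1 ger0_norm; last first.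
      rewrite subr_ge0 mulrC ler_pdivrMr // mul1r.
      by have [tq|/ltW qt] := leP t q; [exact: Jle|rewrite (Jq t)].
    apply: (@le_trans _ _ 1); last by rewrite lerDl mulr_ge0 // invr_ge0 ltW.
    rewrite gerBl mulr_ge0 ?invr_ge0 ?(ltW Z0) //.
    by have [/Jp -> //|/ltW pt] := leP t p; rewrite -(Jp p) // Jle.
  rewrite normrM normrN normfV (gtr0_norm Z0).
  have hg : `|b n t| <= 1 * (4 / K) ^+ n * n.*2`!%:R by exact: hump_gev.
  rewrite mul1r in hg; move: (4 / K) K4 hg => r K4 hg.
  (* Derivative [n.+1] of the cutoff is derivative [n] of the hump, so one power of the ratio is
     paid back by [r^-1]. *)
  apply: (@le_trans _ _ ((J q)^-1 * r^-1 * r ^+ n.+1 * n.+1.*2`!%:R)).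
    rewrite exprS -!mulrA ler_wpM2l ?invr_ge0 ?(ltW Z0) //.
    rewrite mulKf ?gt_eqF //; apply: le_trans hg _.
    rewrite ler_wpM2l ?exprn_ge0 ?(ltW K4) // ler_nat.
    by apply: leq_fact; rewrite leq_double.
  by rewrite -[leLHS]mulrA -[leRHS]mulrA ler_wpM2r ?mulr_ge0 ?exprn_ge0 ?(ltW K4) // lerDr.
- by move=> t tp /=; rewrite (Jp t) // mulr0 subr0.
- by move=> n t tp /=; rewrite /b hump_eq0 ?mulr0 //; left.
- move=> [|n] t qt /=; last by rewrite /b hump_eq0 ?mulr0 //; right.
  by rewrite (Jq t) // mulVf ?subrr // gt_eqF.
Qed.

End SeriesDerivative.

(** * Weak derivatives and primitives *)

Section WeakDerivative.
Context {R : realType}.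
Implicit Types (a b c : R) (f g h : R -> R).
Notation leb := (@lebesgue_measure R).

Lemma Int_dominated a b (f_ : nat -> R -> R) f g :
  (forall n, measurable_fun `[a, b] (f_ n)) -> itg a b g ->
  (forall n x, a <= x <= b -> `|f_ n x| <= g x) ->
  (forall x, a < x < b -> f_ ^~ x @ \oo --> f x) ->
  (fun n => Int a b (f_ n)) @ \oo --> Int a b f.
Proof.
move=> mf_ gi fg ff; pose D := `]a, b[%classic.
have mD : measurable D by exact: measurable_itv.
have sub := @subset_itv_oo_cc _ R a b.
have mf n : measurable_fun D (f_ n) by exact: measurable_funS (mf_ n).
have mF : measurable_fun D f.
  by apply: (measurable_fun_cvg mf) => x; rewrite /D /= in_itv /=; exact: ff.
have mEf n : measurable_fun D (EFin \o f_ n) by exact/measurable_EFinP.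
have mEF : measurable_fun D (EFin \o f) by exact/measurable_EFinP.
have giD : leb.-integrable D (EFin \o g) by apply/itg_ooP.
have cvf : {ae leb, forall x, D x -> (fun n => (EFin \o f_ n) x) @ \oo --> (EFin \o f) x}.
  apply: aeW => x; rewrite /D /= in_itv /= => /ff cx.
  by apply: cvg_EFin; [exact: nearW|exact: cx].
have dom : {ae leb, forall x n, D x -> (`|(EFin \o f_ n) x| <= (EFin \o g) x)%E}.
  apply: aeW => x n; rewrite /D /= in_itv /= lee_fin => /andP[ax xb].
  by apply: fg; rewrite !ltW.
have [FiD _ cI] := @dominated_convergence _ _ _ leb D mD (fun n => EFin \o f_ n)
  (EFin \o f) (EFin \o g) mEf mEF cvf giD dom.
rewrite Int_oo // /Rintegral.
have -> : (fun n => Int a b (f_ n)) = fine \o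
    (fun n => \int[leb]_(x in D) (EFin \o f_ n) x)%E.
  by apply/funext => n /=; rewrite Int_oo.
apply: (@cvg_comp _ _ _ _ _ _ _ _ cI); apply: fine_cvg.
rewrite fineK; last exact: integrable_fin_num.
exact: cvg_id.
Qed.

Lemma cvg_bump0 (c : R) (s : nat -> R) : 0 < c -> (forall n, c * n%:R <= s n) ->
  (fun n => bump0 0 (s n)) @ \oo --> (1 : R).
Proof.
move=> c0 ns; apply/cvgrPdist_le => e e0.
near=> n; have n0 : (0 : R) < n%:R by rewrite ltr0n; near: n; exists 1%N.
have s0 : 0 < s n by apply: lt_le_trans (ns n); rewrite mulr_gt0.
rewrite /bump0 s0 expr0 mul1r fact0 divr1.
have h1 : expR (- (s n)^-1) <= 1 by rewrite -expR0 ler_expR oppr_le0 invr_ge0 ltW.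
have h2 := expR_ge1Dx (- (s n)^-1).
rewrite ger0_norm ?subr_ge0 //.
have : (s n)^-1 <= e.
  rewrite invf_ple ?posrE //; apply: le_trans (ns n).
  rewrite -ler_pdivrMl //.
  by near: n; exact: nbhs_infty_ger.
lra.
Unshelve. all: by end_near. Qed.

Lemma hump0_norm_le1 (K p q t : R) : `|hump K p q 0%N t| <= 1.
Proof.
by rewrite hump0E normrM -(mulr1 1) ler_pM // bump0_norm_le1.
Qed.

(** As [K] tends to 0 the humps, bounded by 1, converge to the indicator of []p, q[]; dominated
    convergence concludes. *)
Lemma Int_eq0_of_humps a b p q h : itg a b h -> a <= p -> p < q -> q <= b ->
  (forall K, 0 < K -> Int a b (fun x => h x * hump K p q 0%N x) = 0) ->
  Int p q h = 0.
Proof.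
move=> hi ap pq qb h0; have hpq : itg p q h by exact: itg_sub hi.
pose K (n : nat) : R := n.+1%:R^-1.
have K0 n : 0 < K n by rewrite invr_gt0 ltr0n.
have mm n : measurable_fun `[p, q] (fun x => h x * hump (K n) p q 0%N x).
  apply: measurable_funM; first exact: itg_meas hpq.
  apply: measurable_funTS; apply: continuous_measurable_fun.
  exact: jet_continuous (hump_jet _ _ _).
have bd n x : `|h x * hump (K n) p q 0%N x| <= `|h x|.
  by rewrite normrM ler_piMr // hump0_norm_le1.
have e n : Int p q (fun x => h x * hump (K n) p q 0%N x) = 0.
  have mi : itg a b (fun x => h x * hump (K n) p q 0%N x).
    apply: (@le_itg _ _ _ _ (fun x => `|h x|)) => //; last exact: itg_norm.
    apply: measurable_funM; first exact: itg_meas hi.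
    apply: measurable_funTS; apply: continuous_measurable_fun.
    exact: jet_continuous (hump_jet _ _ _).
  have := h0 _ (K0 n); rewrite (I_split ap _ mi) ?(ltW (lt_le_trans pq _)) //.
  rewrite (@I_split _ q p b) //; [|exact: ltW|exact: itg_sub mi].
  rewrite (_ : Int a p _ = 0) ?add0r; last first.
    rewrite -(I0 a p); apply: eq_I => x /andP[_ xp].
    by rewrite hump_eq0 ?mulr0 //; left.
  rewrite (_ : Int q b _ = 0) ?addr0 //.
  rewrite -(I0 q b); apply: eq_I => x /andP[qx _].
  by rewrite hump_eq0 ?mulr0 //; right.
have /cvg_lim <- // : (fun n => Int p q (fun x => h x * hump (K n) p q 0%N x)) @ \oo
    --> Int p q h.
  apply: (Int_dominated (g := fun x => `|h x|)) => //; first exact: itg_norm.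
  move=> x /andP[px xq]; rewrite -[X in _ --> X]mulr1.
  apply: cvgM; first exact: cvg_cst.
  rewrite (_ : (fun n => _) = fun n => bump0 0 ((K n)^-1 * x + - p / K n) *
      bump0 0 (- (K n)^-1 * x + q / K n)); last by apply/funext => n; rewrite hump0E.
  rewrite -[X in _ --> X]mulr1; apply: cvgM.
  - apply: (@cvg_bump0 (x - p)) => [|n]; first by rewrite subr_gt0.
    rewrite /K invrK [leRHS](_ : _ = (x - p) * n.+1%:R); last by ring.
    by rewrite ler_pM2l ?subr_gt0 // ler_nat.
  - apply: (@cvg_bump0 (q - x)) => [|n]; first by rewrite subr_gt0.
    rewrite /K invrK [leRHS](_ : _ = (q - x) * n.+1%:R); last by ring.
    by rewrite ler_pM2l ?subr_gt0 // ler_nat.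
by rewrite (funext e) lim_cst.
Qed.

(** The primitive of [h] is constant inside the interval, and by Lebesgue differentiation its
    derivative is [h] almost everywhere. *)
Lemma aeq0_of_Int0 a b h : a < b -> itg a b h ->
  (forall p q, a < p -> p < q -> q < b -> Int p q h = 0) -> aeq a b h (fun=> 0).
Proof.
move=> ab hi h0; pose D := `[a, b]%classic; pose f := h \_ D.
have mD : measurable D by exact: measurable_itv.
have fE x : a <= x <= b -> f x = h x.
  by move=> xab; rewrite /f patchE mem_set //= /D /= in_itv.
have fi : leb.-integrable setT (EFin \o f).
  have := proj1 (@integrable_mkcond _ _ R leb D (EFin \o h) mD) hi.
  by rewrite restrict_EFin.
have fl : locally_integrable setT f by exact: open_integrable_locally openT fi.
have fi' y : leb.-integrable [set` Interval (BLeft a) (BRight y)] (EFin \o f).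
  exact: integrableS fi.
have := FTC1 fi' fl; apply: ae_impl => x /= + /andP[ax xb].
move=> /(_ ax) [_]; rewrite -fE ?(ltW ax) ?(ltW xb) // => <-.
rewrite derive1E; have -> : 0 = 'D_1 (cst (Int a x f)) x :> R by rewrite derive_cst.
apply: near_eq_derive; near=> y.
have ay : a < y by near: y; exact: lt_nbhsr.
have yb : y < b by near: y; exact: lt_nbhsl.
have fI u v : itg u v f by exact: integrableS fi.
have main u v : a < u -> u <= v -> v < b -> Int a v f = Int a u f.
  move=> au; rewrite le_eqVlt => /predU1P[-> //|uv] vb.
  rewrite (@I_split _ u a v) //; [|exact: ltW|exact: ltW].
  rewrite -[RHS]addr0; congr (_ + _); rewrite -[RHS](h0 u v au uv vb).
  apply: eq_I => t /andP[ut tv]; rewrite fE //.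
  by rewrite (ltW (lt_le_trans au ut)) (ltW (le_lt_trans tv vb)).
rewrite /= -[LHS]/(\int[leb]_(t in `[a, y]) f t).
have -> : \int[leb]_(t in `[a, y]) f t = Int a y f by rewrite Int.unlock.
by have [xy|/ltW yx] := leP x y; [exact: main|rewrite (main y x)].
Unshelve. all: by end_near. Qed.

Lemma derive1n_jet (F : nat -> R -> R) n : jet (fun=> True) F ->
  derive1n n (F 0%N) = F n.
Proof.
move=> jF; elim: n => [//|n IH]; rewrite derive1nS IH; apply/funext => x.
by rewrite derive1E; have [_ ->] := jF n x Logic.I.
Qed.

Lemma test_of_jet a b (F : nat -> R -> R) c d : jet (fun=> True) F ->
  a < c -> d < b -> (forall x, x <= c \/ d <= x -> F 0%N x = 0) -> test_fun a b (F 0%N).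
Proof.
move=> jF ac db F0; split=> [n x|].
  by rewrite derive1n_jet //; have [] := jF n x Logic.I.
exists c, d; split=> // x; rewrite in_itv /= negb_and -!ltNge => /orP[h|h].
- by apply: F0; left; exact: ltW.
- by apply: F0; right; exact: ltW.
Qed.

Lemma test_derive a b phi : test_fun a b phi ->
  [/\ forall x : R, is_derive x 1 phi (derive1 phi x), continuous phi &
      continuous (derive1 phi)].
Proof.
move=> [sm _]; split.
- by move=> x; apply: DeriveDef; [exact: (sm 0%N)|rewrite derive1E].
- by move=> x; apply: differentiable_continuous; apply/derivable1_diffP; exact: (sm 0%N).
- by move=> x; apply: differentiable_continuous; apply/derivable1_diffP; exact: (sm 1%N).
Qed.

Lemma weak_derivP a b (u g : L2 a b) : weak_deriv u g <->
  forall phi, test_fun a b phi ->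
    Int a b (fun x => u x * derive1 phi x) = - Int a b (fun x => g x * phi x).
Proof.
split=> H phi tphi; have [_ c1 c2] := test_derive tphi; move: (H phi tphi);
  rewrite !Rintegral_mu_oo //; apply: measurable_funM; try exact: L2_meas;
  exact: continuous_measurable_fun.
Qed.

Lemma weak_deriv_primitive a b c (u g : L2 a b) : a < b ->
  aeq a b u (fun x => c + Int a x g) -> weak_deriv u g.
Proof.
move=> ab uE; apply/weak_derivP => phi tphi.
have [d1 c1 c2] := test_derive tphi.
have [_ [c' [d [ac db ph0]]]] := tphi.
have cw (k : R -> R) u' v : continuous k -> {within `[u', v], continuous k}.
  exact: continuous_subspaceT.
have pa x : a <= x -> 0 + Int a x (derive1 phi) = phi x.
  move=> ax; rewrite (@FTC2 _ a x phi) //; last exact: cw.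
  by rewrite (ph0 a) ?subr0 ?add0r // in_itv /= negb_and -ltNge ac.
have sg := L2_sqi g; have gi := sqi_itg sg.
have := I_by_parts c 0 (ltW ab) sg (cts_sqi (cw _ a b c2)).
rewrite pa ?(ltW ab) // (ph0 b) ?mulr0 ?subr0; last first.
  by rewrite in_itv /= negb_and -(ltNge d) db orbT.
rewrite (@eq_I _ _ _ (fun x => g x * _) (fun x => g x * phi x)); last first.
  by move=> x /andP[ax _]; rewrite pa.
move=> e; apply/eqP; rewrite -addr_eq0 addrC -[X in _ == X]e; apply/eqP; congr (_ + _).
have md : measurable_fun `[a, b] (derive1 phi).
  by apply: measurable_funTS; exact: continuous_measurable_fun.
apply: Int_aeq.
- by apply: measurable_funM => //; apply: measurable_funTS; exact: L2_meas.
- apply: measurable_funM => //; apply: cts_meas => x.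
  by apply: cvgD; [exact: cvg_cst|exact: (I_primitive_cts (ltW ab) gi)].
- by apply: (aeq2 (fun x y => x * y) uE); exact: aeq_refl.
Qed.

(** Du Bois-Reymond's lemma: [u] minus the primitive of [g] is orthogonal to the derivatives of test
    functions, hence to every bump of integral 0, hence constant. *)
Lemma weak_deriv_inv a b (u g : L2 a b) : a < b -> weak_deriv u g ->
  exists c, aeq a b u (fun x => c + Int a x g).
Proof.
move=> ab /weak_derivP wd; pose l := (b - a) / 4.
have l0 : 0 < l by rewrite divr_gt0 // subr_gt0.
have lE : b = a + 4 * l by rewrite /l; field.
have [//|F [jF _ F1 F0 F2]] := @cutoff R 1 (a + l) (a + 2 * l) ltr01; first by lra.
(* Minus the derivative of a cutoff is a smooth function of integral 1 supported inside []a, b[]. *)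
pose th n x := - F n.+1 x.
have jth : jet (fun=> True) th by move=> n x _; exact: dN (jF n.+1 x Logic.I).
have cj (G : nat -> R -> R) n u' v : jet (fun=> True) G -> {within `[u', v], continuous (G n)}.
  by move=> jG; apply: continuous_subspaceT; exact: jet_continuous.
have thI x : a <= x -> Int a x (th 0%N) = 1 - F 0%N x.
  move=> ax; have -> : Int a x (th 0%N) = - F 0%N x - - F 0%N a.
    apply: (@FTC2 _ a x (fun t => - F 0%N t)) ax (cj _ _ _ _ jth) _ => t.
    exact: dN (jF 0%N t Logic.I).
  by rewrite (F1 a); [ring|lra].
have sg := L2_sqi g; have su := L2_sqi u.
pose G x := 0 + Int a x g.
have cG : {within `[a, b], continuous G}.
  move=> x; apply: cvgD; first exact: cvg_cst.
  exact: (I_primitive_cts (ltW ab) (sqi_itg sg)).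
pose k x := u x - G x; have sk : sqi a b k by apply: sqiB => //; exact: cts_sqi.
pose c := Int a b (fun x => k x * th 0%N x).
exists c; suff : aeq a b (fun x => k x - c) (fun=> 0).
  apply: ae_impl => x h xab; have := h xab; rewrite /k /G add0r => /eqP.
  by rewrite subr_eq add0r subr_eq => /eqP.
have skc : sqi a b (fun x => k x - c) by apply: sqiB => //; exact: sqi_cst.
apply: aeq0_of_Int0 => //; first exact: sqi_itg.
move=> p q ap pq qb; apply: (Int_eq0_of_humps (sqi_itg skc) (ltW ap) pq (ltW qb)).
move=> K K0; pose psi := hump K p q; pose m := Int a b (psi 0%N).
have jpsi : jet (fun=> True) psi by exact: hump_jet.
(* Removing [m] times [th] makes the integral vanish, so that the primitive of [chi] is compactly
   supported and may serve as a test function. *)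
pose chi n x := psi n x - m * th n x.
have jchi : jet (fun=> True) chi.
  by move=> n x _; exact: dB (jpsi n x Logic.I) (dZ m (jth n x Logic.I)).
pose e := Num.min (a + l) p; pose e' := Num.max (a + 2 * l) q.
have ae : a < e by rewrite lt_min ap andbT; lra.
have eb : e' < b by rewrite gt_max qb andbT; lra.
have chi0 n x : x <= e \/ e' <= x -> chi n x = 0.
  rewrite le_min ge_max => -[/andP[h1 h2]|/andP[h1 h2]]; rewrite /chi /th.
    by rewrite F0 // /psi hump_eq0 ?oppr0 ?mulr0 ?subr0 //; left.
  by rewrite F2 // /psi hump_eq0 ?oppr0 ?mulr0 ?subr0 //; right.
pose Phi n x := if n is n'.+1 then chi n' x else Int a x (chi 0%N).
have cchi : continuous (chi 0%N) by exact: jet_continuous.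
have jPhi : jet (fun=> True) Phi.
  move=> [|n] x _ /=; last exact: jchi.
  by apply: (is_derive_primitive cchi ae) => y ye; apply: chi0; left; exact: ltW.
have ith : itg a b (th 0%N) by apply: cts_itg; exact: cj.
have ipsi : itg a b (psi 0%N) by apply: cts_itg; exact: cj.
have chiI : Int a b (chi 0%N) = 0.
  rewrite /chi IB //; last exact: itgZ.
  rewrite IZ // thI ?(ltW ab) // F2; last by lra.
  by rewrite subr0 mulr1 /m subrr.
have tPhi : test_fun a b (Phi 0%N).
  apply: (@test_of_jet _ _ _ e e') => // x [xe|ex] /=.
    have [xa|/ltW ax] := leP x a; first exact: I_empty.
    rewrite -(I0 a x); apply: eq_I => y /andP[_ yx]; apply: chi0; left.
    exact: le_trans xe.
  have [bx|/ltW xb] := leP b x.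
    rewrite (@I_split _ b a x) ?(ltW ab) // ?chiI ?add0r; last first.
      by apply: cts_itg; exact: cj.
    rewrite -(I0 b x); apply: eq_I => y /andP[by_ _]; apply: chi0; right.
    exact: le_trans (ltW eb) by_.
  have ax : a <= x.
    by apply: le_trans ex; rewrite le_max; apply/orP; right; exact/ltW/(lt_trans ap).
  have := chiI; rewrite (@I_split _ x a b) //; last by apply: cts_itg; exact: cj.
  rewrite (_ : Int x b _ = 0) ?addr0 //.
  rewrite -(I0 x b); apply: eq_I => y /andP[xy _]; apply: chi0; right.
  exact: le_trans xy.
have dPhi : derive1 (Phi 0%N) = chi 0%N by exact: (derive1n_jet 1 jPhi).
have := wd _ tPhi; rewrite dPhi => uchi.
have schi : sqi a b (chi 0%N) by apply: cts_sqi; exact: cj.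
have := I_by_parts 0 0 (ltW ab) sg schi; rewrite chiI addr0 mulr0 mul0r subr0 => ibp.
have kchi : Int a b (fun x => k x * chi 0%N x) = 0.
  have -> : Int a b (fun x => k x * chi 0%N x) =
      Int a b (fun x => u x * chi 0%N x) - Int a b (fun x => G x * chi 0%N x).
    rewrite -IB; [|exact: sqiM|by apply: sqiM => //; exact: cts_sqi].
    by apply: eq_I => x _; rewrite /k; ring.
  rewrite uchi; move: ibp => /eqP; rewrite addr_eq0 => /eqP ibp.
  rewrite -[Int a b (fun x => G x * _)]opprK -[- Int a b (fun x => G x * _)]ibp.
  rewrite opprK -[RHS](addNr (Int a b (fun x => g x * Phi 0%N x))); congr (- _ + _).
  by apply: eq_I => x _; rewrite add0r.
have spsi : sqi a b (psi 0%N) by apply: cts_sqi; exact: cj.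
have sth : sqi a b (th 0%N) by apply: cts_sqi; exact: cj.
rewrite -[RHS]kchi -/psi.
rewrite (@eq_I _ _ _ (fun x => (k x - c) * psi 0%N x)
   (fun x => k x * psi 0%N x - c * psi 0%N x)); last by move=> x _; ring.
rewrite IB ?IZ //; [|exact: sqiM|exact: itgZ].
rewrite [RHS](@eq_I _ _ _ _ (fun x => k x * psi 0%N x - m * (k x * th 0%N x))); last first.
  by move=> x _; rewrite /chi; ring.
rewrite IB ?IZ //; [|exact: sqiM|exact: sqiM|by apply: itgZ; exact: sqiM].
by rewrite -/m -/c; ring.
Qed.

End WeakDerivative.

(** * Continuous representatives and traces *)

Section Traces.
Context {R : realType}.
Implicit Types (a b c : R) (f g h U V : R -> R).

Lemma within_cts_ball a b f x e : {within `[a, b], continuous f} ->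
  a <= x <= b -> 0 < e ->
  exists2 d, 0 < d & forall y, a <= y <= b -> `|x - y| < d -> `|f x - f y| < e.
Proof.
move=> cf xab e0.
have xA : `[a, b]%classic x by rewrite /= in_itv.
have /subspace_continuousP/(_ x xA) := cf.
move=> /cvgrPdist_lt /(_ e e0); rewrite near_withinE => -[d /= d0 H].
by exists d => // y yab xy; apply: H => //=; rewrite in_itv.
Qed.

Lemma cts_aeq_eq a b U V x : a < b -> {within `[a, b], continuous U} ->
  {within `[a, b], continuous V} -> aeq a b U V -> a <= x <= b -> U x = V x.
Proof.
move=> ab cU cV UV xab; apply/eqP; rewrite -subr_eq0; apply/negPn/negP => n0.
pose W y := U y - V y; have cW : {within `[a, b], continuous W}.
  by move=> y; apply: cvgB; [exact: cU|exact: cV].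
pose e := `|W x|; have e0 : 0 < e / 2 by rewrite divr_gt0 // normr_gt0.
have [d d0 H] := within_cts_ball cW xab e0.
(* The neighbourhood is cut at [a] and [b], since [x] may be an end point; it keeps a positive
   length. *)
pose p := Num.max a (x - d / 2); pose q := Num.min b (x + d / 2).
have pq : p < q.
  by rewrite gt_max !lt_min; apply/andP; split; apply/andP; split; lra.
have ap : a <= p by rewrite le_max lexx.
have qb : q <= b by rewrite ge_min lexx.
have sW : sqi p q W by apply: sqi_sub ap qb _; exact: cts_sqi.
have i0 : Int p q (fun y => W y ^+ 2) = 0.
  rewrite -(I0 p q); apply: Int_aeq.
  - by apply: measurable_funX; case: sW.
  - exact: measurable_cst.
  - apply: ae_impl UV => y h /andP[py yq]; rewrite /W h ?subrr ?expr0n //.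
    by rewrite (le_lt_trans ap py) (lt_le_trans yq qb).
have : (e / 2) ^+ 2 * (q - p) <= 0.
  rewrite -i0 -I_cst ?(ltW pq) //; apply: le_I; [exact: itg_cst|by case: sW|].
  move=> y /andP[py yq]; rewrite -(real_normK (num_real (W y))) lerXn2r ?nnegrE ?(ltW e0) //.
  have yab : a <= y <= b by rewrite (le_trans ap py) (le_trans yq qb).
  have xy : `|x - y| < d.
    move: py yq; rewrite /p /q ge_max le_min => /andP[_ h1] /andP[_ h2].
    by rewrite ltr_norml; apply/andP; split; lra.
  have := H y yab xy; have := ler_normD (W x - W y) (W y); rewrite subrK -/e; lra.
by rewrite leNgt mulr_gt0 // ?exprn_gt0 // subr_gt0.
Qed.

Lemma traceE a b (u : L2 a b) U x : a < b -> {within `[a, b], continuous U} ->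
  aeq a b u U -> a <= x <= b -> trace u x = U x.
Proof.
move=> ab cU uU xab; rewrite /trace.
case: xgetP => [c -> [V [cV /aeqP uV <-]]|/(_ (U x)) []].
  by apply: (cts_aeq_eq ab cV cU) => //; apply: aeq_trans uU; exact: aeq_sym.
by exists U; split => //; apply/aeqP.
Qed.

Lemma cts_prim a b c g : a <= b -> sqi a b g ->
  {within `[a, b], continuous (fun x => c + Int a x g)}.
Proof.
move=> ab sg x; apply: cvgD; first exact: cvg_cst.
exact: (I_primitive_cts ab (sqi_itg sg)).
Qed.

Lemma prim_inj a b c c' g g' : a < b -> sqi a b g -> sqi a b g' ->
  aeq a b (fun x => c + Int a x g) (fun x => c' + Int a x g') ->
  aeq a b g g' /\ c = c'.
Proof.
move=> ab sg sg' e; have ab' := ltW ab.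
have E x : a <= x <= b -> c + Int a x g = c' + Int a x g'.
  by apply: (cts_aeq_eq ab _ _ e); exact: cts_prim.
have cc : c = c' by have := E a; rewrite lexx ab' => /(_ isT); rewrite !I_point !addr0.
split=> //; have sd : sqi a b (fun x => g x - g' x) by exact: sqiB.
suff h : aeq a b (fun x => g x - g' x) (fun=> 0).
  by apply: ae_impl h => x h xab; apply/eqP; rewrite -subr_eq0; apply/eqP/h.
apply: aeq0_of_Int0 => //; first exact: sqi_itg.
move=> p q ap pq qb; have spq f : sqi a b f -> itg p q f.
  by move=> sf; apply: sqi_itg; apply: sqi_sub sf; exact: ltW.
rewrite IB ?spq //.
have P f : sqi a b f -> Int p q f = Int a q f - Int a p f.
  move=> sf; rewrite (@I_split _ p a q) ?(ltW ap) ?(ltW pq) //; first by ring.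
  by apply: sqi_itg; apply: sqi_sub sf => //; exact: ltW.
rewrite !P //; have := E p; have := E q; rewrite (ltW ap) (ltW qb).
rewrite (ltW (lt_trans ap pq)) (ltW (lt_trans pq qb)) cc => /(_ isT) h1 /(_ isT) h2.
lra.
Qed.

Lemma Int_eq_aeq a b g g' x : a <= x <= b -> sqi a b g -> sqi a b g' ->
  aeq a b g g' -> Int a x g = Int a x g'.
Proof.
move=> /andP[ax xb] [mg _] [mg' _] e.
have sub : `[a, x]%classic `<=` `[a, b]%classic by apply: subset_itv; rewrite bnd_simp.
apply: Int_aeq; [exact: measurable_funS mg|exact: measurable_funS mg'|].
by apply: ae_impl e => y h /andP[ay yx]; apply: h; rewrite ay (lt_le_trans yx).
Qed.

(** With [H1_elim], this reduces weak derivatives and traces, both chosen by [xget], to primitives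
    [c + Int a x g], the only form used afterwards. *)
Lemma H1_intro a b (u : L2 a b) c g : a < b -> sqi a b g ->
  aeq a b u (fun x => c + Int a x g) ->
  [/\ H1 u, aeq a b (wderiv u) g &
      forall x, a <= x <= b -> trace u x = c + Int a x g].
Proof.
move=> ab sg ug; have ab' := ltW ab.
have sL := L2_sqi (toL2 a b g).
have gE x : a <= x <= b -> c + Int a x g = c + Int a x (toL2 a b g).
  move=> /andP[ax xb]; congr (_ + _); apply: eq_I => y /andP[ay yx].
  by rewrite toL2E // ay (le_trans yx).
have wd : weak_deriv u (toL2 a b g).
  apply: (@weak_deriv_primitive _ _ _ c) => //; apply: aeq_trans ug _.
  by apply: eq_aeq => x /andP[ax xb]; rewrite gE // !ltW.
have h1 : H1 u by exists (toL2 a b g).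
split => //.
- have wd' : weak_deriv u (wderiv u).
    by rewrite /wderiv; case: xgetP => [v _ //|/(_ (toL2 a b g))].
  have [c' uc'] := weak_deriv_inv ab wd'.
  have := prim_inj ab (L2_sqi _) sg (aeq_trans (aeq_sym uc') ug).
  by case.
- move=> x xab; exact: (traceE ab (cts_prim ab' sg) ug xab).
Qed.

Lemma H1_elim a b (u : L2 a b) : a < b -> H1 u ->
  aeq a b u (fun x => trace u a + Int a x (wderiv u)) /\
  forall x, a <= x <= b -> trace u x = trace u a + Int a x (wderiv u).
Proof.
move=> ab [g wd]; have ab' := ltW ab.
have wd' : weak_deriv u (wderiv u).
  by rewrite /wderiv; case: xgetP => [v _ //|/(_ g)].
have [c uc] := weak_deriv_inv ab wd'.
have tr x : a <= x <= b -> trace u x = c + Int a x (wderiv u).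
  by move=> xab; exact: (traceE ab (cts_prim ab' (L2_sqi _)) uc xab).
have ca : trace u a = c by rewrite tr ?lexx // I_point addr0.
by rewrite ca.
Qed.

End Traces.

(** * Inner product and norm of the state space *)

Section HilbertSpace.
Context {R : realType}.

Lemma L2dot_aeq2 (a b : R) (u u' v v' : L2 a b) : aeq a b u u' -> aeq a b v v' ->
  L2dot u v = L2dot u' v'.
Proof. by move=> h1 h2; rewrite (L2dot_aeq _ h1) L2dotC (L2dot_aeq _ h2) L2dotC. Qed.

Implicit Types (x y w : H R) (k : R).

Lemma Hdot_linear k x y w : Hdot (k *: x + y) w = k * Hdot x w + Hdot y w.
Proof.
rewrite /Hdot -[Hu (k *: x + y)]/(k *: Hu x + Hu y) -[Hv (k *: x + y)]/(k *: Hv x + Hv y).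
rewrite -[Hz (k *: x + y)]/(k * Hz x + Hz y) !L2dot_linear.
move: (L2dot _ _) (L2dot _ _) (L2dot _ _) (L2dot _ _) => ? ? ? ?; ring.
Qed.

Lemma HdotC x y : Hdot x y = Hdot y x.
Proof. by rewrite /Hdot L2dotC (L2dotC (Hv x)) (mulrC (Hz x)). Qed.

Lemma HdotD x y w : Hdot (x + y) w = Hdot x w + Hdot y w.
Proof. by rewrite -[x]scale1r Hdot_linear mul1r scale1r. Qed.

Lemma Hdot0 w : Hdot 0 w = 0.
Proof. by have := HdotD 0 0 w; rewrite addr0 => h; lra. Qed.

Lemma HdotZ k x w : Hdot (k *: x) w = k * Hdot x w.
Proof. by rewrite -[k *: x]addr0 Hdot_linear Hdot0 addr0. Qed.

Lemma HdotN x w : Hdot (- x) w = - Hdot x w.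
Proof. by rewrite -scaleN1r HdotZ mulN1r. Qed.

Lemma HdotB x y w : Hdot (x - y) w = Hdot x w - Hdot y w.
Proof. by rewrite HdotD HdotN. Qed.

Lemma HdotBr x y w : Hdot w (x - y) = Hdot w x - Hdot w y.
Proof. by rewrite !(HdotC w) HdotB. Qed.

Lemma HdotDr x y w : Hdot w (x + y) = Hdot w x + Hdot w y.
Proof. by rewrite !(HdotC w) HdotD. Qed.

Lemma HdotZr k x w : Hdot w (k *: x) = k * Hdot w x.
Proof. by rewrite !(HdotC w) HdotZ. Qed.

Lemma Hdot_ge0 x : 0 <= Hdot x x.
Proof. by rewrite /Hdot !addr_ge0 ?L2dot_ge0 // -expr2 sqr_ge0. Qed.

Lemma Hdot_eq0 x : Hdot x x = 0 -> Heq x 0.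
Proof.
have h1 := L2dot_ge0 (Hu x); have h2 := L2dot_ge0 (Hv x); have h3 := sqr_ge0 (Hz x).
rewrite /Hdot -expr2 => h; split.
- by apply/aeqP; apply: L2dot_eq0; lra.
- by apply/aeqP; apply: L2dot_eq0; lra.
- by have : Hz x ^+ 2 = 0 by [lra]; move=> /eqP; rewrite sqrf_eq0 => /eqP ->.
Qed.

Lemma Heq_refl x : Heq x x.
Proof. by split => //; apply/aeqP; exact: aeq_refl. Qed.

Lemma Heq_sym x y : Heq x y -> Heq y x.
Proof. by move=> [/aeqP h1 /aeqP h2 h3]; split=> //; apply/aeqP; exact: aeq_sym. Qed.

Lemma Heq_trans x y w : Heq x y -> Heq y w -> Heq x w.
Proof.
move=> [/aeqP h1 /aeqP h2 h3] [/aeqP g1 /aeqP g2 g3].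
by split; [apply/aeqP; exact: aeq_trans g1|apply/aeqP; exact: aeq_trans g2|rewrite h3].
Qed.

Lemma Heq_lin k x x' y y' : Heq x x' -> Heq y y' -> Heq (k *: x + y) (k *: x' + y').
Proof.
move=> [/aeqP h1 /aeqP h2 h3] [/aeqP g1 /aeqP g2 g3].
split; last by rewrite -[LHS]/(k * Hz x + Hz y) h3 g3.
- by apply/aeqP; exact: (aeq2 (fun s t => k * s + t) h1 g1).
- by apply/aeqP; exact: (aeq2 (fun s t => k * s + t) h2 g2).
Qed.

Lemma HeqD x x' y y' : Heq x x' -> Heq y y' -> Heq (x + y) (x' + y').
Proof. by move=> h1 h2; have := Heq_lin 1 h1 h2; rewrite !scale1r. Qed.

Lemma HeqZ k x x' : Heq x x' -> Heq (k *: x) (k *: x').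
Proof. by move=> h1; have := Heq_lin k h1 (Heq_refl 0); rewrite !addr0. Qed.

Lemma HeqB x x' y y' : Heq x x' -> Heq y y' -> Heq (x - y) (x' - y').
Proof. by move=> h1 h2; have := HeqD h1 (HeqZ (-1) h2); rewrite !scaleN1r. Qed.

Lemma Hdot_Heq x x' w : Heq x x' -> Hdot x w = Hdot x' w.
Proof.
move=> [/aeqP h1 /aeqP h2 h3]; rewrite /Hdot.
by rewrite (L2dot_aeq _ h1) (L2dot_aeq _ h2) h3.
Qed.

Lemma Hdot_Heq2 x x' w w' : Heq x x' -> Heq w w' -> Hdot x w = Hdot x' w'.
Proof. by move=> h1 h2; rewrite (Hdot_Heq _ h1) HdotC (Hdot_Heq _ h2) HdotC. Qed.

Lemma Heq_of_sub x y : Heq (x - y) 0 -> Heq x y.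
Proof. by move=> h; have := HeqD h (Heq_refl y); rewrite subrK add0r. Qed.

Lemma Hdot_CS x y : Hdot x y ^+ 2 <= Hdot x x * Hdot y y.
Proof.
have [/eqP y0|yn0] := boolP (Hdot y y == 0).
  by rewrite HdotC (Hdot_Heq _ (Hdot_eq0 y0)) Hdot0 y0 mulr0 expr0n.
have yy : 0 < Hdot y y by rewrite lt_def yn0 Hdot_ge0.
have := Hdot_ge0 (Hdot y y *: x - Hdot x y *: y).
rewrite !(HdotB, HdotBr, HdotZ, HdotZr) (HdotC y x) => h.
rewrite -subr_ge0 -(pmulr_rge0 _ yy); apply: le_trans h _.
by rewrite le_eqVlt; apply/orP; left; apply/eqP; ring.
Qed.

Lemma Hnorm_ge0 x : 0 <= Hnorm x.
Proof. exact: sqrtr_ge0. Qed.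

Lemma HnormE x : Hnorm x ^+ 2 = Hdot x x.
Proof. by rewrite sqr_sqrtr // Hdot_ge0. Qed.

Lemma Hdot_le x y : `|Hdot x y| <= Hnorm x * Hnorm y.
Proof.
rewrite -ler_sqr ?nnegrE ?mulr_ge0 ?Hnorm_ge0 //.
by rewrite real_normK ?num_real // exprMn !HnormE Hdot_CS.
Qed.

Lemma HnormD x y : Hnorm (x + y) <= Hnorm x + Hnorm y.
Proof.
rewrite -ler_sqr ?nnegrE ?addr_ge0 ?Hnorm_ge0 // sqrrD !HnormE.
rewrite HdotD !HdotDr (HdotC y x); have := Hdot_le x y; have := ler_norm (Hdot x y).
lra.
Qed.

Lemma HnormZ k x : Hnorm (k *: x) = `|k| * Hnorm x.
Proof.
apply/eqP; rewrite -(@eqrXn2 _ 2) ?mulr_ge0 ?Hnorm_ge0 //.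
by rewrite exprMn !HnormE HdotZ HdotZr real_normK ?num_real // mulrA.
Qed.

Lemma HnormN x : Hnorm (- x) = Hnorm x.
Proof. by rewrite -scaleN1r HnormZ normrN1 mul1r. Qed.

Lemma HnormB x y : Hnorm (x - y) = Hnorm (y - x).
Proof. by rewrite -HnormN opprB. Qed.

Lemma Hnorm_Heq x y : Heq x y -> Hnorm x = Hnorm y.
Proof. by move=> h; rewrite /Hnorm (Hdot_Heq2 h h). Qed.

Lemma Hnorm_eq0 x : Hnorm x = 0 -> Heq x 0.
Proof. by move=> h; apply: Hdot_eq0; rewrite -HnormE h expr0n. Qed.

Lemma Hnorm0 : Hnorm (0 : H R) = 0.
Proof. by rewrite /Hnorm Hdot0 sqrtr0. Qed.

Definition mkH (f g : R -> R) (z : R) : H R := (toL2 (-1) 0 f, toL2 0 1 g, z).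

Lemma Hdot_mkH x f g z : sqi (-1) 0 f -> sqi 0 1 g ->
  Hdot x (mkH f g z) = Int (-1) 0 (fun t => Hu x t * f t) +
    Int 0 1 (fun t => Hv x t * g t) + Hz x * z.
Proof.
move=> sf sg; rewrite /Hdot !L2dotE; congr (_ + _ + _).
- by apply: eq_I => t tI; rewrite toL2E.
- by apply: eq_I => t tI; rewrite toL2E.
Qed.

Lemma Hdot_mkH2 f g z f' g' z' : sqi (-1) 0 f -> sqi 0 1 g ->
  sqi (-1) 0 f' -> sqi 0 1 g' ->
  Hdot (mkH f g z) (mkH f' g' z') = Int (-1) 0 (fun t => f t * f' t) +
    Int 0 1 (fun t => g t * g' t) + z * z'.
Proof.
move=> sf sg sf' sg'; rewrite Hdot_mkH //; congr (_ + _ + _).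
- by apply: eq_I => t tI; rewrite toL2E.
- by apply: eq_I => t tI; rewrite toL2E.
Qed.

Lemma Heq_mkH x f g z : sqi (-1) 0 f -> sqi 0 1 g ->
  aeq (-1) 0 (Hu x) f -> aeq 0 1 (Hv x) g -> Hz x = z -> Heq x (mkH f g z).
Proof.
move=> sf sg h1 h2 h3; split=> //; apply/aeqP.
- apply: aeq_trans h1 _; apply: eq_aeq => t /andP[t1 t2].
  by rewrite toL2E // !ltW.
- apply: aeq_trans h2 _; apply: eq_aeq => t /andP[t1 t2].
  by rewrite toL2E // !ltW.
Qed.

End HilbertSpace.

(** * Coordinates on the energy space *)

Section EnergySpace.
Context {R : realType}.
Implicit Types (x y : H R) (bc : boundary).

(** An element of the energy space is encoded by the pair of its weak
    derivatives, integrated from the Dirichlet end [-1]. *)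
Definition PW : Type := (L2 (-1 : R) 0 * L2 (0 : R) 1)%type.
HB.instance Definition _ := GRing.Lmodule.on PW.
Implicit Types (p q : PW).

Definition pdot p q := L2dot p.1 q.1 + L2dot p.2 q.2.
(** The leading [0 +] keeps the shape [c + Int a x g] of [cts_prim] and [I_by_parts]. Starting [JV]
    from [JU p 0] builds in the junction conditions [u(0) = v(0) = z]. *)
Definition JU p (t : R) := 0 + Int (-1) t p.1.
Definition JV p (t : R) := JU p 0 + Int 0 t p.2.
Definition J p : H R := mkH (JU p) (JV p) (JU p 0).

Lemma ltN10 : (-1 : R) < 0. Proof. by rewrite oppr_lt0. Qed.
Lemma leN10 : (-1 : R) <= 0. Proof. exact: ltW ltN10. Qed.

Lemma JU_cts p : {within `[(-1 : R), 0], continuous (JU p)}.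
Proof. exact: (cts_prim leN10 (L2_sqi p.1)). Qed.

Lemma JV_cts p : {within `[(0 : R), 1], continuous (JV p)}.
Proof. exact: (cts_prim ler01 (L2_sqi p.2)). Qed.

Lemma JU_sqi p : sqi (-1) 0 (JU p). Proof. exact: cts_sqi (@JU_cts p). Qed.
Lemma JV_sqi p : sqi 0 1 (JV p). Proof. exact: cts_sqi (@JV_cts p). Qed.

Lemma pdot_linear k p q r : pdot (k *: p + q) r = k * pdot p r + pdot q r.
Proof.
rewrite /pdot -[(k *: p + q).1]/(k *: p.1 + q.1) -[(k *: p + q).2]/(k *: p.2 + q.2).
rewrite !L2dot_linear.
move: (L2dot _ _) (L2dot _ _) (L2dot _ _) (L2dot _ _) => ? ? ? ?; ring.
Qed.

Lemma pdotC p q : pdot p q = pdot q p.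
Proof. by rewrite /pdot L2dotC (L2dotC p.2). Qed.

Lemma pdotD p q r : pdot (p + q) r = pdot p r + pdot q r.
Proof. by rewrite -[p]scale1r pdot_linear mul1r scale1r. Qed.

Lemma pdot0 r : pdot 0 r = 0.
Proof. by have := pdotD 0 0 r; rewrite addr0 => h; lra. Qed.

Lemma pdot_ge0 p : 0 <= pdot p p.
Proof. by rewrite addr_ge0 // L2dot_ge0. Qed.

Lemma L2_lin_itg (a b k c d : R) (u v : L2 a b) : a <= c -> d <= b ->
  Int c d (k *: u + v) = k * Int c d u + Int c d v.
Proof.
move=> ac db; have iu : itg c d u by apply: itg_sub ac db _; exact: sqi_itg (L2_sqi u).
have iv : itg c d v by apply: itg_sub ac db _; exact: sqi_itg (L2_sqi v).
by rewrite -IZ // -ID //; exact: itgZ.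
Qed.

Lemma JU_linear k p q t : -1 <= t -> t <= 0 -> JU (k *: p + q) t = k * JU p t + JU q t.
Proof.
move=> t1 t0; rewrite /JU -[(k *: p + q).1]/(k *: p.1 + q.1) L2_lin_itg //; ring.
Qed.

Lemma JV_linear k p q t : 0 <= t -> t <= 1 -> JV (k *: p + q) t = k * JV p t + JV q t.
Proof.
move=> t1 t0; rewrite /JV JU_linear ?leN10 // -[(k *: p + q).2]/(k *: p.2 + q.2).
rewrite L2_lin_itg //; ring.
Qed.

Lemma J_linear k p q : Heq (J (k *: p + q)) (k *: J p + J q).
Proof.
split; last by rewrite -[LHS]/(JU _ 0) JU_linear // leN10.
- apply/aeqP; apply: eq_aeq => t /andP[/ltW t1 /ltW t0].
  transitivity (k * toL2 (-1) 0 (JU p) t + toL2 (-1) 0 (JU q) t); last by [].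
  by rewrite -[LHS]/(toL2 (-1) 0 (JU _) t) !toL2E ?t1 ?t0 //; [exact: JU_linear|..]; exact: JU_sqi.
- apply/aeqP; apply: eq_aeq => t /andP[/ltW t1 /ltW t0].
  transitivity (k * toL2 0 1 (JV p) t + toL2 0 1 (JV q) t); last by [].
  by rewrite -[LHS]/(toL2 0 1 (JV _) t) !toL2E ?t1 ?t0 //; [exact: JV_linear|..]; exact: JV_sqi.
Qed.

(** The one condition of the energy space that the encoding by [J] does not enforce. *)
Definition Wp bc p : Prop := bc = Dirichlet -> JV p 1 = 0.

Lemma Wp_linear bc k p q : Wp bc p -> Wp bc q -> Wp bc (k *: p + q).
Proof. by move=> hp hq h; rewrite JV_linear // hp // hq // mulr0 addr0. Qed.

Lemma inW_elim bc x : inW bc x ->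
  [/\ Heq x (J (wderiv (Hu x), wderiv (Hv x))), Wp bc (wderiv (Hu x), wderiv (Hv x))
    & Wnorm x ^+ 2 = pdot (wderiv (Hu x), wderiv (Hv x)) (wderiv (Hu x), wderiv (Hv x))].
Proof.
move=> [[h1 h2] t1 t0 t0' tD]; set p : PW := (wderiv (Hu x), wderiv (Hv x)).
have [a1 e1] := H1_elim ltN10 h1; have [a2 e2] := H1_elim ltr01 h2.
have z0 : JU p 0 = Hz x by rewrite -t0 e1 ?leN10 ?lexx // t1.
split.
- apply: Heq_mkH; [exact: JU_sqi|exact: JV_sqi| | |by rewrite z0].
  + by move: a1; rewrite t1.
  + by move: a2; rewrite t0' -z0.
- by move=> /tD; rewrite e2 ?ler01 ?lexx // t0' -z0.
- by rewrite sqr_sqrtr // addr_ge0 // L2dot_ge0.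
Qed.

Lemma inW_intro bc p x : Heq x (J p) -> Wp bc p ->
  [/\ inW bc x, Wnorm x ^+ 2 = pdot p p, aeq (-1) 0 (wderiv (Hu x)) p.1
    & aeq 0 1 (wderiv (Hv x)) p.2].
Proof.
move=> [/aeqP xu /aeqP xv xz] hp.
have uE : aeq (-1) 0 (Hu x) (JU p).
  apply: aeq_trans xu _; apply: eq_aeq => t /andP[/ltW t1 /ltW t0].
  by rewrite -[LHS]/(toL2 (-1) 0 (JU p) t) toL2E ?t1 ?t0 //; exact: JU_sqi.
have vE : aeq 0 1 (Hv x) (JV p).
  apply: aeq_trans xv _; apply: eq_aeq => t /andP[/ltW t1 /ltW t0].
  by rewrite -[LHS]/(toL2 0 1 (JV p) t) toL2E ?t1 ?t0 //; exact: JV_sqi.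
have [h1 d1 t1] := H1_intro ltN10 (L2_sqi p.1) uE.
have [h2 d2 t2] := H1_intro ltr01 (L2_sqi p.2) vE.
split => //.
- split => //.
  + by rewrite t1 ?lexx ?leN10 // I_point addr0.
  + by rewrite t1 ?lexx ?leN10 // xz.
  + by rewrite t2 ?lexx ?ler01 // I_point addr0 xz.
  + by move=> D; rewrite t2 ?lexx ?ler01 //; exact: hp.
- rewrite sqr_sqrtr; last by rewrite addr_ge0 // L2dot_ge0.
  by congr (_ + _); exact: L2dot_aeq2.
Qed.

End EnergySpace.

(** * Eigenfunctions and inversion of the generator *)

Section Eigenfunctions.
Context {R : realType}.
Implicit Types (m t : R) (x y : H R) (p : @PW R) (bc : boundary).

Lemma FTC2_in (a b : R) (F f : R -> R) : a <= b -> {within `[a, b], continuous f} ->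
  (forall x : R, a <= x <= b -> is_derive x 1 F (f x)) -> Int a b f = F b - F a.
Proof.
rewrite le_eqVlt => /predU1P[->|ab]; first by rewrite I_point subrr.
move=> cf dF; rewrite Int.unlock /Rintegral (@continuous_FTC2 R f F) //=.
- have cF (x : R) : a <= x <= b -> {for x, continuous F}.
    by move=> /dF; exact: is_derive_cvg.
  split; first by move=> x; rewrite in_itv /= => /andP[ax xb]; have [] := dF x; rewrite ?ltW.
  + by apply: cvg_at_right_filter; apply: cF; rewrite lexx ltW.
  + by apply: cvg_at_left_filter; apply: cF; rewrite lexx ltW.
- move=> x; rewrite in_itv /= => /andP[ax xb]; rewrite derive1E.
  by have [|_ ->] := dF x; rewrite ?ltW.
Qed.

Lemma aeq_mulr (a b : R) (f f' h : R -> R) : aeq a b f f' ->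
  aeq a b (fun t => f t * h t) (fun t => f' t * h t).
Proof. by apply: ae_impl => t ff tab; rewrite ff. Qed.

(** Normalised to have slope 1 at [-1]. The extra term of [ev] creates the jump of slope
    [- m * sin m] at 0, which equals [- m ^+ 2] times the value [m^-1 * sin m] there, as the third
    component of the eigenvalue equation requires. *)
Definition eu m t := m^-1 * sin (m * (1 + t)).
Definition deu m t := cos (m * (1 + t)).
Definition ev m t := m^-1 * sin (m * (1 + t)) - sin m * sin (m * t).
Definition dev m t := cos (m * (1 + t)) - m * sin m * cos (m * t).
Definition Ef m : H R := mkH (eu m) (ev m) (m^-1 * sin m).
Definition pE m : PW := (toL2 (-1) 0 (deu m), toL2 0 1 (dev m)).

Lemma dlin1 m t : is_derive t 1 (fun s : R => m * (1 + s)) m.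
Proof. by apply: is_derive_eq (dZ m (dD (dC t 1) (dI t))) _; ring. Qed.

Lemma dlin0 m t : is_derive t 1 (fun s : R => m * s) m.
Proof. by apply: is_derive_eq (dZ m (dI t)) _; ring. Qed.

Lemma eu_d m t : m != 0 -> is_derive t 1 (eu m) (deu m t).
Proof.
move=> m0; apply: is_derive_eq
  (dZ m^-1 (@dcomp _ _ (fun s => m * (1 + s)) _ _ _ (is_derive_sin _) (dlin1 m t))) _.
by rewrite /deu; field.
Qed.

Lemma deu_d m t : m != 0 -> is_derive t 1 (deu m) (- m ^+ 2 * eu m t).
Proof.
move=> m0; apply: is_derive_eq
  (@dcomp _ _ (fun s => m * (1 + s)) _ _ _ (is_derive_cos _) (dlin1 m t)) _.
by rewrite /eu; field.
Qed.

Lemma ev_d m t : m != 0 -> is_derive t 1 (ev m) (dev m t).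
Proof.
move=> m0; apply: is_derive_eq (dB (eu_d t m0)
  (dZ (sin m) (@dcomp _ _ (fun s => m * s) _ _ _ (is_derive_sin _) (dlin0 m t)))) _.
by rewrite /deu /dev; ring.
Qed.

Lemma dev_d m t : m != 0 -> is_derive t 1 (dev m) (- m ^+ 2 * ev m t).
Proof.
move=> m0; apply: is_derive_eq (dB (deu_d t m0)
  (dZ (m * sin m) (@dcomp _ _ (fun s => m * s) _ _ _ (is_derive_cos _) (dlin0 m t)))) _.
by rewrite /eu /ev; ring.
Qed.

Lemma is_derive_cts (f df : R -> R) : (forall t : R, is_derive t 1 f (df t)) ->
  continuous f.
Proof. by move=> d t; exact: is_derive_cvg (d t). Qed.

Lemma cts_sqiT (f : R -> R) a b : continuous f -> sqi a b f.
Proof. by move=> cf; apply: cts_sqi; exact: continuous_subspaceT. Qed.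

Lemma FTC2D (F f : R -> R) a b : a <= b -> continuous f ->
  (forall t : R, is_derive t 1 F (f t)) -> F a + Int a b f = F b.
Proof.
move=> ab cf dF; have -> : Int a b f = F b - F a.
  by apply: FTC2 => //; exact: continuous_subspaceT.
by rewrite addrC subrK.
Qed.

Lemma eu_cts m : m != 0 -> continuous (eu m).
Proof. by move=> m0; apply: (is_derive_cts (df := deu m)) => t; exact: eu_d. Qed.
Lemma deu_cts m : m != 0 -> continuous (deu m).
Proof. by move=> m0; apply: (is_derive_cts (df := fun t => - m ^+ 2 * eu m t)) => t; exact: deu_d. Qed.
Lemma ev_cts m : m != 0 -> continuous (ev m).
Proof. by move=> m0; apply: (is_derive_cts (df := dev m)) => t; exact: ev_d. Qed.
Lemma dev_cts m : m != 0 -> continuous (dev m).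
Proof. by move=> m0; apply: (is_derive_cts (df := fun t => - m ^+ 2 * ev m t)) => t; exact: dev_d. Qed.

Lemma euN1 m : eu m (-1) = 0.
Proof. by rewrite /eu subrr mulr0 sin0 mulr0. Qed.
Lemma eu0 m : eu m 0 = m^-1 * sin m.
Proof. by rewrite /eu addr0 mulr1. Qed.
Lemma ev0 m : ev m 0 = m^-1 * sin m.
Proof. by rewrite /ev addr0 mulr1 mulr0 sin0 mulr0 subr0. Qed.
Lemma Int_pE1 m t : m != 0 -> -1 <= t -> t <= 0 -> Int (-1) t (pE m).1 = eu m t.
Proof.
move=> m0 t1 t0; rewrite -(FTC2D t1 (deu_cts m0) (fun s => eu_d s m0)) euN1 add0r.
apply: eq_I => s /andP[s1 st]; rewrite /= toL2E //; first exact: cts_sqiT (deu_cts m0).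
by rewrite s1 (le_trans st).
Qed.

Lemma JU_pE m t : m != 0 -> -1 <= t -> t <= 0 -> JU (pE m) t = eu m t.
Proof. by move=> *; rewrite /JU Int_pE1 // add0r. Qed.

Lemma JV_pE m t : m != 0 -> 0 <= t -> t <= 1 -> JV (pE m) t = ev m t.
Proof.
move=> m0 t0 t1; rewrite /JV JU_pE ?leN10 // eu0 -ev0.
have <- : Int 0 t (dev m) = Int 0 t (pE m).2.
  apply: eq_I => s /andP[s1 st]; rewrite /= toL2E //; first exact: cts_sqiT (dev_cts m0).
  by rewrite s1 (le_trans st).
exact: FTC2D t0 (dev_cts m0) (fun s => ev_d s m0).
Qed.

Lemma eu_sqi m : m != 0 -> sqi (-1) 0 (eu m).
Proof. by move=> m0; exact: cts_sqiT (eu_cts m0). Qed.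
Lemma ev_sqi m : m != 0 -> sqi 0 1 (ev m).
Proof. by move=> m0; exact: cts_sqiT (ev_cts m0). Qed.
Lemma deu_sqi m : m != 0 -> sqi (-1) 0 (deu m).
Proof. by move=> m0; exact: cts_sqiT (deu_cts m0). Qed.
Lemma dev_sqi m : m != 0 -> sqi 0 1 (dev m).
Proof. by move=> m0; exact: cts_sqiT (dev_cts m0). Qed.

Lemma Ef_J m : m != 0 -> Heq (Ef m) (J (pE m)).
Proof.
move=> m0; apply: Heq_mkH; [exact: JU_sqi|exact: JV_sqi| | |].
- apply: eq_aeq => t /andP[/ltW t1 /ltW t0]; rewrite JU_pE //.
  by rewrite -[LHS]/(toL2 (-1) 0 (eu m) t) toL2E ?t1 ?t0 //; exact: eu_sqi.
- apply: eq_aeq => t /andP[/ltW t1 /ltW t0]; rewrite JV_pE //.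
  by rewrite -[LHS]/(toL2 0 1 (ev m) t) toL2E ?t1 ?t0 //; exact: ev_sqi.
- by rewrite JU_pE ?leN10 // eu0.
Qed.

Lemma Hdot_J_Ef p m : m != 0 -> Hdot (J p) (Ef m) =
  Int (-1) 0 (fun t => JU p t * eu m t) + Int 0 1 (fun t => JV p t * ev m t) +
  JU p 0 * (m^-1 * sin m).
Proof.
by move=> m0; apply: Hdot_mkH2; [exact: JU_sqi|exact: JV_sqi|exact: eu_sqi|exact: ev_sqi].
Qed.

Lemma pdot_pE p m : pdot p (pE m) =
  Int (-1) 0 (fun t => p.1 t * (pE m).1 t) + Int 0 1 (fun t => p.2 t * (pE m).2 t).
Proof. by rewrite /pdot !L2dotE. Qed.

Lemma pdot_pE' p m : m != 0 -> pdot p (pE m) =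
  Int (-1) 0 (fun t => p.1 t * deu m t) + Int 0 1 (fun t => p.2 t * dev m t).
Proof.
move=> m0; rewrite pdot_pE; congr (_ + _); apply: eq_I => t tI; rewrite /= toL2E //.
- exact: deu_sqi.
- exact: dev_sqi.
Qed.

(** The derivative is moved onto the eigenfunction; [pdot_Ef2] moves it onto [p]. *)
Lemma pdot_Ef p m : m != 0 ->
  pdot p (pE m) = m ^+ 2 * Hdot (J p) (Ef m) + JV p 1 * dev m 1.
Proof.
move=> m0; rewrite pdot_pE' // Hdot_J_Ef //.
have sdu : sqi (-1) 0 (fun t => - m ^+ 2 * eu m t) by apply: sqiZ; exact: eu_sqi.
have sdv : sqi 0 1 (fun t => - m ^+ 2 * ev m t) by apply: sqiZ; exact: ev_sqi.
have cdu : continuous (fun t => - m ^+ 2 * eu m t).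
  by move=> t; apply: cvgM; [exact: cvg_cst|exact: eu_cts].
have cdv : continuous (fun t => - m ^+ 2 * ev m t).
  by move=> t; apply: cvgM; [exact: cvg_cst|exact: ev_cts].
have Fu t : -1 <= t -> deu m (-1) + Int (-1) t (fun t => - m ^+ 2 * eu m t) = deu m t.
  by move=> t1; exact: FTC2D t1 cdu (fun s => deu_d s m0).
have Fv t : 0 <= t -> dev m 0 + Int 0 t (fun t => - m ^+ 2 * ev m t) = dev m t.
  by move=> t1; exact: FTC2D t1 cdv (fun s => dev_d s m0).
have := I_by_parts 0 (deu m (-1)) (@leN10 R) (L2_sqi p.1) sdu.
have := I_by_parts (JU p 0) (dev m 0) (@ler01 R) (L2_sqi p.2) sdv.
rewrite Fu ?leN10 // Fv ?ler01 // -/(JV p 1) -/(JU p 0).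
rewrite (@eq_I _ 0 1 (fun t => p.2 t * (_ + _)) (fun t => p.2 t * dev m t)); last by move=> t /andP[t0 _]; rewrite Fv.
rewrite (@eq_I _ (-1) 0 (fun t => p.1 t * (_ + _)) (fun t => p.1 t * deu m t)); last first.
  by move=> t /andP[t0 _]; rewrite Fu.
rewrite (@eq_I _ 0 1 (fun t => (_ + _) * _) (fun t => - m ^+ 2 * (JV p t * ev m t))); last first.
  by move=> t _; rewrite /JV; ring.
rewrite (@eq_I _ (-1) 0 (fun t => (0 + _) * _) (fun t => - m ^+ 2 * (JU p t * eu m t))); last first.
  by move=> t _; rewrite /JU; ring.
rewrite IZ; last by apply: sqiM; [exact: JV_sqi|exact: ev_sqi].
rewrite IZ; last by apply: sqiM; [exact: JU_sqi|exact: eu_sqi].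
have du0 : deu m 0 = cos m by rewrite /deu addr0 mulr1.
have dv0 : dev m 0 = cos m - m * sin m by rewrite /dev addr0 mulr1 mulr0 cos0 mulr1.
rewrite mul0r subr0 du0 dv0.
set a1 := Int _ _ _; set a2 := Int _ _ _; set a3 := Int _ _ _; set a4 := Int _ _ _.
move=> h1 h2; rewrite mulrDr mulrDr [JU p 0 * (m^-1 * _)]mulrCA.
have -> : m ^+ 2 * (m^-1 * (JU p 0 * sin m)) = JU p 0 * (m * sin m) by field.
lra.
Qed.

(** The boundary term at 1 is kept because the polynomials [Q i] satisfy no homogeneous condition
    there: it is where the control enters. *)
Lemma pdot_Ef2 p m c1 c2 (y1 y2 : R -> R) : m != 0 -> sqi (-1) 0 y1 -> sqi 0 1 y2 ->
  aeq (-1) 0 p.1 (fun t => c1 + Int (-1) t y1) ->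
  aeq 0 1 p.2 (fun t => c2 + Int 0 t y2) ->
  pdot p (pE m) =
    - Hdot (mkH y1 y2 (c2 - (c1 + Int (-1) 0 y1))) (Ef m) + (c2 + Int 0 1 y2) * ev m 1.
Proof.
move=> m0 s1 s2 e1 e2; rewrite pdot_pE' // Hdot_mkH2 //; try exact: eu_sqi; try exact: ev_sqi.
have Fu t : -1 <= t -> 0 + Int (-1) t (deu m) = eu m t.
  by move=> t1; rewrite -(euN1 m); exact: FTC2D t1 (deu_cts m0) (fun s => eu_d s m0).
have Fv t : 0 <= t -> ev m 0 + Int 0 t (dev m) = ev m t.
  by move=> t1; exact: FTC2D t1 (dev_cts m0) (fun s => ev_d s m0).
have := I_by_parts c1 0 (@leN10 R) s1 (deu_sqi m0).
have := I_by_parts c2 (ev m 0) (@ler01 R) s2 (dev_sqi m0).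
rewrite Fu ?leN10 // Fv ?ler01 // mulr0 subr0.
rewrite (@eq_I _ 0 1 (fun t => y2 t * _) (fun t => y2 t * ev m t)); last first.
  by move=> t /andP[t0 _]; rewrite Fv.
rewrite (@eq_I _ (-1) 0 (fun t => y1 t * _) (fun t => y1 t * eu m t)); last first.
  by move=> t /andP[t0 _]; rewrite Fu.
have q1 : Int (-1) 0 (fun t => (c1 + Int (-1) t y1) * deu m t) =
    Int (-1) 0 (fun t => p.1 t * deu m t).
  apply: Int_aeq; last first.
  - exact: aeq_mulr (aeq_sym e1).
  - by apply: measurable_funM; [case: (L2_sqi p.1)|case: (deu_sqi m0)].
  - by apply: measurable_funM; [exact: cts_meas (cts_prim (@leN10 R) s1)|case: (deu_sqi m0)].
have q2 : Int 0 1 (fun t => (c2 + Int 0 t y2) * dev m t) =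
    Int 0 1 (fun t => p.2 t * dev m t).
  apply: Int_aeq; last first.
  - exact: aeq_mulr (aeq_sym e2).
  - by apply: measurable_funM; [case: (L2_sqi p.2)|case: (dev_sqi m0)].
  - by apply: measurable_funM; [exact: cts_meas (cts_prim (@ler01 R) s2)|case: (dev_sqi m0)].
rewrite q1 q2 eu0 ev0; move: (Int _ _ _) (Int _ _ _) (Int _ _ _) (Int _ _ _) (Int _ _ _) (Int _ _ _).
by move=> a1 a2 a3 a4 a5 a6 h1 h2; lra.
Qed.

Definition bcE bc m := if bc is Dirichlet then ev m 1 = 0 else dev m 1 = 0.

Lemma Wp_pE bc m : m != 0 -> bcE bc m -> Wp bc (pE m).
Proof. by move=> m0 + D; rewrite D /= JV_pE. Qed.

Lemma pdot_eigen bc p m : m != 0 -> bcE bc m -> Wp bc p ->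
  pdot p (pE m) = m ^+ 2 * Hdot (J p) (Ef m).
Proof.
move=> m0 bm wp; rewrite pdot_Ef //; case: bc bm wp => /= [_ -> //|->].
  by rewrite mul0r addr0.
by rewrite mulr0 addr0.
Qed.

Lemma domA_elim bc x : domA bc x -> exists (p : PW) (c1 c2 : R) (y1 y2 : R -> R),
  [/\ Heq x (J p) /\ Wp bc p, sqi (-1) 0 y1 /\ sqi 0 1 y2,
      aeq (-1) 0 p.1 (fun t => c1 + Int (-1) t y1) /\
      aeq 0 1 p.2 (fun t => c2 + Int 0 t y2),
      bc = Neumann -> c2 + Int 0 1 y2 = 0 &
      Heq (opA x) (mkH y1 y2 (c2 - (c1 + Int (-1) 0 y1)))].
Proof.
move=> [w [_ h1] [_ h2] tN]; have [xp wp _] := inW_elim w.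
have [a1 e1] := H1_elim (@ltN10 R) h1; have [a2 e2] := H1_elim (@ltr01 R) h2.
exists (wderiv (Hu x), wderiv (Hv x)), (trace (wderiv (Hu x)) (-1)), (trace (wderiv (Hv x)) 0).
exists (wderiv (wderiv (Hu x))), (wderiv (wderiv (Hv x))).
split => //; first by split; exact: L2_sqi.
- by move=> N; rewrite -e2 ?ler01 ?lexx // tN.
- apply: Heq_mkH; [exact: L2_sqi|exact: L2_sqi|exact: aeq_refl|exact: aeq_refl|].
  by rewrite /opA /Hz /= e1 ?leN10 ?lexx.
Qed.

Lemma domA_intro bc x p (c1 c2 : R) (y1 y2 : R -> R) : Heq x (J p) -> Wp bc p ->
  sqi (-1) 0 y1 -> sqi 0 1 y2 -> aeq (-1) 0 p.1 (fun t => c1 + Int (-1) t y1) ->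
  aeq 0 1 p.2 (fun t => c2 + Int 0 t y2) -> (bc = Neumann -> c2 + Int 0 1 y2 = 0) ->
  domA bc x /\ Heq (opA x) (mkH y1 y2 (c2 - (c1 + Int (-1) 0 y1))).
Proof.
move=> xp wp s1 s2 e1 e2 N; have [w _ d1 d2] := inW_intro xp wp.
have [h1 dd1 t1] := H1_intro (@ltN10 R) s1 (aeq_trans d1 e1).
have [h2 dd2 t2] := H1_intro (@ltr01 R) s2 (aeq_trans d2 e2).
have [[hu hv] _ _ _ _] := w.
split; first by split => // Nn; rewrite t2 ?ler01 ?lexx //; exact: N.
apply: Heq_mkH => //; rewrite /opA /Hz /= t1 ?leN10 ?lexx // t2 ?ler01 ?lexx //.
by rewrite I_point addr0.
Qed.

(** Symmetry of the generator, tested on an eigenfunction: both integrations by parts apply, and the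
    two boundary conditions cancel the term at 1. *)
Lemma opA_Ef bc x m : m != 0 -> bcE bc m -> domA bc x ->
  Hdot (opA x) (Ef m) = - m ^+ 2 * Hdot x (Ef m).
Proof.
move=> m0 bm /domA_elim [p [c1 [c2 [y1 [y2 [[xp wp] [s1 s2] [e1 e2] N oe]]]]]].
have := pdot_Ef2 m0 s1 s2 e1 e2; rewrite (pdot_eigen m0 bm wp).
rewrite (Hdot_Heq _ oe) (Hdot_Heq _ xp) => h.
suff b0 : (c2 + Int 0 1 y2) * ev m 1 = 0 by rewrite b0 addr0 in h; rewrite mulNr h opprK.
by case: bc bm N {wp} => /= [-> _|_ -> //]; rewrite ?mulr0 // mul0r.
Qed.

Lemma Ef_domA bc m : m != 0 -> bcE bc m ->
  domA bc (Ef m) /\ Heq (opA (Ef m)) (- m ^+ 2 *: Ef m).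
Proof.
move=> m0 bm.
have su : sqi (-1) 0 (fun t => - m ^+ 2 * eu m t) by apply: sqiZ; exact: eu_sqi.
have sv : sqi 0 1 (fun t => - m ^+ 2 * ev m t) by apply: sqiZ; exact: ev_sqi.
have cu : continuous (fun t => - m ^+ 2 * eu m t).
  by move=> t; apply: cvgM; [exact: cvg_cst|exact: eu_cts].
have cv : continuous (fun t => - m ^+ 2 * ev m t).
  by move=> t; apply: cvgM; [exact: cvg_cst|exact: ev_cts].
have Fu t : -1 <= t -> deu m (-1) + Int (-1) t (fun t => - m ^+ 2 * eu m t) = deu m t.
  by move=> t1; exact: FTC2D t1 cu (fun s => deu_d s m0).
have Fv t : 0 <= t -> dev m 0 + Int 0 t (fun t => - m ^+ 2 * ev m t) = dev m t.
  by move=> t1; exact: FTC2D t1 cv (fun s => dev_d s m0).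
have [|||dA oA] := @domA_intro bc (Ef m) (pE m) (deu m (-1)) (dev m 0) _ _ (Ef_J m0)
  (Wp_pE m0 bm) su sv.
- apply: eq_aeq => t /andP[/ltW t1 /ltW t0]; rewrite Fu //= toL2E ?t1 ?t0 //.
  exact: deu_sqi.
- apply: eq_aeq => t /andP[/ltW t1 /ltW t0]; rewrite Fv //= toL2E ?t1 ?t0 //.
  exact: dev_sqi.
- by move=> N; rewrite Fv //; move: bm; rewrite N.
split => //; apply: Heq_trans oA _; apply: Heq_sym; apply: Heq_mkH => //.
- apply: eq_aeq => t /andP[/ltW t1 /ltW t0].
  transitivity (- m ^+ 2 * toL2 (-1) 0 (eu m) t); first by [].
  by rewrite toL2E ?t1 ?t0 //; exact: eu_sqi.
- apply: eq_aeq => t /andP[/ltW t1 /ltW t0].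
  transitivity (- m ^+ 2 * toL2 0 1 (ev m) t); first by [].
  by rewrite toL2E ?t1 ?t0 //; exact: ev_sqi.
- rewrite Fu ?leN10 // -[LHS]/(- m ^+ 2 * (m^-1 * sin m)) /deu /dev addr0 mulr1 mulr0 cos0.
  by field.
Qed.

(** Writing each element of [H] as [opA w] gives access to the domain, where completeness and the
    commutation with the semigroup are available. *)
Lemma opA_surj bc x : exists w, domA bc w /\ Heq (opA w) x.
Proof.
pose y1 := Hu x; pose y2 := Hv x; pose A1 := Int (-1) 0 y1; pose A2 := Int 0 1 y2.
have s1 : sqi (-1) 0 y1 by exact: L2_sqi.
have s2 : sqi 0 1 y2 by exact: L2_sqi.
pose B1 := Int (-1) 0 (fun t => 0 + Int (-1) t y1).
pose B2 := Int 0 1 (fun t => 0 + Int 0 t y2).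
(* The slope at [-1] is the solution of the scalar condition at 1: [JV p 1 = 0] for Dirichlet, slope
   0 at 1 for Neumann. The choice of [c2] prescribes the jump of slope at 0. *)
pose c1 := if bc is Dirichlet then - (B1 + B2 + A1 + Hz x) / 2 else - A2 - A1 - Hz x.
pose c2 := c1 + A1 + Hz x.
pose f1 t := c1 + Int (-1) t y1; pose f2 t := c2 + Int 0 t y2.
have sf1 : sqi (-1) 0 f1 by exact: cts_sqi (cts_prim (@leN10 R) s1).
have sf2 : sqi 0 1 f2 by exact: cts_sqi (cts_prim (@ler01 R) s2).
have sg1 : sqi (-1) 0 (fun t => 0 + Int (-1) t y1) by exact: cts_sqi (cts_prim (@leN10 R) s1).
have sg2 : sqi 0 1 (fun t => 0 + Int 0 t y2) by exact: cts_sqi (cts_prim (@ler01 R) s2).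
pose p : PW := (toL2 (-1) 0 f1, toL2 0 1 f2).
have E1 : Int (-1) 0 p.1 = c1 + B1.
  rewrite (@eq_I _ (-1) 0 _ (fun t => c1 + (0 + Int (-1) t y1))); last first.
    by move=> t tI; rewrite /= toL2E // /f1 add0r.
  rewrite ID; [|exact: itg_cst|exact: sqi_itg].
  by rewrite I_cst ?leN10 // -/B1; ring.
have E2 : Int 0 1 p.2 = c2 + B2.
  rewrite (@eq_I _ 0 1 _ (fun t => c2 + (0 + Int 0 t y2))); last first.
    by move=> t tI; rewrite /= toL2E // /f2 add0r.
  rewrite ID; [|exact: itg_cst|exact: sqi_itg].
  by rewrite I_cst ?ler01 // -/B2; ring.
have wp : Wp bc p.
  by move=> D; rewrite /JV /JU E1 E2 /c2 /c1 D; field.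
have [|||dA oA] := @domA_intro bc (J p) p c1 c2 y1 y2 (Heq_refl _) wp s1 s2.
- by apply: eq_aeq => t /andP[/ltW t1 /ltW t0]; rewrite /= toL2E ?t1 ?t0.
- by apply: eq_aeq => t /andP[/ltW t1 /ltW t0]; rewrite /= toL2E ?t1 ?t0.
- by move=> N; rewrite -/A2 /c2 /c1 N; ring.
exists (J p); split => //; apply: Heq_trans oA _; apply: Heq_sym; apply: Heq_mkH => //.
- exact: aeq_refl.
- exact: aeq_refl.
- by rewrite -/A1 /c2; ring.
Qed.

(** [opA] is built from chosen representatives, so its compatibility with almost everywhere equality
    has to be derived from the uniqueness of primitives. *)
Lemma opA_Heq0 bc (w : H R) : domA bc w -> Heq w 0 -> Heq (opA w) 0.
Proof.
move=> /domA_elim [p [c1 [c2 [y1 [y2 [[xp wp] [s1 s2] [e1 e2] N oe]]]]]] w0.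
have [/aeqP j1 /aeqP j2 j3] := Heq_trans (Heq_sym xp) w0.
have zE (a b c : R) (g : R -> R) : a < b -> sqi a b g ->
    aeq a b (fun t => c + Int a t g) (fun=> 0) -> aeq a b g (fun=> 0) /\ c = 0.
  move=> ab sg h; have := @prim_inj _ a b c 0 g (fun=> 0) ab sg (sqi_cst _ _ _).
  by apply; apply: aeq_trans h _; apply: eq_aeq => t _; rewrite I0 addr0.
have [p10 _] : aeq (-1) 0 p.1 (fun=> 0) /\ (0 : R) = 0.
  apply: zE (@ltN10 R) (L2_sqi _) _; apply: aeq_trans j1; apply: eq_aeq => t /andP[/ltW t1 /ltW t0].
  by rewrite -[RHS]/(toL2 (-1) 0 (JU p) t) toL2E ?t1 ?t0 //; exact: JU_sqi.
have [p20 _] : aeq 0 1 p.2 (fun=> 0) /\ JU p 0 = 0.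
  apply: zE (@ltr01 R) (L2_sqi _) _; apply: aeq_trans j2; apply: eq_aeq => t /andP[/ltW t1 /ltW t0].
  by rewrite -[RHS]/(toL2 0 1 (JV p) t) toL2E ?t1 ?t0 //; exact: JV_sqi.
have [y10 c10] := zE _ _ _ _ (@ltN10 R) s1 (aeq_trans (aeq_sym e1) p10).
have [y20 c20] := zE _ _ _ _ (@ltr01 R) s2 (aeq_trans (aeq_sym e2) p20).
apply: Heq_trans oe _; split.
- apply/aeqP; apply: aeq_trans y10; apply: eq_aeq => t /andP[/ltW t1 /ltW t0].
  by rewrite -[LHS]/(toL2 (-1) 0 y1 t) toL2E ?t1 ?t0.
- apply/aeqP; apply: aeq_trans y20; apply: eq_aeq => t /andP[/ltW t1 /ltW t0].
  by rewrite -[LHS]/(toL2 0 1 y2 t) toL2E ?t1 ?t0.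
- rewrite -[LHS]/(c2 - (c1 + Int (-1) 0 y1)) c10 c20 (Int_eq_aeq _ s1 (sqi_cst (-1) 0 0)) //.
    by rewrite I0; rewrite -[RHS]/(0 : R); ring.
  by rewrite leN10 lexx.
Qed.

End Eigenfunctions.

(** * Frequencies and bounds on the eigenfunctions *)

Section Eigenvalues.
Context {R : realType}.
Implicit Types (m t : R) (bc : boundary).

Lemma cos_natpi n : cos (n%:R * pi) = (-1) ^+ n :> R.
Proof.
elim: n => [|n IH]; first by rewrite mul0r cos0 expr0.
by rewrite -natr1 mulrDl mul1r cosDpi IH exprS mulN1r.
Qed.

Lemma sin_natpi n : sin (n%:R * pi) = 0 :> R.
Proof.
elim: n => [|n IH]; first by rewrite mul0r sin0.
by rewrite -natr1 mulrDl mul1r sinDpi IH oppr0.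
Qed.

Lemma IVT_alternating (f : R -> R) (a b : R) n : a < b -> continuous f ->
  0 < (-1) ^+ n * f a -> (-1) ^+ n * f b < 0 ->
  exists2 c, a < c < b & f c = 0.
Proof.
move=> ab cf fa fb; pose g t := (-1) ^+ n * f t.
have cg : {within `[a, b], continuous g}.
  apply: continuous_subspaceT => t; apply: cvgM; [exact: cvg_cst|exact: cf].
have [|c cab gc] := IVT (v := 0) (ltW ab) cg.
- by rewrite ge_min le_max (ltW fa) (ltW fb) orbT.
move: cab; rewrite in_itv /= => /andP[ac cb]; exists c.
  rewrite !lt_neqAle ac cb !andbT; apply/andP; split; apply/eqP => e.
    by move: fa; rewrite -/(g a) e gc ltxx.
  by move: fb; rewrite -/(g b) -e gc ltxx.
by move/eqP: gc; rewrite mulf_eq0 signr_eq0 => /eqP.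
Qed.

Lemma sqrr_sign1 n : (-1) ^+ n * (-1) ^+ n = 1 :> R.
Proof. by rewrite -exprMn mulrNN mulr1 expr1n. Qed.

(** The sign changes: the value is [2 (-1)^j] at the left end and [- m (-1)^j] at the right end. *)
Lemma rootD_ex j : exists2 m : R, j%:R * pi < m < (j%:R + 2^-1) * pi &
  2 * cos m - m * sin m = 0.
Proof.
have p0 := pi_gt0 R; apply: (@IVT_alternating _ _ _ j).
- by rewrite ltr_pM2r //; lra.
- by move=> t; apply: (@is_derive_cvg _ (fun t => 2 * cos t - t * sin t)).
- by rewrite sin_natpi mulr0 subr0 cos_natpi mulrCA sqrr_sign1; lra.
- have -> : (j%:R + 2^-1) * pi = j%:R * pi + pi / 2 :> R by ring.
  rewrite cosDpihalf sinDpihalf sin_natpi cos_natpi oppr0 mulr0 sub0r mulrN mulrCA sqrr_sign1.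
  by rewrite mulr1 oppr_lt0 ltr_wpDl ?mulr_ge0 ?(ltW p0) // divr_gt0.
Qed.

(** By the double angle formula the function is [cos(2m) - (m/2) sin(2m)], whose signs at the two
    ends are [(-1)^j] and [-(-1)^j]. *)
Lemma rootN_ex j : exists2 m : R, j%:R * (pi / 2) < m < (j%:R + 2^-1) * (pi / 2) &
  cos (2 * m) - m * sin m * cos m = 0.
Proof.
have p0 := pi_gt0 R.
suff [m mj e] : exists2 m : R, j%:R * (pi / 2) < m < (j%:R + 2^-1) * (pi / 2) &
    cos (2 * m) - m / 2 * sin (2 * m) = 0.
  exists m => //; rewrite -[RHS]e; congr (_ - _).
  by rewrite mulr_natl sin_mulr2n -mulr_natl; field.
apply: (@IVT_alternating _ _ _ j).
- by rewrite ltr_pM2r; lra.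
- move=> t; rewrite (_ : (fun m : R => _) = (fun t => cos (2 * t) - 2^-1 * t * sin (2 * t))).
    apply: is_derive_cvg (dB (@dcomp _ _ (fun s => 2 * s) t _ _ (is_derive_cos _) (dlin0 2 t))
      (dM (dlin0 2^-1 t) (@dcomp _ _ (fun s => 2 * s) t _ _ (is_derive_sin _) (dlin0 2 t)))).
  by apply/funext => s; congr (_ - _ * _); rewrite mulrC.
- have -> : 2 * (j%:R * (pi / 2)) = j%:R * pi :> R by field.
  by rewrite sin_natpi cos_natpi mulr0 subr0 sqrr_sign1; lra.
- have -> : 2 * ((j%:R + 2^-1) * (pi / 2)) = j%:R * pi + pi / 2 :> R by field.
  rewrite cosDpihalf sinDpihalf sin_natpi cos_natpi oppr0 sub0r mulrN mulrCA sqrr_sign1.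
  rewrite mulr1 oppr_lt0 divr_gt0 // mulr_gt0 //; last by lra.
Qed.

Definition rootD j : R := xget 0 [set m | j%:R * pi < m < (j%:R + 2^-1) * pi /\
  2 * cos m - m * sin m = 0].
Definition rootN j : R := xget 0 [set m | j%:R * (pi / 2) < m < (j%:R + 2^-1) * (pi / 2) /\
  cos (2 * m) - m * sin m * cos m = 0].

Lemma rootDP j : j%:R * pi < rootD j < (j%:R + 2^-1) * pi /\
  2 * cos (rootD j) - rootD j * sin (rootD j) = 0.
Proof.
rewrite /rootD; case: xgetP => [m _ //|H].
by have [m h1 h2] := rootD_ex j; case: (H m).
Qed.

Lemma rootNP j : j%:R * (pi / 2) < rootN j < (j%:R + 2^-1) * (pi / 2) /\
  cos (2 * rootN j) - rootN j * sin (rootN j) * cos (rootN j) = 0.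
Proof.
rewrite /rootN; case: xgetP => [m _ //|H].
by have [m h1 h2] := rootN_ex j; case: (H m).
Qed.

(** [ev m 1 = m^-1 * sin m * (2 * cos m - m * sin m)]: the Dirichlet frequencies alternate
    between the zeros of [2 * cos m - m * sin m] and those of [sin m]. *)
Definition mu bc k : R :=
  if bc is Dirichlet then if odd k then (k./2.+1)%:R * pi else rootD k./2 else rootN k.

(** One frequency is chosen in each interval of length [pi / 2]. Strict order and linear growth
    follow; that none has been missed is the content of completeness. *)
Lemma mu_bracket bc k : k%:R * (pi / 2) < mu bc k <= k.+1%:R * (pi / 2).
Proof.
have p0 := pi_gt0 R; case: bc => /=; last first.
  have [/andP[h1 h2] _] := rootNP k; rewrite h1 /= ltW // (lt_le_trans h2) //.
  by rewrite ler_pM2r; [rewrite -[k.+1%:R]natr1; lra|lra].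
have := odd_double_half k; case: (odd k) => /= <-.
- have -> : (1 + k./2.*2)%:R * (pi / 2) = (k./2.+1)%:R * pi - pi / 2 :> R.
    by rewrite natrD -mul2n natrM -natr1; field.
  have -> : (1 + k./2.*2).+1%:R * (pi / 2) = (k./2.+1)%:R * pi :> R.
    by rewrite -natr1 natrD -mul2n natrM -natr1; field.
  have -> : (1 + k./2.*2)./2 = k./2 by rewrite (half_bit_double _ true).
  by rewrite lexx andbT; lra.
- have -> : (0 + k./2.*2)%:R * (pi / 2) = k./2%:R * pi :> R.
    by rewrite add0n -mul2n natrM; field.
  have -> : (0 + k./2.*2).+1%:R * (pi / 2) = (k./2%:R + 2^-1) * pi :> R.
    by rewrite add0n -natr1 -mul2n natrM; field.
  have -> : (0 + k./2.*2)./2 = k./2 by rewrite (half_bit_double _ false).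
  by have [/andP[-> h2] _] := rootDP k./2; rewrite ltW.
Qed.

Lemma mu_gt0 bc k : 0 < mu bc k.
Proof.
have /andP[h _] := mu_bracket bc k; apply: le_lt_trans h.
by rewrite mulr_ge0 // divr_ge0 // pi_ge0.
Qed.

Lemma mu_neq0 bc k : mu bc k != 0. Proof. by rewrite gt_eqF // mu_gt0. Qed.

Lemma mu_ge_nat bc k : k%:R <= mu bc k.
Proof.
have /andP[h _] := mu_bracket bc k; apply: le_trans (ltW h).
by rewrite ler_peMr //; have := pihalf_ge1 R.
Qed.

Lemma mu_lt bc i j : (i < j)%N -> mu bc i < mu bc j.
Proof.
move=> ij; have /andP[_ h1] := mu_bracket bc i; have /andP[h2 _] := mu_bracket bc j.
apply: le_lt_trans h1 (le_lt_trans _ h2); rewrite ler_wpM2r ?ler_nat //.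
by rewrite divr_ge0 // pi_ge0.
Qed.

Lemma mu_le bc i j : (i <= j)%N -> mu bc i <= mu bc j.
Proof. by rewrite leq_eqVlt => /predU1P[-> //|/(mu_lt bc)/ltW]. Qed.

Lemma mu_inj bc i j : mu bc i = mu bc j -> i = j.
Proof.
by case: (ltngtP i j) => // /(mu_lt bc) + e; rewrite e ltxx.
Qed.

Lemma mu_bc bc k : bcE bc (mu bc k).
Proof.
case: bc => /=; rewrite /ev /dev; last first.
  have [_ <-] := rootNP k; rewrite mulr1; congr (cos _ - _).
  by rewrite mulrC.
set m := if _ then _ else _; have m0 : m != 0 by exact: (mu_neq0 Dirichlet k).
have -> : m^-1 * sin (m * (1 + 1)) - sin m * sin (m * 1) =
    m^-1 * sin m * (2 * cos m - m * sin m).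
  have -> : m * (1 + 1) = m *+ 2 by ring.
  by rewrite sin_mulr2n -mulr_natr mulr1; field.
rewrite /m; case: (odd k); first by rewrite sin_natpi mulr0 mul0r.
by have [_ ->] := rootDP k./2; rewrite mulr0.
Qed.

(** The upper end of the bracket of the frequency of index [2M]. It exceeds the first [2M + 1]
    frequencies, yet stays below [pi] divided by the node spacing, as Wirtinger's inequality
    requires. *)
Definition Kb bc M : R := if bc is Dirichlet then (M%:R + 2^-1) * pi else (M%:R + 4^-1) * pi.

Lemma mu_lt_Kb bc M : mu bc M.*2 < Kb bc M.
Proof.
case: bc => /=; last first.
  have [/andP[_ h] _] := rootNP M.*2; apply: lt_le_trans h _.
  by rewrite -mul2n natrM le_eqVlt; apply/orP; left; apply/eqP; field.
by rewrite odd_double doubleK; have [/andP[_ h] _] := rootDP M.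
Qed.

Lemma Kb_ge bc M : M%:R <= Kb bc M.
Proof.
have p2 := pi_ge2 R; have M0 : 0 <= M%:R :> R by [].
by case: bc => /=; nra.
Qed.

(** The trace at [1] of the eigenfunction that the control acts on. *)
Definition beta bc m := if bc is Dirichlet then - dev m 1 else ev m 1.

(** In the Dirichlet case [dev m 1] contains [m * sin m * cos m], which could grow with [m]; the
    frequency equation gives either [sin m = 0] or [m * sin m = 2 * cos m]. *)
Lemma beta_bound bc k : `|beta bc (mu bc k)| <= 3 + (mu bc 0)^-1.
Proof.
have m0 := mu_gt0 bc k; have m1 := mu_gt0 bc 0.
have i1 : 0 < (mu bc 0)^-1 by rewrite invr_gt0.
case: bc m0 m1 i1 => /= m0 m1 i1; last first.
  rewrite /ev mulr1; apply: le_trans (ler_normB _ _) _; rewrite !normrM.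
  have : `|(rootN k)^-1| <= (rootN 0)^-1.
    rewrite ger0_norm ?invr_ge0 ?(ltW m0) // lef_pV2 ?posrE //.
    exact: (mu_le Neumann (leq0n k)).
  have := sin_max (rootN k * (1 + 1)); have := sin_max (rootN k).
  have n1 := normr_ge0 (sin (rootN k * (1 + 1))); have n2 := normr_ge0 (sin (rootN k)).
  have n3 := normr_ge0 ((rootN k)^-1).
  move=> h1 h2 h3; nra.
rewrite normrN; set m := if _ then _ else _ in m0 *.
suff h : `|m * sin m * cos m| <= 2.
  apply: le_trans (ler_normB _ _) _; rewrite mulr1.
  by have := cos_max (m * (1 + 1)); lra.
rewrite /m; case: (odd k).
  by rewrite sin_natpi mulr0 mul0r normr0.
have [_ /eqP] := rootDP k./2; rewrite subr_eq0 => /eqP <-.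
rewrite !normrM normr_nat; have := cos_max (rootD k./2).
by have := normr_ge0 (cos (rootD k./2)); nra.
Qed.

(** The right side is the energy of [Ef m], at least the integral of [cos(m(1+t))^2] over [[-1, 0]],
    that is [1/2 + sin(2m)/(4m)]. For [m >= 1] the last term is at least [-1/4]; for [m < 1] it is
    positive. *)
Lemma Ef_norm_ge bc m : 0 < m -> bcE bc m -> 4^-1 <= m ^+ 2 * Hdot (Ef m) (Ef m).
Proof.
move=> m0 mbc; have mn0 : m != 0 by rewrite gt_eqF.
rewrite (Hdot_Heq _ (Ef_J mn0)) -(pdot_eigen mn0 mbc (Wp_pE mn0 mbc)) pdot_pE' //.
have -> : Int (-1) 0 (fun t => (pE m).1 t * deu m t) = Int (-1) 0 (fun t => deu m t ^+ 2).
  by apply: eq_I => t tI; rewrite toL2E //; exact: deu_sqi.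
have -> : Int 0 1 (fun t => (pE m).2 t * dev m t) = Int 0 1 (fun t => dev m t ^+ 2).
  by apply: eq_I => t tI; rewrite toL2E //; exact: dev_sqi.
have : 0 <= Int 0 1 (fun t => dev m t ^+ 2) by apply: I_ge0 => t _; exact: sqr_ge0.
suff : 4^-1 <= Int (-1) 0 (fun t => deu m t ^+ 2) by lra.
pose G t := 2^-1 * t + (4 * m)^-1 * sin (2 * (m * (1 + t))).
have dG (t : R) : is_derive t 1 G (deu m t ^+ 2).
  have dl : is_derive t 1 (fun s => 2 * (m * (1 + s))) (2 * m) := dZ 2 (dlin1 m t).
  have := dD (dZ 2^-1 (dI t)) (dZ (4 * m)^-1
    (@dcomp _ sin (fun s => 2 * (m * (1 + s))) t _ _ (is_derive_sin _) dl)).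
  move=> h; apply: is_derive_eq h _; rewrite /deu.
  have -> : 2 * (m * (1 + t)) = (m * (1 + t)) *+ 2 by ring.
  by rewrite cos_mulr2n -mulr_natl; field.
have cd : continuous (fun t => deu m t ^+ 2).
  by move=> t; apply: cvgM; exact: deu_cts.
have := FTC2D leN10 cd dG.
rewrite /G !addr0 subrr !mulr0 sin0 mulr0 addr0 mulr1 add0r => e.
suff : - 4^-1 <= (4 * m)^-1 * sin (2 * m) by lra.
have [m1|m1] := lerP 1 m.
  have h : `|(4 * m)^-1 * sin (2 * m)| <= 4^-1.
    rewrite normrM gtr0_norm ?invr_gt0 ?mulr_gt0 // -[leRHS]mulr1 ler_pM ?invr_ge0 //.
    - lra.
    - by rewrite lef_pV2 ?posrE //; lra.
    - exact: sin_max.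
  by move: h; rewrite ler_norml => /andP[].
apply: le_trans (_ : 0 <= _); first by lra.
apply: mulr_ge0; first by rewrite invr_ge0; lra.
apply/ltW/sin_gt0_pi; rewrite mulr_gt0 //=; have := pi_ge2 R; lra.
Qed.

End Eigenvalues.

(** * Wirtinger's inequality *)

Section Wirtinger.
Context {R : realType}.
Implicit Types (a b c d k m t : R) (F g : R -> R).

(** On an interval of length less than [pi / k] around [m], completing the square
    with the multiplier [k tan (k (x - m))]. *)
Lemma Wirtinger c d k m F g : c <= d -> 0 < k -> sqi c d g ->
  (forall t, c <= t <= d -> F t = F c + Int c t g) ->
  (forall t, c <= t <= d -> `|k * (t - m)| < pi / 2) ->
  F c = 0 -> F d = 0 \/ d = m ->
  k ^+ 2 * Int c d (fun t => F t ^+ 2) <= Int c d (fun t => g t ^+ 2).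
Proof.
move=> cd k0 sg FE km Fc Fd.
(* [tau] solves the Riccati equation [tau' = k^2 + tau^2], so [(g + F tau)^2 = g^2 - k^2 F^2 + (F^2
   tau)'] and only boundary terms remain to be discarded. *)
pose tau t := k * tan (k * (t - m)); pose tau' t := k ^+ 2 + tau t ^+ 2.
have c0 t : c <= t <= d -> cos (k * (t - m)) != 0.
  by move=> /km h; rewrite gt_eqF // cos_gt0_pihalf // -ltr_norml.
have dtau t : c <= t <= d -> is_derive t 1 tau (tau' t).
  move=> tI; have dl : is_derive t 1 (fun s => k * (s - m)) k.
    by apply: is_derive_eq (dZ k (dB (dI t) (dC t m))) _; ring.
  have := dZ k (@dcomp _ tan (fun s => k * (s - m)) t _ _ (is_derive_tan (c0 t tI)) dl).
  move=> h; apply: is_derive_eq h _; rewrite cos2_tan2 ?c0 // /tau' /tau; ring.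
have ctau : {within `[c, d], continuous tau}.
  apply: derivable_within_continuous => t; rewrite in_itv /= => tI.
  by have [] := dtau t tI.
have ctau' : {within `[c, d], continuous tau'}.
  by move=> t; apply: cvgD; [exact: cvg_cst|apply: cvgM; exact: ctau].
have stau : sqi c d tau by exact: cts_sqi.
have stau' : sqi c d tau' by exact: cts_sqi.
have sF : sqi c d F.
  apply: (@eq_sqi _ _ _ (fun t => F c + Int c t g)); first by move=> t /FE.
  exact: cts_sqi (cts_prim cd sg).
have cF : {within `[c, d], continuous (fun t => F c + Int c t g)} by exact: cts_prim.
have tauE t : c <= t <= d -> tau c + Int c t tau' = tau t.
  move=> /andP[ct td]; have -> : Int c t tau' = tau t - tau c; last by ring.
  apply: (FTC2_in ct).
    by apply: continuous_subspaceW ctau'; apply: subset_itv; rewrite bnd_simp.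
  by move=> s /andP[cs st]; apply: dtau; rewrite cs (le_trans st).
pose P t := F t * tau t; pose P' t := g t * tau t + F t * tau' t.
have sP : sqi c d P.
  apply: (@eq_sqi _ _ _ (fun t => (F c + Int c t g) * tau t)).
    by move=> t /FE; rewrite /P => ->.
  by apply: cts_sqi => t; apply: cvgM; [exact: cF|exact: ctau].
have bt (h f : R -> R) : sqi c d h -> {within `[c, d], continuous f} ->
    sqi c d (fun t => h t * f t).
  move=> sh cf; have [K KP] : exists K, forall t, c <= t <= d -> `|f t| <= K.
    have [|s _ sM] := @EVT_max _ (fun t => `|f t|) c d cd; last by exists `|f s|.
    by move=> t; apply: cvg_norm; exact: cf.
  have mm : measurable_fun `[c, d] (fun t => h t * f t).
    by apply: measurable_funM; [case: sh|exact: cts_meas].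
  split => //; apply: (@le_itg _ _ _ _ (fun t => K ^+ 2 * h t ^+ 2)).
  - exact: measurable_funX.
  - move=> t tI; rewrite ger0_norm ?sqr_ge0 // exprMn mulrC ler_wpM2r ?sqr_ge0 //.
    rewrite -(real_normK (num_real (f t))) lerXn2r ?nnegrE //; last exact: KP.
    by apply: le_trans (KP t tI).
  - by apply: itgZ; case: sh.
have sP' : sqi c d P' by apply: sqiD; apply: bt.
have PE t : c <= t <= d -> P t = P c + Int c t P'.
  move=> tI; have /andP[ct td] := tI.
  have sgt : sqi c t g by apply: sqi_sub sg.
  have stt : sqi c t tau' by apply: sqi_sub stau'.
  have sFt : sqi c t F by apply: sqi_sub sF.
  have := I_by_parts (F c) (tau c) ct sgt stt.
  rewrite -FE // tauE //.
  rewrite (@eq_I _ c t (fun s => g s * (_ + _)) (fun s => g s * tau s)); last first.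
    by move=> s /andP[cs st]; rewrite tauE // cs (le_trans st).
  rewrite (@eq_I _ c t (fun s => (_ + _) * tau' s) (fun s => F s * tau' s)); last first.
    by move=> s /andP[cs st]; rewrite -FE // cs (le_trans st).
  rewrite -ID; [|exact: sqiM sgt (sqi_sub _ td stau)|exact: sqiM].
  by rewrite -/P' => ->; rewrite /P; ring.
have := I_by_parts (F c) (P c) cd sg sP'.
rewrite -FE ?lexx ?cd // -PE ?lexx ?cd //.
rewrite (@eq_I _ c d (fun s => g s * (_ + _)) (fun s => g s * P s)); last first.
  by move=> s sI; rewrite -PE.
rewrite (@eq_I _ c d (fun s => (_ + _) * P' s) (fun s => g s * P s + F s ^+ 2 * tau' s)); last first.
  by move=> s sI; rewrite -FE // /P' /P; ring.
have sFt' : sqi c d (fun t => F t * tau t) by exact: bt.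
have iFt' : itg c d (fun t => F t ^+ 2 * tau' t).
  have := sqiM sF (bt F tau' sF ctau'); apply: eq_itg => t _; ring.
rewrite ID //; last exact: sqiM.
(* At [d] either [F] vanishes, or [d = m] is the zero of the multiplier: the second case serves a
   half interval ending at the free Neumann end. *)
have -> : F d * P d - F c * P c = 0.
  rewrite /P Fc !mul0r subr0; case: Fd => [->|->]; first by rewrite mul0r.
  by rewrite /tau subrr mulr0 tan0 !mulr0.
move=> ibp; have iFF : itg c d (fun t => F t ^+ 2) by case: sF.
have igg : itg c d (fun t => g t ^+ 2) by case: sg.
have igP : itg c d (fun t => g t * P t) by exact: sqiM.
have : 0 <= Int c d (fun t => g t ^+ 2 + 2 * (g t * P t) +
    (F t ^+ 2 * tau' t - k ^+ 2 * F t ^+ 2)).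
  apply: I_ge0 => t _; have -> : g t ^+ 2 + 2 * (g t * P t) +
    (F t ^+ 2 * tau' t - k ^+ 2 * F t ^+ 2) = (g t + P t) ^+ 2.
    by rewrite /P /tau'; ring.
  exact: sqr_ge0.
rewrite ID; [|by apply: itgD => //; exact: itgZ|by apply: itgB => //; exact: itgZ].
rewrite ID //; last exact: itgZ.
rewrite IB //; last exact: itgZ.
rewrite !IZ //; lra.
Qed.

Lemma Wirtinger_nodes a l k n F g : 0 < l -> 0 < k -> k * l < pi ->
  sqi a (a + n%:R * l) g ->
  (forall t, a <= t <= a + n%:R * l -> F t = F a + Int a t g) ->
  (forall j, (j <= n)%N -> F (a + j%:R * l) = 0) ->
  k ^+ 2 * Int a (a + n%:R * l) (fun t => F t ^+ 2) <=
  Int a (a + n%:R * l) (fun t => g t ^+ 2).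
Proof.
move=> l0 k0 kl; elim: n => [|n IH] sg FE F0.
  by rewrite mul0r addr0 !I_point mulr0.
set b := a + n%:R * l; set b' := a + n.+1%:R * l.
have bb : b <= b' by rewrite /b' -natr1 mulrDl mul1r addrA lerDl ltW.
have ab : a <= b by rewrite lerDl mulr_ge0 // ltW.
have b'E : b' = b + l by rewrite /b' -natr1 mulrDl mul1r addrA.
have sF : sqi a b' F.
  apply: (@eq_sqi _ _ _ (fun t => F a + Int a t g)); first by move=> t /FE.
  exact: cts_sqi (cts_prim (le_trans ab bb) sg).
rewrite !(@I_split _ b a b') //; [|by case: sg|by case: sF].
rewrite mulrDr; apply: lerD.
  apply: IH.
  - by apply: sqi_sub sg.
  - by move=> t /andP[t1 t2]; apply: FE; rewrite t1 (le_trans t2).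
  - by move=> j jn; apply: F0; exact: leqW.
apply: (@Wirtinger b b' k (b + l / 2)) => //.
- by apply: sqi_sub sg.
- move=> t /andP[bt tb]; rewrite (FE t) ?(le_trans ab) // (FE b) ?ab ?bb //.
  rewrite (@I_split _ b a t) ?addrA //.
  by apply: itg_sub (sqi_itg sg).
- move=> t /andP[bt tb]; rewrite normrM gtr0_norm //.
  have h : `|t - (b + l / 2)| <= l / 2.
    by rewrite ler_norml; apply/andP; split; rewrite b'E in tb; lra.
  apply: le_lt_trans (_ : k * (l / 2) < _); first by rewrite ler_wpM2l // ltW.
  by rewrite mulrA ltr_pM2r.
- exact: F0.
- by left; exact: F0.
Qed.

End Wirtinger.

(** * The inequality for functions vanishing at nodes *)

Section NodalInequality.
Context {R : realType}.
Implicit Types (p q : @PW R) (bc : boundary).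

Local Notation Kb := (@Kb R).
(** The node spacing on [[0, 1]]. In the Neumann case [M] full intervals leave exactly half an
    interval before the free end. *)
Definition ell bc M : R := if bc is Dirichlet then M.+1%:R^-1 else (M%:R + 2^-1)^-1.

Lemma Hdot_JJ p : Hdot (J p) (J p) =
  Int (-1) 0 (fun t => JU p t ^+ 2) + Int 0 1 (fun t => JV p t ^+ 2) + JU p 0 ^+ 2.
Proof. by rewrite /J (Hdot_mkH2 _ _ (JU_sqi p) (JV_sqi p) (JU_sqi p) (JV_sqi p)). Qed.

Lemma pdot_pp p : pdot p p = Int (-1) 0 (fun t => p.1 t ^+ 2) + Int 0 1 (fun t => p.2 t ^+ 2).
Proof. by rewrite /pdot !L2dotE. Qed.

(** The node at 0 removes the point mass [z] and decouples the two intervals, each treated between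
    consecutive nodes. *)
Lemma nodal_ineq bc M p : Wp bc p ->
  (forall j, (j <= M)%N -> JU p (-1 + j.+1%:R / M.+1%:R) = 0) ->
  (forall j, (0 < j <= M)%N -> JV p (j%:R * ell bc M) = 0) ->
  Kb bc M ^+ 2 * Hdot (J p) (J p) <= pdot p p.
Proof.
move=> Wpp hu hv; have p0 := pi_gt0 R; have M0 : 0 <= M%:R :> R by [].
have M1 : M.+1%:R = M%:R + 1 :> R by rewrite -natr1.
have k0 : 0 < Kb bc M by case: bc {Wpp hv} => /=; rewrite mulr_gt0 //; lra.
have JU0 : JU p 0 = 0.
  by have := hu M (leqnn M); rewrite divff ?addNr.
have JUN1 : JU p (-1) = 0 by rewrite /JU I_point addr0.
have JV0 : JV p 0 = 0 by rewrite /JV I_point addr0.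
rewrite Hdot_JJ JU0 expr0n /= addr0 pdot_pp mulrDr; apply: lerD.
  have e : -1 + M.+1%:R * M.+1%:R^-1 = 0 :> R by rewrite divff ?addNr.
  have kl : Kb bc M * M.+1%:R^-1 < pi.
    by rewrite ltr_pdivrMr // M1; case: bc {Wpp hv k0} => /=; nra.
  have l0 : 0 < M.+1%:R^-1 :> R by [].
  have := @Wirtinger_nodes _ (-1) _ _ M.+1 (JU p) p.1 l0 k0 kl; rewrite e; apply.
  - exact: L2_sqi.
  - by move=> t _; rewrite JUN1 add0r /JU add0r.
  - by case=> [_|j jM]; [rewrite mul0r addr0|exact: hu].
have l0 : 0 < ell bc M by case: bc {Wpp hv k0} => /=; rewrite invr_gt0; lra.
have JVE (t : R) : 0 <= t <= 1 -> JV p t = JV p 0 + Int 0 t p.2 by rewrite JV0 /JV JU0.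
case: bc Wpp hv l0 k0 => /= Wpp hv l0 k0.
  have e : 0 + M.+1%:R * M.+1%:R^-1 = 1 :> R by rewrite divff ?add0r.
  have kl : (M%:R + 2^-1) * pi * M.+1%:R^-1 < pi :> R by rewrite ltr_pdivrMr // M1; nra.
  have := @Wirtinger_nodes _ 0 _ _ M.+1 (JV p) p.2 l0 k0 kl; rewrite e; apply.
  - exact: L2_sqi.
  - exact: JVE.
  - move=> [_|j]; first by rewrite mul0r addr0.
    rewrite leq_eqVlt => /predU1P[->|jM]; last by rewrite add0r hv.
    by rewrite e Wpp.
set l := (M%:R + 2^-1)^-1 in hv l0 *; set k := _ * pi in k0 *.
have le1 : M%:R * l <= 1 by rewrite /l ler_pdivrMr; lra.
have Ml0 : 0 <= M%:R * l by rewrite mulr_ge0 // ltW.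
have kl : k * l < pi by rewrite /l ltr_pdivrMr ?/k; nra.
have iV : itg 0 1 (fun t => JV p t ^+ 2) by case: (JV_sqi p).
have ip : itg 0 1 (fun t => p.2 t ^+ 2) by case: (L2_sqi p.2).
rewrite (@I_split _ (M%:R * l) 0 1) // (@I_split _ (M%:R * l) 0 1 (fun t => p.2 t ^+ 2)) //.
rewrite mulrDr; apply: lerD.
  have := @Wirtinger_nodes _ 0 l k M (JV p) p.2 l0 k0 kl; rewrite !add0r; apply.
  - by apply: sqi_sub (L2_sqi p.2).
  - by move=> t /andP[t0 tM]; apply: JVE; rewrite t0 (le_trans tM).
  - by case=> [|j] jM; rewrite ?mul0r add0r // ?mul0r // hv.
(* The last half interval, with the multiplier centred at the free end. *)
apply: (@Wirtinger _ _ _ k 1) => //.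
- by apply: sqi_sub (L2_sqi p.2).
- move=> t /andP[Mt t1]; have t0 := le_trans Ml0 Mt.
  have hM : JV p (M%:R * l) = JV p 0 + Int 0 (M%:R * l) p.2 by apply: JVE; rewrite Ml0.
  have ht : JV p t = JV p 0 + Int 0 t p.2 by apply: JVE; rewrite t0.
  have it : itg 0 t p.2 by apply: itg_sub (sqi_itg (L2_sqi p.2)).
  by rewrite hM ht (I_split Ml0 Mt it) addrA.
- move=> t /andP[Mt t1]; rewrite normrM gtr0_norm // ler0_norm ?subr_le0 //.
  have : 1 - t <= l / 2.
    have : M%:R * l + l / 2 = 1 by rewrite /l; field; lra.
    lra.
  rewrite ltr_pdivlMr //; nra.
- by case: (M) hv => [|n] hv; [rewrite mul0r|rewrite hv /=].
- by right.
Qed.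

End NodalInequality.

(** * Orthogonality, spectral gap and Parseval's identity *)

Section Completeness.
Context {R : realType}.
Implicit Types (p q : @PW R) (bc : boundary) (x y w : H R).

Local Notation mu := (@mu R).
Local Notation Kb := (@Kb R).
Local Notation Wp := (@Wp R).

Definition e_ bc n : H R := Ef (mu bc n).
Definition nrm bc n : R := Hdot (e_ bc n) (e_ bc n).
Definition coef bc x n : R := Hdot x (e_ bc n) / nrm bc n.
Definition proj bc x K : H R := \sum_(0 <= n < K) coef bc x n *: e_ bc n.

Lemma nrm_ge bc n : (4 * mu bc n ^+ 2)^-1 <= nrm bc n.
Proof.
have m0 := @mu_gt0 R bc n; have := Ef_norm_ge m0 (@mu_bc R bc n).
rewrite -/(nrm bc n) => h; rewrite -ler_pdivrMl ?exprn_gt0 // in h.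
by rewrite invfM mulrC.
Qed.

Lemma nrm_gt0 bc n : 0 < nrm bc n.
Proof.
by apply: lt_le_trans (nrm_ge bc n); rewrite invr_gt0 mulr_gt0 // exprn_gt0 ?(@mu_gt0 R).
Qed.

Lemma nrm_neq0 bc n : nrm bc n != 0. Proof. by rewrite gt_eqF ?nrm_gt0. Qed.

Lemma pdot_e bc p n : Wp bc p ->
  pdot p (pE (mu bc n)) = mu bc n ^+ 2 * Hdot (J p) (e_ bc n).
Proof. exact: pdot_eigen (@mu_neq0 R _ _) (@mu_bc R _ _). Qed.

Lemma Wp_e bc n : Wp bc (pE (mu bc n)).
Proof. exact: Wp_pE (@mu_neq0 R _ _) (@mu_bc R _ _). Qed.

Lemma e_J bc n : Heq (e_ bc n) (J (pE (mu bc n))).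
Proof. exact: Ef_J (@mu_neq0 R _ _). Qed.

Lemma e_ortho bc i j : i != j -> Hdot (e_ bc i) (e_ bc j) = 0.
Proof.
move=> ij; have h1 := pdot_e j (Wp_e (bc := bc) i); have h2 := pdot_e i (Wp_e (bc := bc) j).
rewrite -(Hdot_Heq _ (e_J bc i)) in h1; rewrite -(Hdot_Heq _ (e_J bc j)) HdotC in h2.
have : (mu bc j ^+ 2 - mu bc i ^+ 2) * Hdot (e_ bc i) (e_ bc j) = 0.
  by rewrite mulrBl -h1 -h2 pdotC subrr.
move/eqP; rewrite mulf_eq0 => /orP[|/eqP //].
rewrite subr_eq0 eqrXn2 ?(ltW (@mu_gt0 R _ _)) // => /eqP/mu_inj e.
by rewrite e eqxx in ij.
Qed.

Lemma lin_sum (V : lmodType R) (L : V -> R) n (a : nat -> R) (v : nat -> V) :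
  (forall k (u u' : V), L (k *: u + u') = k * L u + L u') ->
  L (\sum_(0 <= j < n) a j *: v j) = \sum_(0 <= j < n) a j * L (v j).
Proof.
move=> Ll; have L0 : L 0 = 0.
  by have := Ll 1 0 0; rewrite scale1r addr0 mul1r => h; lra.
elim: n => [|n IH]; first by rewrite !big_nil.
by rewrite !big_nat_recr //= addrC Ll IH addrC.
Qed.

Lemma HdotJ_linear w k p q : Hdot (J (k *: p + q)) w = k * Hdot (J p) w + Hdot (J q) w.
Proof. by rewrite (Hdot_Heq _ (J_linear k p q)) Hdot_linear. Qed.

Lemma sum_ortho bc n (a : nat -> R) j : (j < n)%N ->
  \sum_(0 <= i < n) a i * Hdot (e_ bc i) (e_ bc j) = a j * nrm bc j.
Proof.
move=> jn; rewrite (bigD1_seq j) ?mem_index_iota ?iota_uniq //= big1 ?addr0 // => i ij.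
by rewrite e_ortho ?mulr0.
Qed.

Lemma Hdot_proj bc x K n : (n < K)%N -> Hdot (proj bc x K) (e_ bc n) = Hdot x (e_ bc n).
Proof.
move=> nK; rewrite /proj (@lin_sum _ (fun y => Hdot y (e_ bc n))); last first.
  by move=> k u w; exact: Hdot_linear.
by rewrite sum_ortho // /coef divfK ?nrm_neq0.
Qed.

Lemma Hdot_projr bc x y K :
  Hdot (proj bc x K) y = series (fun n => Hdot x (e_ bc n) * Hdot y (e_ bc n) / nrm bc n) K.
Proof.
rewrite /proj (@lin_sum _ (fun w => Hdot w y)); last by move=> k u w; exact: Hdot_linear.
by rewrite /series /=; apply: eq_bigr => n _; rewrite /coef HdotC mulrAC (HdotC y).
Qed.

Lemma Bessel bc x K : series (fun n => Hdot x (e_ bc n) ^+ 2 / nrm bc n) K <= Hdot x x.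
Proof.
set s := series _ _; have e1 : Hdot (proj bc x K) x = s.
  by rewrite Hdot_projr.
have e2 : Hdot (proj bc x K) (proj bc x K) = s.
  rewrite Hdot_projr /s /series /=; apply: eq_big_nat => n /andP[_ nK].
  by rewrite Hdot_proj.
have := Hdot_ge0 (x - proj bc x K); rewrite HdotB !HdotBr (HdotC x (proj _ _ _)) e1 e2.
lra.
Qed.

Lemma Bessel_cvg bc x : cvgn (series (fun n => Hdot x (e_ bc n) ^+ 2 / nrm bc n)).
Proof.
apply: bounded_cvg_series (Bessel bc x) => k.
by rewrite divr_ge0 ?sqr_ge0 ?(ltW (nrm_gt0 _ _)).
Qed.

Lemma Wp0 bc : Wp bc 0.
Proof.
move=> _; have := @JV_linear R 1 0 0 1 ler01 (lexx _).
by rewrite scaler0 addr0 mul1r; lra.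
Qed.

Lemma Wp_sum bc n (a : nat -> R) (v : nat -> @PW R) :
  (forall j, Wp bc (v j)) -> Wp bc (\sum_(0 <= j < n) a j *: v j).
Proof.
move=> Wv; elim: n => [|n IH]; first by rewrite big_nil; exact: Wp0.
by rewrite big_nat_recr //= addrC; apply: Wp_linear.
Qed.

Lemma left_kernel m (A : 'M[R]_(m.+1, m)) : exists2 a : 'rV[R]_m.+1, a != 0 & a *m A = 0.
Proof.
have : kermx A != 0.
  rewrite -mxrank_eq0 mxrank_ker subn_eq0 -ltnNge ltnS; exact: rank_leq_col.
move/rowV0Pn => [a /sub_kermxP aA a0]; by exists a.
Qed.

(** Some nontrivial combination of [p] and the first [2M+1] eigenfunctions vanishes at the
    [2M+1] nodes, while the nodal constant exceeds the [2M+1] first eigenvalues. *)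
Lemma spectral_gap bc M p : Wp bc p ->
  (forall n, (n <= M.*2)%N -> Hdot (J p) (e_ bc n) = 0) ->
  Kb bc M ^+ 2 * Hdot (J p) (J p) <= pdot p p.
Proof.
move=> Wpp po; set m := M.*2.+1.
(* Evaluations at the [2M + 1] nodes: the first [M + 1] lie on [[-1, 0]], with 0 as the last, and
   the other [M] on []0, 1]]. *)
pose phi (i : nat) (q : @PW R) := if (i <= M)%N then JU q (-1 + i.+1%:R / M.+1%:R)
  else JV q ((i - M)%:R * ell bc M).
have l0 : 0 < ell bc M :> R.
  by have M0 : 0 <= M%:R :> R by []; case: bc {Wpp po phi} => /=; rewrite invr_gt0; lra.
have phil i k q r : (i < m)%N -> phi i (k *: q + r) = k * phi i q + phi i r.
  move=> im; rewrite /phi; case: ifP => iM.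
    have h : i.+1%:R / M.+1%:R <= 1 :> R by rewrite ler_pdivrMr // mul1r ler_nat.
    have h' : 0 <= i.+1%:R / M.+1%:R :> R by rewrite divr_ge0.
    by move: h h'; set z := _ / _ => h h'; apply: JU_linear; lra.
  apply: JV_linear; first by rewrite mulr_ge0 // ltW.
  have : (i - M <= M)%N by lia.
  rewrite -(ler_nat R) => h; have M0 : 0 <= M%:R :> R by [].
  case: bc {Wpp po phi l0} => /=; last by rewrite ler_pdivrMr ?mul1r; lra.
  by rewrite ler_pdivrMr // mul1r ler_nat; lia.
pose v j := if (j < m)%N then pE (mu bc j) else p.
have [a a0 aA] := left_kernel (\matrix_(i < m.+1, j < m) phi j (v i)).
pose b j := a 0 (inord j).
pose s : @PW R := \sum_(0 <= j < m) b j *: pE (mu bc j).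
pose r := b m *: p + s.
have Ws : Wp bc s by apply: Wp_sum => j; exact: Wp_e.
have Wr : Wp bc r by exact: Wp_linear.
have rE : r = \sum_(0 <= j < m.+1) b j *: v j.
  rewrite /r addrC big_nat_recr //= {2}/v ltnn; congr (_ + _).
  by apply: eq_big_nat => j /andP[_ jm]; rewrite /v jm.
have phir i : (i < m)%N -> phi i r = 0.
  move=> im; rewrite rE lin_sum; last by move=> *; exact: phil.
  move/matrixP: aA => /(_ 0 (Ordinal im)); rewrite !mxE => h; rewrite -[RHS]h.
  rewrite big_mkord; apply: eq_bigr => j _; rewrite !mxE /b.
  by congr (a 0 _ * _); apply/val_inj; rewrite /= inordK.
have key : Kb bc M ^+ 2 * Hdot (J r) (J r) <= pdot r r.
  apply: nodal_ineq => // [j jM|j /andP[j0 jM]].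
    by have := phir j; rewrite /phi jM; apply; rewrite /m; lia.
  have := phir (j + M)%N; rewrite /phi addnK.
  have -> : (j + M <= M)%N = false by lia.
  by apply; rewrite /m; lia.
have sp : pdot s p = 0.
  rewrite (@lin_sum _ (fun q => pdot q p)); last by move=> *; exact: pdot_linear.
  rewrite big_nat big1 // => j /andP[_ jm].
  by rewrite pdotC pdot_e // po ?mulr0 // -ltnS.
have spJ : Hdot (J s) (J p) = 0.
  rewrite (@lin_sum _ (fun q => Hdot (J q) (J p))); last by move=> *; exact: HdotJ_linear.
  rewrite big_nat big1 // => j /andP[_ jm].
  by rewrite -(Hdot_Heq _ (e_J _ _)) HdotC po ?mulr0 // -ltnS.
have Jse j : (j < m)%N -> Hdot (J s) (e_ bc j) = b j * nrm bc j.
  move=> jm; rewrite (@lin_sum _ (fun q => Hdot (J q) (e_ bc j))); last first.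
    by move=> *; exact: HdotJ_linear.
  by rewrite -(sum_ortho bc b jm); apply: eq_bigr => i _; rewrite -(Hdot_Heq _ (e_J _ _)).
have ss : pdot s s = \sum_(0 <= j < m) mu bc j ^+ 2 * (b j ^+ 2 * nrm bc j).
  rewrite {1}/s (@lin_sum _ (fun q => pdot q s)); last by move=> *; exact: pdot_linear.
  apply: eq_big_nat => j /andP[_ jm]; rewrite pdotC pdot_e // Jse //; ring.
have ssJ : Hdot (J s) (J s) = \sum_(0 <= j < m) (b j ^+ 2 * nrm bc j).
  rewrite {1}/s (@lin_sum _ (fun q => Hdot (J q) (J s))); last first.
    by move=> *; exact: HdotJ_linear.
  apply: eq_big_nat => j /andP[_ jm].
  rewrite -(Hdot_Heq _ (e_J _ _)) HdotC Jse //; ring.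
have rr : pdot r r = b m ^+ 2 * pdot p p + pdot s s.
  rewrite /r pdot_linear (pdotC p) (pdotC s) !pdot_linear sp (pdotC p s) sp; ring.
have rrJ : Hdot (J r) (J r) = b m ^+ 2 * Hdot (J p) (J p) + Hdot (J s) (J s).
  rewrite /r HdotJ_linear (HdotC (J p)) (HdotC (J s)) !HdotJ_linear spJ (HdotC (J p)) spJ; ring.
have gap : \sum_(0 <= j < m) (Kb bc M ^+ 2 - mu bc j ^+ 2) * (b j ^+ 2 * nrm bc j) =
    Kb bc M ^+ 2 * Hdot (J s) (J s) - pdot s s.
  rewrite ss ssJ mulr_sumr -sumrB; apply: eq_bigr => j _; ring.
have muK j : (j < m)%N -> 0 < Kb bc M ^+ 2 - mu bc j ^+ 2.
  move=> jm; rewrite subr_gt0 ltrXn2r ?nnegrE ?(ltW (@mu_gt0 R _ _)) //.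
  by apply: le_lt_trans (@mu_lt_Kb R bc M); apply: (@mu_le R bc); rewrite -ltnS.
have gap0 j : (j < m)%N -> 0 <= (Kb bc M ^+ 2 - mu bc j ^+ 2) * (b j ^+ 2 * nrm bc j).
  move=> jm; apply: mulr_ge0; first exact: ltW (muK j jm).
  by rewrite mulr_ge0 ?sqr_ge0 ?(ltW (nrm_gt0 _ _)).
have gap_ge0 : 0 <= Kb bc M ^+ 2 * Hdot (J s) (J s) - pdot s s.
  by rewrite -gap big_nat; apply: sumr_ge0 => j /andP[_ jm]; exact: gap0.
(* The orthogonality of [p] and [s] for both inner products turns [key] into [b_m^2 (Kb^2 |J p|^2 -
   pdot p p) <= pdot s s - Kb^2 |J s|^2 <= 0]; a nonzero [b m] cancels. *)
have [bm0|bm0] := eqVneq (b m) 0; last first.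
  have b2 : 0 < b m ^+ 2 by rewrite exprn_even_gt0.
  by rewrite -(ler_pM2l b2); rewrite rr rrJ in key; lra.
(* With [b m = 0] the combination consists of eigenfunctions of frequency below [Kb], so equality
   holds in the gap and every coefficient vanishes, against [a != 0]. *)
have /eqP : \sum_(0 <= j < m) (Kb bc M ^+ 2 - mu bc j ^+ 2) * (b j ^+ 2 * nrm bc j) = 0.
  by rewrite gap; rewrite rr rrJ bm0 expr0n /= !mul0r in key; lra.
rewrite big_nat psumr_eq0; last by move=> j /andP[_ jm]; exact: gap0.
move/allP => h; case/negP: a0; apply/eqP/rowP => i; rewrite mxE.
have bi : a 0 i = b i by rewrite /b; congr (a 0 _); apply/val_inj; rewrite /= inordK.
rewrite bi; have := ltn_ord i; rewrite ltnS leq_eqVlt => /predU1P[->//|im].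
have := h i; rewrite mem_index_iota /= => /(_ im); rewrite im /=.
rewrite mulf_eq0 gt_eqF ?muK //= mulf_eq0 (negbTE (nrm_neq0 _ _)) orbF sqrf_eq0.
by move/eqP.
Qed.

(** The remainder is orthogonal to the first [2M + 1] eigenfunctions, so the gap applies to it; it
    is also orthogonal in energy to the projection, so its energy is at most that of [x]. *)
Lemma proj_error bc x M K : (M.*2 < K)%N -> inW bc x ->
  Kb bc M ^+ 2 * Hnorm (x - proj bc x K) ^+ 2 <= Wnorm x ^+ 2.
Proof.
move=> MK /inW_elim[xJ Wpp ->]; set p := (_, _) in xJ Wpp *; rewrite HnormE.
pose s : @PW R := \sum_(0 <= j < K) coef bc x j *: pE (mu bc j).
have Js w : Hdot (J s) w = Hdot (proj bc x K) w.
  rewrite /s (@lin_sum _ (fun q => Hdot (J q) w)); last by move=> *; exact: HdotJ_linear.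
  rewrite /proj (@lin_sum _ (fun y => Hdot y w)); last by move=> *; exact: Hdot_linear.
  by apply: eq_bigr => j _; rewrite -(Hdot_Heq _ (e_J _ _)).
have Ws : Wp bc s by apply: Wp_sum => j; exact: Wp_e.
pose r := (-1) *: s + p.
have Wr : Wp bc r by exact: Wp_linear.
have Jr w : Hdot (J r) w = Hdot (x - proj bc x K) w.
  by rewrite HdotJ_linear HdotB Js -(Hdot_Heq _ xJ); ring.
have ro n : (n < K)%N -> Hdot (J r) (e_ bc n) = 0.
  by move=> nK; rewrite Jr HdotB Hdot_proj ?subrr.
have -> : Hdot (x - proj bc x K) (x - proj bc x K) = Hdot (J r) (J r).
  by rewrite Jr HdotC -Jr HdotC.
apply: le_trans (spectral_gap Wr _) _.
  by move=> n nM; apply: ro; apply: leq_ltn_trans MK.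
have rs : pdot r s = 0.
  rewrite pdotC {1}/s (@lin_sum _ (fun q => pdot q r)); last by move=> *; exact: pdot_linear.
  rewrite big_nat big1 // => j /andP[_ jK].
  by rewrite pdotC pdot_e // ro // !mulr0.
have pE' : p = s + r by rewrite /r addrA scaleN1r subrr add0r.
rewrite pE' pdotD pdotC pdotD (pdotC r (s + r)) pdotD (pdotC s r) rs addr0 add0r.
by rewrite lerDr pdot_ge0.
Qed.

Lemma proj_cvg bc x : inW bc x -> Hnorm (x - proj bc x K) @[K --> \oo] --> (0 : R).
Proof.
move=> xW; apply/cvgrPdist_le => e e0.
have [M hM] : exists M : nat, Wnorm x / e + 1 <= M%:R.
  by have [M _ h] := nbhs_infty_ger (Wnorm x / e + 1); exists M; apply: h => /=.
exists M.*2.+1 => // K /= MK; rewrite sub0r normrN ger0_norm ?Hnorm_ge0 //.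
have W0 : 0 <= Wnorm x by exact: sqrtr_ge0.
have We : 0 <= Wnorm x / e by rewrite divr_ge0 // ltW.
have KM := @Kb_ge R bc M; have := proj_error MK xW.
have n0 := Hnorm_ge0 (x - proj bc x K).
have K0 : 0 < Kb bc M by lra.
rewrite -exprMn ler_pXn2r ?nnegrE ?mulr_ge0 ?(ltW K0) // => h.
have : Wnorm x <= Kb bc M * e by rewrite -ler_pdivrMr //; lra.
move: h; rewrite -(ler_pM2l K0 _ e); lra.
Qed.

Lemma Parseval bc x y : inW bc x ->
  series (fun n => Hdot x (e_ bc n) * Hdot y (e_ bc n) / nrm bc n) @ \oo --> Hdot x y.
Proof.
move=> xW; apply/cvgrPdist_le => e e0.
have y1 : 0 < Hnorm y + 1 by have := Hnorm_ge0 y; lra.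
have /cvgrPdist_le/(_ (e / (Hnorm y + 1))) := proj_cvg xW.
rewrite divr_gt0 // => /(_ isT)[K0 _ h]; exists K0 => // K /h /=.
rewrite sub0r normrN ger0_norm ?Hnorm_ge0 // => hh.
rewrite -Hdot_projr -HdotB; apply: le_trans (Hdot_le _ _) _.
rewrite ler_pdivlMr // in hh; have := Hnorm_ge0 (x - proj bc x K); nra.
Qed.

Lemma ortho_eq0 bc x : inW bc x -> (forall n, Hdot x (e_ bc n) = 0) -> Heq x 0.
Proof.
move=> xW xo; apply: Hdot_eq0; have := Parseval (y := x) xW.
rewrite (_ : series _ = fun=> 0); last first.
  by apply/funext => K; rewrite /series /= big1 // => n _; rewrite xo !mul0r.
move=> h; exact: cvg_unique h (cvg_cst _).
Qed.

Lemma prim_sqr_le (a b t : R) g : a <= t <= b -> b - a <= 1 -> sqi a b g ->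
  Int a t g ^+ 2 <= Int a b (fun u => g u ^+ 2).
Proof.
move=> /andP[at_ tb] ab1 sg; have sgt : sqi a t g by exact: sqi_sub sg.
have nn : 0 <= Int a t (fun u => g u ^+ 2) by apply: I_ge0 => u _; exact: sqr_ge0.
have n1 : 0 <= Int t b (fun u => g u ^+ 2) by apply: I_ge0 => u _; exact: sqr_ge0.
apply: le_trans (_ : Int a t (fun u => `|g u|) ^+ 2 <= _).
  rewrite -(real_normK (num_real (Int a t g))) lerXn2r ?nnegrE //.
    by apply: I_ge0.
  exact/I_norm/sqi_itg.
apply: le_trans (I_CauchySchwarz at_ sgt) _.
by rewrite (@I_split _ t a b) //; [nra|case: sg].
Qed.

(** Makes each element of [H] a bounded functional on the energy space, with the constant 2 that
    reappears in [within_continuity]. *)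
Lemma Poincare bc x : inW bc x -> Hnorm x <= 2 * Wnorm x.
Proof.
move=> /inW_elim[xJ _ Wx]; have W0 : 0 <= Wnorm x by exact: sqrtr_ge0.
rewrite -(@ler_pXn2r _ 2) ?nnegrE ?Hnorm_ge0 ?mulr_ge0 // exprMn Wx HnormE.
move: xJ; set p := (_, _) => xJ; rewrite (Hdot_Heq2 xJ xJ) Hdot_JJ pdot_pp.
set A := Int (-1) 0 (fun t => p.1 t ^+ 2); set B := Int 0 1 (fun t => p.2 t ^+ 2).
have JUle t : -1 <= t <= 0 -> JU p t ^+ 2 <= A.
  by move=> tI; rewrite /JU add0r; apply: prim_sqr_le (L2_sqi _) => //; lra.
have JVle t : 0 <= t <= 1 -> JV p t ^+ 2 <= 2 * (A + B).
  move=> tI; have h0 : JU p 0 ^+ 2 <= A by apply: JUle; lra.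
  have h1 : Int 0 t p.2 ^+ 2 <= B by apply: prim_sqr_le (L2_sqi _) => //; lra.
  by rewrite /JV; have := sqr_ge0 (JU p 0 - Int 0 t p.2); nra.
have iU : Int (-1) 0 (fun t => JU p t ^+ 2) <= A.
  apply: le_trans (le_I _ (itg_cst _ _ A) JUle) _; first by case: (JU_sqi p).
  by rewrite I_cst; lra.
have iV : Int 0 1 (fun t => JV p t ^+ 2) <= 2 * (A + B).
  apply: le_trans (le_I _ (itg_cst _ _ (2 * (A + B))) JVle) _; first by case: (JV_sqi p).
  by rewrite I_cst; lra.
have h0 : JU p 0 ^+ 2 <= A by apply: JUle; lra.
have A0 : 0 <= A by apply: I_ge0 => t _; exact: sqr_ge0.
have B0 : 0 <= B by apply: I_ge0 => t _; exact: sqr_ge0.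
lra.
Qed.

End Completeness.

(** * Eigenfunction series with rapidly decreasing coefficients *)

Section RapidSeries.
Context {R : realType}.
Implicit Types (bc : boundary) (a : R^nat) (t : R).
Local Notation mu := (@mu R).

(** Summability against every power of the frequency: the sum is then smooth up to the boundary, and
    its derivatives and traces are computed termwise. *)
Definition rapid bc a := forall n, cvgn (series (fun k => `|a k| * mu bc k ^+ n)).

Definition jet_series (fam : nat -> nat -> R -> R) a (n : nat) t : R :=
  limn (series (fun k => a k * fam k n t)).

Section Family.
Variables (bc : boundary) (a : R^nat) (fam : nat -> nat -> R -> R) (C : R).
Hypothesis ra : rapid bc a.
Hypothesis fam_jet : forall k, jet (fun=> True) (fam k).
Hypothesis fam_le : forall k n t, `|fam k n t| <= C * mu bc k ^+ n.

Lemma rapid_term k n t : `|a k * fam k n t| <= C * (`|a k| * mu bc k ^+ n).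
Proof. by rewrite normrM mulrCA ler_wpM2l. Qed.

Lemma rapid_major n : cvgn (series (fun k => C * (`|a k| * mu bc k ^+ n))).
Proof. exact: cvgP (lim_seriesMl (l := C) (@ra n)). Qed.

Lemma rapid_series_cvg n t : cvgn (series (fun k => a k * fam k n t)).
Proof. by apply: abs_cvg_series _ (@rapid_major n) => k; exact: rapid_term. Qed.

Lemma jet_series_jet : jet (fun=> True) (jet_series fam a).
Proof.
move=> n t _; apply: (@is_derive_series _ _ (fun k t => a k * fam k n.+1 t)
  (fun k t => a k * fam k n.+2 t) (fun k => C * (`|a k| * mu bc k ^+ n.+2)) t 1) => //.
- by move=> k s _; apply: dZ; exact: fam_jet.
- by move=> k s _; apply: dZ; exact: fam_jet.
- by move=> k s _; exact: rapid_term.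
- exact: rapid_major.
- by move=> s _; exact: rapid_series_cvg.
- exact: rapid_series_cvg.
Qed.

Lemma Int_jet_series b c y : itg b c y ->
  series (fun k => a k * Int b c (fun t => y t * fam k 0%N t)) @ \oo -->
  Int b c (fun t => y t * jet_series fam a 0%N t).
Proof.
move=> iy; have cf k : continuous (fam k 0%N) by exact: jet_continuous.
have iyf k : itg b c (fun t => y t * fam k 0%N t).
  apply: (@le_itg _ _ _ _ (fun t => C * `|y t|)).
  - apply: measurable_funM; first exact: itg_meas.
    by apply: cts_meas; apply: continuous_subspaceT; exact: cf.
  - move=> t _; rewrite normrM mulrC ler_wpM2r //.
    by have := fam_le k 0%N t; rewrite expr0 mulr1.
  - exact/itgZ/itg_norm.
have [] := @Int_series _ b c (fun k t => a k * (y t * fam k 0%N t))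
  (fun t => y t * jet_series fam a 0%N t)
  (fun k => C * (`|a k| * mu bc k ^+ 0) * Int b c (fun t => `|y t|)).
- by move=> k; apply: itgZ.
- move=> k; rewrite -IZ; last exact: itg_norm.
  apply: le_I => [||t _]; [exact/itg_norm/itgZ|exact/itgZ/itg_norm|].
  by rewrite mulrCA normrM mulrC ler_wpM2r // rapid_term.
- have := lim_seriesMl (l := Int b c (fun t => `|y t|)) (@rapid_major 0).
  move=> h; apply: cvgP; apply: cvg_trans h; apply: near_eq_cvg.
  by near=> n; apply: eq_bigr => k _; rewrite mulrC.
- move=> t _; have := lim_seriesMl (l := y t) (rapid_series_cvg (n := 0) (t := t)).
  by apply: cvg_trans; apply: near_eq_cvg; near=> n; apply: eq_bigr => k _; rewrite mulrCA.
- move=> _ h; apply: cvg_trans h; apply: near_eq_cvg; near=> n.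
  by apply: eq_bigr => k _; rewrite IZ.
Unshelve. all: by end_near.
Qed.

End Family.

Definition euj m n t := (- m ^+ 2) ^+ n./2 * (if odd n then deu m t else eu m t).
Definition evj m n t := (- m ^+ 2) ^+ n./2 * (if odd n then dev m t else ev m t).

Lemma half_jet (m : R) (f df : R -> R) : 
  (forall t, is_derive t 1 f (df t)) -> (forall t, is_derive t 1 df (- m ^+ 2 * f t)) ->
  jet (fun=> True) (fun n t => (- m ^+ 2) ^+ n./2 * (if odd n then df t else f t)).
Proof.
move=> hf hdf n t _; rewrite /= uphalf_half; case: (odd n) => /=.
  by apply: is_derive_eq (dZ _ (hdf t)) _; rewrite exprD expr1; ring.
exact: dZ.
Qed.

Lemma half_bound (m x y C : R) n : 0 < m -> `|x| <= C -> `|y| <= m * C ->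
  `|(- m ^+ 2) ^+ n./2 * (if odd n then y else x)| <= C * m ^+ n.
Proof.
move=> m0 hx hy; rewrite normrM normrX normrN normrX (gtr0_norm m0) -exprM mulrC.
rewrite -[in leRHS](odd_double_half n) exprD -mul2n mulrA ler_wpM2r ?exprn_ge0 ?(ltW m0) //.
by case: (odd n); rewrite ?expr1 ?expr0 ?mulr1 // mulrC.
Qed.

Lemma euj_jet m : m != 0 -> jet (fun=> True) (euj m).
Proof. by move=> m0; apply: half_jet => t; [exact: eu_d|exact: deu_d]. Qed.

Lemma evj_jet m : m != 0 -> jet (fun=> True) (evj m).
Proof. by move=> m0; apply: half_jet => t; [exact: ev_d|exact: dev_d]. Qed.

Definition ebound bc : R := (mu bc 0)^-1 + 1.

Lemma ebound_gt0 bc : 0 < ebound bc.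
Proof. by rewrite addr_gt0 // invr_gt0 (@mu_gt0 R). Qed.

Lemma mu_inv_le bc k : (mu bc k)^-1 + 1 <= ebound bc.
Proof. by rewrite lerD2r lef_pV2 ?posrE ?(@mu_gt0 R) //; exact: (@mu_le R). Qed.

Lemma euj_le bc k n t : `|euj (mu bc k) n t| <= ebound bc * mu bc k ^+ n.
Proof.
have m0 := @mu_gt0 R bc k; have im := mu_inv_le bc k.
have i0 : 0 < (mu bc k)^-1 by rewrite invr_gt0.
apply: half_bound => //.
  rewrite /eu normrM (gtr0_norm i0); have := sin_max (mu bc k * (1 + t)).
  by have := normr_ge0 (sin (mu bc k * (1 + t))); nra.
apply: le_trans (cos_max _) _; apply: le_trans (_ : mu bc k * ((mu bc k)^-1 + 1) <= _).
  by rewrite mulrDr mulr1 divff ?gt_eqF //; lra.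
by rewrite ler_wpM2l // ltW.
Qed.

Lemma evj_le bc k n t : `|evj (mu bc k) n t| <= ebound bc * mu bc k ^+ n.
Proof.
have m0 := @mu_gt0 R bc k; have im := mu_inv_le bc k.
have i0 : 0 < (mu bc k)^-1 by rewrite invr_gt0.
apply: half_bound => //.
  apply: le_trans im; rewrite /ev; apply: le_trans (ler_normB _ _) _.
  rewrite normrM (gtr0_norm i0) normrM.
  have := sin_max (mu bc k * (1 + t)); have := sin_max (mu bc k * t).
  have := sin_max (mu bc k).
  have := normr_ge0 (sin (mu bc k * (1 + t))).
  have := normr_ge0 (sin (mu bc k)); have := normr_ge0 (sin (mu bc k * t)).
  by move=> *; nra.
apply: le_trans (_ : mu bc k * ((mu bc k)^-1 + 1) <= _); last by rewrite ler_wpM2l // ltW.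
rewrite mulrDr mulr1 divff ?gt_eqF // /dev; apply: le_trans (ler_normB _ _) _.
apply: lerD; first exact: cos_max.
rewrite !normrM (gtr0_norm m0) -mulrA ger_pMr // -[leRHS]mulr1.
by apply: ler_pM => //; [exact: sin_max|exact: cos_max].
Qed.

Definition SU bc a := jet_series (fun k => euj (mu bc k)) a.
Definition SV bc a := jet_series (fun k => evj (mu bc k)) a.
Definition Sw bc a : H R := mkH (SU bc a 0) (SV bc a 0) (SU bc a 0 0).
Definition Sp bc a : PW := (toL2 (-1) 0 (SU bc a 1), toL2 0 1 (SV bc a 1)).

Section RapidElement.
Variables (bc : boundary) (a : R^nat).
Hypothesis ra : rapid bc a.

Lemma SU_jet : jet (fun=> True) (SU bc a).
Proof.
by apply: jet_series_jet (@ra) _ (euj_le bc) => k; exact: euj_jet (@mu_neq0 R _ _).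
Qed.

Lemma SV_jet : jet (fun=> True) (SV bc a).
Proof.
by apply: jet_series_jet (@ra) _ (evj_le bc) => k; exact: evj_jet (@mu_neq0 R _ _).
Qed.

Lemma SV_cvg n t : series (fun k => a k * evj (mu bc k) n t) @ \oo --> SV bc a n t.
Proof. exact: (@rapid_series_cvg bc a (fun k => evj (mu bc k)) _ ra (evj_le bc) n t). Qed.

Lemma jet_sqi (F : nat -> R -> R) n b c : jet (fun=> True) F -> sqi b c (F n).
Proof. by move=> h; apply: cts_sqiT; exact: jet_continuous. Qed.

Lemma jet_FTC (F : nat -> R -> R) n b t : jet (fun=> True) F -> b <= t ->
  F n b + Int b t (F n.+1) = F n t.
Proof.
move=> h bt; apply: FTC2D => //; first exact: jet_continuous.
by move=> s; exact: h.
Qed.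

Lemma jet_toL2 (F : nat -> R -> R) n b c t : jet (fun=> True) F -> b <= t -> t <= c ->
  F n b + Int b t (toL2 b c (F n.+1)) = F n t.
Proof.
move=> h bt tc; rewrite -(@jet_FTC F n b t h bt); congr (_ + _); apply: eq_I => s /andP[bs st].
by rewrite toL2E ?bs ?(le_trans st) //; exact: jet_sqi.
Qed.

Lemma SU_N1 : SU bc a 0 (-1) = 0.
Proof.
rewrite /SU /jet_series (_ : (fun k => _) = fun=> 0).
  by rewrite (_ : series _ = fun=> 0) ?lim_cst //; apply/funext => n; rewrite /series /= big1.
by apply/funext => k; rewrite /euj /= euN1 !mulr0.
Qed.

Lemma SU_SV0 : SU bc a 0 0 = SV bc a 0 0.
Proof.
rewrite /SU /SV /jet_series; congr (limn (series _)); apply/funext => k.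
by rewrite /euj /evj /= eu0 ev0.
Qed.

Lemma JU_Sp t : -1 <= t -> t <= 0 -> JU (Sp bc a) t = SU bc a 0 t.
Proof. by move=> t1 t0; have := jet_toL2 0 SU_jet t1 t0; rewrite SU_N1. Qed.

Lemma JV_Sp t : 0 <= t -> t <= 1 -> JV (Sp bc a) t = SV bc a 0 t.
Proof.
by move=> t0 t1; rewrite /JV JU_Sp ?leN10 // SU_SV0; exact: (jet_toL2 0 SV_jet t0 t1).
Qed.

Lemma Sw_J : Heq (Sw bc a) (J (Sp bc a)).
Proof.
apply: Heq_mkH; rewrite ?JU_Sp ?leN10 //.
- exact: JU_sqi.
- exact: JV_sqi.
- apply: eq_aeq => t /andP[t1 t2]; rewrite /Sw /Hu /= toL2E ?(ltW t1) ?(ltW t2) //.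
    by rewrite JU_Sp ?ltW.
  exact: jet_sqi SU_jet.
- apply: eq_aeq => t /andP[t1 t2]; rewrite /Sw /Hv /= toL2E ?(ltW t1) ?(ltW t2) //.
    by rewrite JV_Sp ?ltW.
  exact: jet_sqi SV_jet.
Qed.

Lemma SV_bc n : n = (if bc is Dirichlet then 0%N else 1%N) -> SV bc a n 1 = 0.
Proof.
move=> ->; rewrite /SV /jet_series (_ : (fun k => _) = fun=> 0).
  by rewrite (_ : series _ = fun=> 0) ?lim_cst //; apply/funext => j; rewrite /series /= big1.
apply/funext => k; have := @mu_bc R bc k.
by case: (bc) => /= h; rewrite /evj /= h !mulr0.
Qed.

Lemma Wp_Sp : Wp bc (Sp bc a).
Proof. by move=> e; rewrite JV_Sp // SV_bc // e. Qed.

Lemma Sw_domA : domA bc (Sw bc a).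
Proof.
have h := @domA_intro _ bc (Sw bc a) (Sp bc a) (SU bc a 1 (-1)) (SV bc a 1 0)
  (SU bc a 2) (SV bc a 2) Sw_J Wp_Sp.
have [] // := h _ _ _ _ _.
- exact: jet_sqi SU_jet.
- exact: jet_sqi SV_jet.
- apply: eq_aeq => t /andP[t1 t2]; rewrite toL2E ?(ltW t1) ?(ltW t2) //.
    by rewrite jet_FTC ?ltW //; exact: SU_jet.
  exact: jet_sqi SU_jet.
- apply: eq_aeq => t /andP[t1 t2]; rewrite toL2E ?(ltW t1) ?(ltW t2) //.
    by rewrite jet_FTC ?ltW //; exact: SV_jet.
  exact: jet_sqi SV_jet.
- by move=> e; rewrite jet_FTC //; [rewrite SV_bc // e|exact: SV_jet].
Qed.

Lemma Sw_inW : inW bc (Sw bc a). Proof. by case: Sw_domA. Qed.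

(** Turns the [xget] traces of any representative into values of smooth functions at 1. *)
Lemma Sw_traces x : Heq x (Sw bc a) ->
  trace (Hv x) 1 = SV bc a 0 1 /\ trace (wderiv (Hv x)) 1 = SV bc a 1 1.
Proof.
move=> xS; have [_ _ _ h] := inW_intro (Heq_trans xS Sw_J) Wp_Sp.
have ctsV n : {within `[0, 1], continuous (SV bc a n)}.
  exact/continuous_subspaceT/jet_continuous/SV_jet.
split; (apply: traceE; rewrite ?ler01 ?lexx //).
  case: xS => _ /aeqP xv _; apply: aeq_trans xv _; apply: eq_aeq => t /andP[t1 t2].
  by rewrite toL2E ?(ltW t1) ?(ltW t2) //; exact: jet_sqi SV_jet.
apply: aeq_trans h _; apply: eq_aeq => t /andP[t1 t2].
by rewrite toL2E ?(ltW t1) ?(ltW t2) //; exact: jet_sqi SV_jet.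
Qed.

Lemma Hdot_Sw y : series (fun k => a k * Hdot y (e_ bc k)) @ \oo --> Hdot y (Sw bc a).
Proof.
have jU k : jet (fun=> True) (euj (mu bc k)) by exact: euj_jet (@mu_neq0 R _ _).
have jV k : jet (fun=> True) (evj (mu bc k)) by exact: evj_jet (@mu_neq0 R _ _).
have h1 := Int_jet_series (@ra) jU (euj_le bc) (sqi_itg (L2_sqi (Hu y))).
have h2 := Int_jet_series (@ra) jV (evj_le bc) (sqi_itg (L2_sqi (Hv y))).
have h3 : series (fun k => a k * (Hz y * eu (mu bc k) 0)) @ \oo --> Hz y * SU bc a 0 0.
  have := lim_seriesMl (l := Hz y) (rapid_series_cvg (@ra) (euj_le bc) (n := 0) (t := 0)).
  apply: cvg_trans; apply: near_eq_cvg; near=> n; apply: eq_bigr => k _.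
  by rewrite mulrCA /euj /= mul1r.
rewrite /Sw Hdot_mkH; [|exact: jet_sqi SU_jet|exact: jet_sqi SV_jet].
apply: cvg_trans (cvgD (cvgD h1 h2) h3); apply: near_eq_cvg; near=> n.
rewrite !fctE /series /= -!big_split /=; apply: eq_bigr => k _.
rewrite Hdot_mkH; [|exact: eu_sqi (@mu_neq0 R _ _)|exact: ev_sqi (@mu_neq0 R _ _)].
rewrite -eu0 !mulrDr; congr (_ * _ + _ * _ + _); apply: eq_I => t _;
  by rewrite /euj /evj /= expr0 mul1r.
Unshelve. all: by end_near.
Qed.

Lemma Hdot_Sw_e n : Hdot (Sw bc a) (e_ bc n) = a n * nrm bc n.
Proof.
rewrite HdotC; apply: cvg_unique (Hdot_Sw (y := e_ bc n)) _ => //.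
apply: cvg_near_cst; near=> K; have nK : (n < K)%N by near: K; exact: nbhs_infty_gt.
rewrite -(sum_ortho bc a nK); apply: eq_bigr => k _; by rewrite HdotC.
Unshelve. all: by end_near.
Qed.

End RapidElement.

End RapidSeries.

(** * Exponential multipliers and their decay *)

Section Exponentials.
Context {R : realType}.
Implicit Types (c : R -> R) (l t h u e : R).
Local Notation mu := (@mu R).
Local Notation e_ := (@e_ R).
Local Notation nrm := (@nrm R).

Lemma expR_quadratic u : 0 <= u -> u <= 2^-1 ->
  0 <= expR u - 1 - u <= 2 * u ^+ 2 /\ expR u <= 2.
Proof.
move=> u0 u1; have := expR_ge1Dx u; have := expR_ge1Dx (- u).
rewrite expRN => h1 h2; have e0 := expR_gt0 u.
have h3 : expR u * (1 - u) <= 1.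
  by move: h1; rewrite -(ler_pM2l e0) divff ?gt_eqF.
split; last by nra.
apply/andP; split; first by lra.
nra.
Qed.

Lemma norm_expr1_le (x a : R) n : `|x - 1| <= a -> `|x ^+ n - 1| <= (1 + a) ^+ n - 1.
Proof.
move=> xa; have a0 : 0 <= a by exact: le_trans (normr_ge0 _) xa.
have x1 : `|x| <= 1 + a.
  by have := ler_normD (x - 1) 1; rewrite subrK normr1; lra.
elim: n => [|n IH]; first by rewrite !expr0 subrr normr0.
have -> : x ^+ n.+1 - 1 = x * (x ^+ n - 1) + (x - 1) by rewrite exprS; ring.
apply: le_trans (ler_normD _ _) _; rewrite normrM exprS.
have := normr_ge0 (x ^+ n - 1); have := normr_ge0 x.
nra.
Qed.

(** [c t = c (t / n) ^+ n], and the right derivative at the origin controls [c (t / n)]. *)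
Lemma multiplicative_expR c l t : 0 <= l -> 0 < t ->
  (forall s t, 0 <= s -> 0 <= t -> c (s + t) = c s * c t) ->
  ((c h - 1) / h + l) @[h --> 0^'+] --> 0 -> c t = expR (- l * t).
Proof.
move=> l0 t0 cM /cvg_at_rightP cl.
pose u n := t / n.+1%:R.
have u0 n : 0 < u n by exact: divr_gt0.
have uc : u @ \oo --> 0.
  have := @cvgMr _ _ _ _ _ t _ (@cvg_harmonic R); rewrite mulr0; exact.
have /cvgrPdist_le uF := cl u (conj u0 uc).
have /cvgrPdist_le uC := uc.
have cX k (v : R) : 0 <= v -> c (k.+1%:R * v) = c v ^+ k.+1.
  move=> v0; elim: k => [|k IH]; first by rewrite mul1r expr1.
  rewrite -natr1 mulrDl mul1r cM ?mulr_ge0 // IH -exprSr //.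
have key e : 0 < e -> `|c t * expR (l * t) - 1| <= expR (5 * e * t) - 1.
  move=> e0.
  (* The two thresholds ensure [l * u n <= 1/2], for the quadratic bound on the exponential, and
     [l^2 * u n <= e], so that second-order terms are at most [e * u n]. *)
  have f0 : 0 < Num.min (2^-1 / (l + 1)) (e / (l ^+ 2 + 1)).
    rewrite lt_min; apply/andP; split; apply: divr_gt0 => //; first by lra.
  by have := sqr_ge0 l; lra.
  near \oo => n.
  have h1 : `|0 - ((c (u n) - 1) / u n + l)| <= e by near: n; exact: uF.
  have h2 : `|0 - u n| <= Num.min (2^-1 / (l + 1)) (e / (l ^+ 2 + 1)) by near: n; exact: uC.
  have un0 := u0 n; rewrite sub0r normrN gtr0_norm // le_min in h2.
  have /andP[h2a h2b] := h2.
  rewrite ler_pdivlMr in h2a; last by lra.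
  rewrite ler_pdivlMr in h2b; last by have := sqr_ge0 l; lra.
  have lu : l * u n <= 2^-1 by nra.
  have llu : l ^+ 2 * u n <= e by nra.
  have lu0 : 0 <= l * u n by rewrite mulr_ge0 // ltW.
  have [/andP[r0 r1] e2] := expR_quadratic lu0 lu.
  set ee := expR (l * u n) in r0 r1 e2.
  set eps := (c (u n) - 1) / u n + l in h1; rewrite sub0r normrN in h1.
  have cu : c (u n) = 1 - l * u n + u n * eps by rewrite /eps; field; rewrite gt_eqF.
  (* The three pieces of the expansion cost 1, 2 and 2 times [e * u n]. *)
  have d1 : `|c (u n) * ee - 1| <= 5 * e * u n.
    have -> : c (u n) * ee - 1 = - (l * u n) ^+ 2 + (1 - l * u n) * (ee - 1 - l * u n)
        + u n * eps * ee by rewrite cu; ring.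
    have b1 : `|- (l * u n) ^+ 2| <= e * u n.
      rewrite normrN ger0_norm ?sqr_ge0 //.
      have -> : (l * u n) ^+ 2 = (l ^+ 2 * u n) * u n by ring.
      by rewrite ler_wpM2r // ltW.
    have b2 : `|(1 - l * u n) * (ee - 1 - l * u n)| <= 2 * (e * u n).
      rewrite normrM ger0_norm; last by lra.
      rewrite (ger0_norm r0); have : (l * u n) ^+ 2 <= e * u n.
        have -> : (l * u n) ^+ 2 = (l ^+ 2 * u n) * u n by ring.
        by rewrite ler_wpM2r // ltW.
      nra.
    have b3 : `|u n * eps * ee| <= 2 * (e * u n).
      rewrite normrM normrM (gtr0_norm un0) (gtr0_norm (expR_gt0 _)) -/ee.
      have ne := normr_ge0 eps; have ee0 : 0 < ee by exact: expR_gt0.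
      have : `|eps| * ee <= e * 2 by apply: ler_pM => //; exact: ltW.
      by nra.
    apply: le_trans (ler_normD _ _) _; apply: le_trans (lerD (ler_normD _ _) (lexx _)) _.
    lra.
  have tu : t = n.+1%:R * u n by rewrite /u mulrC divfK.
  have -> : c t * expR (l * t) = (c (u n) * ee) ^+ n.+1.
    by rewrite exprMn -cX ?(ltW un0) // -tu -expRM_natl tu; congr (_ * expR _); ring.
  apply: le_trans (norm_expr1_le _ d1) _; rewrite lerD2r.
  have -> : expR (5 * e * t) = expR (5 * e * u n) ^+ n.+1.
    by rewrite -expRM_natl {1}tu; congr expR; ring.
  apply: lerXn2r; rewrite ?nnegrE ?expR_ge0 ?expR_ge1Dx //.
  by rewrite addr_ge0 // !mulr_ge0 // ltW.
have d1 : c t * expR (l * t) = 1.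
  apply/eqP; rewrite -subr_eq0 -normr_le0 leNgt; apply/negP.
  (* With this [e] the bound [key] reads [d <= d / 2]. *)
  set d := `|_| => d0; pose e := ln (1 + d / 2) / (5 * t).
  have e0 : 0 < e by rewrite divr_gt0 ?ln_gt0 ?mulr_gt0 //; lra.
  have := key e e0; rewrite -/d.
  have -> : 5 * e * t = ln (1 + d / 2) by rewrite /e; field; rewrite gt_eqF.
  by rewrite lnK ?posrE; lra.
by rewrite mulNr expRN -[RHS]mul1r -d1 mulfK // gt_eqF ?expR_gt0.
Unshelve. all: by end_near.
Qed.

(** Half of the exponent is spent on the power: [m ^+ n] is at most 1 for [m <= 1], and at most
    [m^(2n)] otherwise, which the exponential series bounds. *)
Lemma expR_poly_decay (t : R) n : 0 < t -> exists2 C, 0 <= C &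
  forall m : R, 0 < m -> m ^+ n * expR (- m ^+ 2 * t) <= C * expR (- m ^+ 2 * (t / 2)).
Proof.
move=> t0; pose s := t / 2; have s0 : 0 < s by exact: divr_gt0.
have sn : 0 < s ^+ n by exact: exprn_gt0.
have f0 := @fact_gt0R R n.
exists (1 + n`!%:R / s ^+ n) => [|m m0]; first by rewrite addr_ge0 // divr_ge0 ?ltW.
have -> : - m ^+ 2 * t = - m ^+ 2 * s + - (m ^+ 2 * s) by rewrite /s; field.
rewrite expRD mulrCA mulrC -/s ler_wpM2r ?expR_ge0 // expRN ler_pdivrMr ?expR_gt0 //.
have m2 : 0 <= m ^+ 2 * s by rewrite mulr_ge0 ?sqr_ge0 // ltW.
have e1 : 1 <= expR (m ^+ 2 * s) by have := expR_ge1Dx (m ^+ 2 * s); lra.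
have h := ler_exprn_fact n m2.
have hm : m ^+ n.*2 <= n`!%:R / s ^+ n * expR (m ^+ 2 * s).
  rewrite exprMn -exprM mul2n in h; rewrite ler_pdivrMr // in h.
  by rewrite mulrAC ler_pdivlMr // mulrC (mulrC n`!%:R) mulrC.
rewrite mulrDl mul1r; have [m1|m1] := leP m 1.
  have : m ^+ n <= 1 by apply: exprn_ile1 => //; exact: ltW.
  have : 0 <= n`!%:R / s ^+ n * expR (m ^+ 2 * s) by rewrite !mulr_ge0 ?invr_ge0 ?expR_ge0 ?ltW.
  lra.
have : m ^+ n <= m ^+ n.*2 by apply: ler_weXn2l; [exact: ltW|rewrite -addnn leq_addr].
lra.
Qed.

Lemma expR_mu_le bc k (t : R) : 0 <= t -> expR (- mu bc k ^+ 2 * t) <= expR (- t) ^+ k.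
Proof.
move=> t0; rewrite -expRM_natl ler_expR mulrN mulNr lerN2 ler_wpM2r //.
case: k => [|k]; first exact: sqr_ge0.
have := @mu_ge_nat R bc k.+1; have : 1 <= k.+1%:R :> R by rewrite ler1n.
by nra.
Qed.

Lemma cvg_expR_series (t : R) : 0 < t -> cvgn (series (fun k => expR (- t) ^+ k)).
Proof.
move=> t0; have := @is_cvg_geometric_series R 1 (expR (- t)).
rewrite ger0_norm ?expR_ge0 // expR_lt1 oppr_lt0 => /(_ t0).
by under [geometric _ _]eq_fun do rewrite mul1r.
Qed.

Definition heat bc x t k := coef bc x k * expR (- mu bc k ^+ 2 * t).

(** The eigenfunctions are normalised by their slope at [-1], so their norms may decay, but no
    faster than [1 / (2 mu)]. *)
Lemma coef_le bc x k : `|coef bc x k| <= 2 * Hnorm x * mu bc k.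
Proof.
have m0 := @mu_gt0 R bc k; have h0 := @nrm_ge R bc k; have N0 := @nrm_gt0 R bc k.
rewrite /coef normrM normfV (gtr0_norm N0) ler_pdivrMr //.
apply: le_trans (Hdot_le _ _) _.
have e0 := Hnorm_ge0 (e_ bc k); have x0 := Hnorm_ge0 x.
have : nrm bc k = Hnorm (e_ bc k) ^+ 2 by rewrite HnormE.
set h := Hnorm (e_ bc k) in e0 *; set N := nrm bc k in h0 N0 *; move=> NE.
have : 1 <= 2 * mu bc k * h.
  rewrite -(@ler_pXn2r _ 2) ?nnegrE ?mulr_ge0 ?(ltW m0) // expr1n !exprMn -NE.
  have m2 : 0 < 4 * mu bc k ^+ 2 by rewrite mulr_gt0 // exprn_gt0.
  rewrite -(ler_pM2l m2) divff ?gt_eqF // in h0.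
  by apply: le_trans h0 _; rewrite le_eqVlt; apply/orP; left; apply/eqP; ring.
rewrite NE => h1; have : Hnorm x * h * 1 <= Hnorm x * h * (2 * mu bc k * h).
  by rewrite ler_wpM2l // mulr_ge0.
lra.
Qed.

Lemma heat_le bc x (t : R) n : 0 < t -> exists2 C, 0 <= C & forall k,
  `|heat bc x t k| * mu bc k ^+ n <= C * expR (- (t / 2)) ^+ k.
Proof.
move=> t0; have [C C0 hC] := @expR_poly_decay t n.+1 t0.
have x0 := Hnorm_ge0 x.
exists (2 * Hnorm x * C) => [|k]; first by rewrite !mulr_ge0.
have m0 := @mu_gt0 R bc k.
rewrite /heat normrM (ger0_norm (expR_ge0 _)) mulrAC -mulrA.
apply: le_trans (_ : 2 * Hnorm x * (mu bc k ^+ n.+1 * expR (- mu bc k ^+ 2 * t)) <= _).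
  rewrite [mu bc k ^+ n.+1]exprS -(mulrA (mu bc k)) [leRHS]mulrA ler_wpM2r ?coef_le //.
  by rewrite mulr_ge0 ?expR_ge0 // exprn_ge0 // ltW.
rewrite -!mulrA ler_wpM2l // ler_wpM2l //; apply: le_trans (hC _ m0) _.
by rewrite ler_wpM2l //; apply: expR_mu_le; rewrite divr_ge0 // ltW.
Qed.

Lemma rapid_heat bc x t : 0 < t -> rapid bc (heat bc x t).
Proof.
move=> t0 n; have [C C0 hC] := heat_le bc x n t0.
apply: (@abs_cvg_series _ _ (fun k => C * expR (- (t / 2)) ^+ k)).
  by move=> k; rewrite ger0_norm // mulr_ge0 // exprn_ge0 // ltW // (@mu_gt0 R).
exact: cvgP (lim_seriesMl (l := C) (cvg_expR_series (divr_gt0 t0 _))).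
Qed.

End Exponentials.

(** * Spectral form of the semigroup *)

Section Semigroup.
Context {R : realType}.
Variables (bc : boundary) (S : R -> H R -> H R).
Hypothesis SG : generated_semigroup bc S.
Implicit Types (x y w : H R) (s t h : R).
Local Notation mu := (@mu R bc).
Local Notation e_ := (@e_ R bc).
Local Notation nrm := (@nrm R bc).

Lemma inW_Heq x y : Heq x y -> inW bc y -> inW bc x.
Proof. by move=> xy /inW_elim[yJ Wy _]; case: (inW_intro (Heq_trans xy yJ) Wy). Qed.

Lemma e_domA n : domA bc (e_ n) /\ Heq (opA (e_ n)) (- mu n ^+ 2 *: e_ n).
Proof. exact: Ef_domA (@mu_neq0 R _ _) (@mu_bc R _ _). Qed.

Lemma opA_e x n : domA bc x -> Hdot (opA x) (e_ n) = - mu n ^+ 2 * Hdot x (e_ n).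
Proof. exact: opA_Ef (@mu_neq0 R _ _) (@mu_bc R _ _). Qed.

(** With [x = opA w], the coefficients of [w] are those of [x] divided by [- mu n ^+ 2]; they vanish
    and [w] lies in the energy space, where completeness is known. *)
Lemma ortho_eq0_all x : (forall n, Hdot x (e_ n) = 0) -> Heq x 0.
Proof.
move=> xo; have [w [wA wx]] := opA_surj bc x.
have w0 : Heq w 0.
  have wW : inW bc w by case: wA.
  apply: (ortho_eq0 wW) => n; have := opA_e n wA; rewrite (Hdot_Heq _ wx) xo => /esym/eqP.
  by rewrite mulf_eq0 oppr_eq0 expf_eq0 (negbTE (@mu_neq0 R _ _)) andbF => /eqP.
exact: Heq_trans (Heq_sym wx) (opA_Heq0 wA w0).
Qed.

Lemma eq_by_coefs x y : (forall n, Hdot x (e_ n) = Hdot y (e_ n)) -> Heq x y.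
Proof. by move=> xy; apply/Heq_of_sub/ortho_eq0_all => n; rewrite HdotB xy subrr. Qed.

Lemma SZD t k x y : 0 <= t -> Heq (S t (k *: x + y)) (k *: S t x + S t y).
Proof. exact: sg_linear SG _ _ _ _. Qed.

Lemma S_0 t : 0 <= t -> Heq (S t 0) 0.
Proof.
move=> t0; have [C hC] := sg_bounded SG t0; apply: Hnorm_eq0; apply/eqP.
by rewrite eq_le Hnorm_ge0 andbT; have := hC 0; rewrite Hnorm0 mulr0.
Qed.

Lemma SZ t k x : 0 <= t -> Heq (S t (k *: x)) (k *: S t x).
Proof.
move=> t0; have := SZD k x 0 t0; rewrite addr0 => /Heq_trans; apply.
by have := HeqD (Heq_refl (k *: S t x)) (S_0 t0); rewrite addr0.
Qed.

Lemma SB t x y : 0 <= t -> Heq (S t (x - y)) (S t x - S t y).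
Proof.
move=> t0; have := SZD (-1) y x t0.
by rewrite !scaleN1r ![- _ + _]addrC.
Qed.

Lemma S_Heq t x y : 0 <= t -> Heq x y -> Heq (S t x) (S t y).
Proof.
move=> t0 xy; apply: Heq_of_sub; apply: Heq_trans (Heq_sym (SB x y t0)) _.
have [C hC] := sg_bounded SG t0; apply: Hnorm_eq0; apply/eqP.
rewrite eq_le Hnorm_ge0 andbT; apply: le_trans (hC _) _.
by have := HeqB xy (Heq_refl y); rewrite subrr => /Hnorm_Heq ->; rewrite Hnorm0 mulr0.
Qed.

(** By linearity and the semigroup law, the difference quotients of [S t x] are the images under the
    bounded [S t] of those of [x]. *)
Lemma S_domA t x : 0 <= t -> domA bc x ->
  domA bc (S t x) /\ Heq (S t (opA x)) (opA (S t x)).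
Proof.
move=> t0 xA; apply/(sg_generator SG).
have [C hC] := sg_bounded SG t0.
have /(sg_generator SG) xg : domA bc x /\ Heq (opA x) (opA x) by split => //; exact: Heq_refl.
have hc : C * Hnorm (h^-1 *: (S h x - x) - opA x) @[h --> 0^'+] --> 0.
  by rewrite -[X in _ --> X](mulr0 C); exact: cvgMr.
apply: squeeze_cvgr (cvg_cst 0) hc; near=> h.
have h0 : 0 < h by near: h; exact: nbhs_right_gt.
rewrite Hnorm_ge0 /=; apply: le_trans (hC _); rewrite le_eqVlt; apply/orP; left; apply/eqP.
apply/Hnorm_Heq/Heq_sym/(Heq_trans (SB _ _ t0))/HeqB; last exact: Heq_refl.
apply: Heq_trans (SZ _ _ t0) _; apply: HeqZ; apply: Heq_trans (SB _ _ t0) _.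
apply: HeqB; last exact: Heq_refl.
apply: Heq_trans (Heq_sym (sg_D SG x t0 (ltW h0))) _.
by rewrite addrC; exact: (sg_D SG).
Unshelve. all: by end_near.
Qed.

(** [S t (e_ k)] is again an eigenvector for [- mu k ^+ 2], while symmetry multiplies its
    coefficient on [e_ n] by [- mu n ^+ 2]. *)
Lemma S_e_ortho t k n : 0 <= t -> n != k -> Hdot (S t (e_ k)) (e_ n) = 0.
Proof.
move=> t0 nk; have [eA eO] := e_domA k; have [SA SO] := S_domA t0 eA.
have h1 := opA_e n SA.
rewrite -(Hdot_Heq _ SO) (Hdot_Heq _ (S_Heq t0 eO)) (Hdot_Heq _ (SZ _ _ t0)) HdotZ in h1.
move/eqP: h1; rewrite -subr_eq0 -mulrBl mulf_eq0 => /orP[|/eqP //].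
rewrite opprK addrC subr_eq0 eqrXn2 ?(ltW (@mu_gt0 R _ _)) // => /eqP/(@mu_inj R) e.
by rewrite e eqxx in nk.
Qed.

Lemma S_e_coef t k : 0 <= t -> Heq (S t (e_ k)) (coef bc (S t (e_ k)) k *: e_ k).
Proof.
move=> t0; apply: eq_by_coefs => n; rewrite HdotZ.
have [->|nk] := eqVneq n k; first by rewrite divfK ?(@nrm_neq0 R).
by rewrite S_e_ortho // e_ortho ?mulr0 // eq_sym.
Qed.

Lemma S_e t k : 0 < t -> Heq (S t (e_ k)) (expR (- mu k ^+ 2 * t) *: e_ k).
Proof.
move=> t0; pose c s := coef bc (S s (e_ k)) k.
rewrite -(@multiplicative_expR _ c (mu k ^+ 2) t) ?sqr_ge0 //.
- exact: S_e_coef (ltW t0).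
- move=> s u s0 u0; rewrite /c /coef (Hdot_Heq _ (sg_D SG _ s0 u0)).
  rewrite (Hdot_Heq _ (S_Heq s0 (S_e_coef k u0))) (Hdot_Heq _ (SZ _ _ s0)) HdotZ.
  by rewrite -mulrA mulrC.
- have [eA eO] := e_domA k.
  have /(sg_generator SG) eg : domA bc (e_ k) /\ Heq (- mu k ^+ 2 *: e_ k) (opA (e_ k)).
    by split => //; exact: Heq_sym.
  pose K := Hnorm (e_ k) / nrm k.
  have N0 := @nrm_gt0 R bc k.
  have hc : K * Hnorm (h^-1 *: (S h (e_ k) - e_ k) - (- mu k ^+ 2 *: e_ k)) @[h --> 0^'+] --> 0.
    by rewrite -[X in _ --> X](mulr0 K); exact: cvgMr.
  apply/norm_cvg0P; apply: squeeze_cvgr (cvg_cst 0) hc; near=> h.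
  have h0 : 0 < h by near: h; exact: nbhs_right_gt.
  rewrite normr_ge0 /=.
  have -> : (c h - 1) / h + mu k ^+ 2 =
      Hdot (h^-1 *: (S h (e_ k) - e_ k) - (- mu k ^+ 2 *: e_ k)) (e_ k) / nrm k.
    rewrite HdotB !HdotZ HdotB /c /coef -/(nrm k); field.
    by rewrite (@nrm_neq0 R) gt_eqF.
  rewrite normrM normfV (gtr0_norm N0) /K mulrAC ler_wpM2r ?invr_ge0 ?(ltW N0) //.
  by rewrite [leRHS]mulrC Hdot_le.
Unshelve. all: by end_near.
Qed.

Lemma S_proj t x K n : 0 < t -> (n < K)%N ->
  Hdot (S t (proj bc x K)) (e_ n) = expR (- mu n ^+ 2 * t) * Hdot x (e_ n).
Proof.
move=> t0 nK; have sumS (a : nat -> R) L : Heq (S t (\sum_(0 <= i < L) a i *: e_ i))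
    (\sum_(0 <= i < L) (a i * expR (- mu i ^+ 2 * t)) *: e_ i).
  elim: L => [|L IH]; first by rewrite !big_nil; exact: S_0 (ltW t0).
  rewrite !big_nat_recr //= addrC [X in Heq _ X]addrC.
  apply: Heq_trans (SZD _ _ _ (ltW t0)) _; apply: HeqD => //.
  by rewrite -scalerA; apply: HeqZ; exact: S_e.
rewrite (Hdot_Heq _ (sumS _ _)) (@lin_sum R _ (fun y => Hdot y (e_ n))); last first.
  by move=> k u u'; exact: Hdot_linear.
by rewrite sum_ortho // mulrAC /coef divfK ?(@nrm_neq0 R) // mulrC.
Qed.

(** On the energy space the projections converge in norm, so boundedness of [S t] passes to the
    limit from finite combinations. *)
Lemma S_coef_domA t w n : 0 < t -> inW bc w ->
  Hdot (S t w) (e_ n) = expR (- mu n ^+ 2 * t) * Hdot w (e_ n).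
Proof.
move=> t0 wW; have [C hC] := sg_bounded SG (ltW t0).
have cv : Hdot (S t w) (e_ n) - Hdot (S t (proj bc w K)) (e_ n) @[K --> \oo] --> 0.
  have hc : C * Hnorm (w - proj bc w K) * Hnorm (e_ n) @[K --> \oo] --> 0.
    rewrite -[X in _ --> X](mul0r (Hnorm (e_ n))) -(mulr0 C); apply: cvgMl.
    by apply: cvgMr; exact: proj_cvg.
  apply/norm_cvg0P; apply: squeeze_cvgr (cvg_cst 0) hc; near=> K.
  rewrite normr_ge0 /= -HdotB -(Hdot_Heq _ (SB _ _ (ltW t0))).
  by apply: le_trans (Hdot_le _ _) _; rewrite ler_wpM2r ?Hnorm_ge0.
apply/eqP; rewrite -subr_eq0; apply/eqP; apply: cvg_unique cv => //.
apply: cvg_near_cst; near=> K; rewrite S_proj //; near: K; exact: nbhs_infty_gt.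
Unshelve. all: by end_near.
Qed.

(** For [t > 0] and [x = opA w], both sides are [- mu n ^+ 2] times those for [w], since [S t]
    commutes with [opA]. *)
Lemma S_coef t x n : 0 <= t -> Hdot (S t x) (e_ n) = expR (- mu n ^+ 2 * t) * Hdot x (e_ n).
Proof.
rewrite le_eqVlt => /predU1P[<-|t0].
  by rewrite mulr0 expR0 mul1r; apply: Hdot_Heq; exact: (sg_0 SG).
have [w [wA wx]] := opA_surj bc x; have [SA SO] := S_domA (ltW t0) wA.
rewrite -(Hdot_Heq _ (S_Heq (ltW t0) wx)) (Hdot_Heq _ SO) opA_e // -(Hdot_Heq _ wx) opA_e //.
by rewrite S_coef_domA //; [ring|case: wA].
Qed.

Lemma S_heat t x : 0 < t -> Heq (S t x) (Sw bc (heat bc x t)).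
Proof.
move=> t0; apply: eq_by_coefs => n; rewrite Hdot_Sw_e; last exact: rapid_heat.
by rewrite S_coef ?ltW // /heat /coef mulrAC divfK ?(@nrm_neq0 R) // mulrC.
Qed.

Lemma S_inW t x : 0 < t -> inW bc (S t x).
Proof. by move=> t0; apply: inW_Heq (S_heat x t0) (Sw_inW (@rapid_heat R bc x t t0)). Qed.

(** Parseval's identity for [S t x], which lies in the energy space as soon as [t > 0], is compared
    with Bessel's inequality for [x]. *)
Lemma S_contraction t x : 0 <= t -> Hnorm (S t x) <= Hnorm x.
Proof.
rewrite le_eqVlt => /predU1P[<-|t0]; first by rewrite (Hnorm_Heq (sg_0 SG x)).
rewrite -(@ler_pXn2r _ 2) ?nnegrE ?Hnorm_ge0 // !HnormE.
have hP := Parseval (y := S t x) (S_inW x t0); rewrite -(cvg_lim _ hP) //.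
apply: limr_le; first exact: cvgP hP.
 near=> K; apply: le_trans (Bessel bc x K); apply: ler_series => n.
  rewrite ler_wpM2r ?invr_ge0 ?(ltW (@nrm_gt0 R _ _)) // S_coef ?(ltW t0) //.
  have -> : expR (- mu n ^+ 2 * t) * Hdot x (e_ n) * (expR (- mu n ^+ 2 * t) * Hdot x (e_ n)) =
    expR (- mu n ^+ 2 * t) ^+ 2 * Hdot x (e_ n) ^+ 2 by ring.
  rewrite ler_piMl ?sqr_ge0 // exprn_ile1 ?expR_ge0 // -expR0 ler_expR mulNr oppr_le0.
  by rewrite mulr_ge0 ?sqr_ge0 // ltW.
Unshelve. all: by end_near.
Qed.

(** Contraction reduces any increment to one starting at time 0, so continuity at 0 yields a modulus
    uniform in time. *)
Lemma S_increment s t x : 0 <= s -> 0 <= t ->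
  Hnorm (S s x - S t x) <= Hnorm (S `|s - t| x - x).
Proof.
have wl : forall s t : R, 0 <= t -> t <= s ->
    Hnorm (S s x - S t x) <= Hnorm (S `|s - t| x - x).
  move=> {}s {}t t0 ts; have st0 : 0 <= s - t by rewrite subr_ge0.
  apply: le_trans (S_contraction _ t0); rewrite le_eqVlt; apply/orP; left; apply/eqP.
  rewrite ger0_norm //; apply/Hnorm_Heq/Heq_sym/(Heq_trans (SB _ _ t0))/HeqB; last exact: Heq_refl.
  apply: Heq_trans (Heq_sym (sg_D SG x t0 st0)) _; rewrite addrC subrK; exact: Heq_refl.
move=> s0 t0; have [ts|/ltW st] := leP t s; first exact: wl.
by rewrite HnormB distrC; exact: wl.
Qed.

Lemma S_continuity e x : 0 < e -> exists2 d : R, 0 < d & forall s t, 0 <= s -> 0 <= t ->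
  `|s - t| < d -> Hnorm (S s x - S t x) <= e.
Proof.
move=> e0; have /cvgrPdist_le/(_ e e0) := sg_continuous SG x.
move=> [d /= d0 hd]; exists d => // s t s0 t0 std.
apply: le_trans (S_increment x s0 t0) _.
have [->|st] := eqVneq s t.
  rewrite subrr normr0; have := HeqB (sg_0 SG x) (Heq_refl x); rewrite subrr.
  by move/Hnorm_Heq ->; rewrite Hnorm0 ltW.
have st0 : 0 < `|s - t| by rewrite normr_gt0 subr_eq0.
have := hd `|s - t|; rewrite /= sub0r normrN normr_id => /(_ std st0).
by rewrite sub0r normrN (ger0_norm (Hnorm_ge0 _)).
Qed.

(** The observation at 1 dual to the control; with this sign the two transposition identities read
    alike. *)
Definition ctr x : R :=
  if bc is Dirichlet then - trace (wderiv (Hv x)) 1 else trace (Hv x) 1.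

Lemma ctr_heat t x : 0 < t ->
  series (fun k => heat bc x t k * beta bc (mu k)) @ \oo --> ctr (S t x).
Proof.
move=> t0; have ra := @rapid_heat R bc x t t0.
have [h1 h2] := Sw_traces ra (S_heat x t0).
rewrite /ctr; case: (bc) ra h1 h2 => ra h1 h2 /=; rewrite ?h1 ?h2.
  apply: cvg_trans (cvgN (SV_cvg (a := heat Dirichlet x t) ra (n := 1) (t := 1))).
  apply: near_eq_cvg; near=> n.
  rewrite /= !fctE /series /= -sumrN; apply: eq_bigr => k _.
  by rewrite /evj /= expr0 mul1r mulrN.
have := SV_cvg (a := heat Neumann x t) ra (n := 0) (t := 1).
apply: cvg_trans; apply: near_eq_cvg; near=> n.
by apply: eq_bigr => k _; rewrite /evj /= expr0 mul1r.
Unshelve. all: by end_near.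
Qed.

End Semigroup.

(** * The polynomials of the flat parametrisation *)

Section FlatBasis.
Context {R : realType}.
Implicit Types (bc : boundary) (t x : R) (y : H R).
Local Notation mu := (@mu R).
Local Notation e_ := (@e_ R).

Definition mon d x : R := x ^+ d / d`!%:R.
Definition dmon d x : R := if d is d'.+1 then mon d' x else 0.

Lemma mon_d d x : is_derive x 1 (mon d) (dmon d x).
Proof.
case: d => [|d].
  have -> : mon 0 = fun=> 1 by apply/funext => z; rewrite /mon expr0 fact0 divr1.
  exact: dC.
have f0 := @fact_gt0R R d.
have := dZ (d.+1`!%:R^-1) (dX d.+1 (dI x)).
rewrite (_ : (fun t => _) = mon d.+1); last by apply/funext => z; rewrite /mon mulrC.
move=> h; apply: is_derive_eq h _; rewrite /= /mon mulr1 factS natrM.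
have s0 : d.+1%:R != 0 :> R by [].
by field; rewrite nat1r s0 gt_eqF.
Qed.

Lemma mon_le d (x X : R) : `|x| <= X -> `|mon d x| <= X ^+ d / d`!%:R.
Proof.
move=> xX; rewrite normrM normrX normfV (gtr0_norm (fact_gt0R d)).
rewrite ler_wpM2r ?invr_ge0 ?(ltW (fact_gt0R d)) // lerXn2r ?nnegrE //.
exact: le_trans xX.
Qed.

(** [pU i] and [pV i] are the coefficients of [(- m ^+ 2) ^+ i] in [eu m] and [ev m], once
    [sin m * sin (m * x)] is rewritten as [(cos (m * (1 - x)) - cos (m * (1 + x))) / 2]. *)
Definition pU i x := mon i.*2.+1 (1 + x).
Definition pU1 i x := mon i.*2 (1 + x).
Definition pU2 i x := dmon i.*2 (1 + x).
Definition pV i x := mon i.*2.+1 (1 + x) + (mon i.*2 (1 + x) - mon i.*2 (1 - x)) / 2.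
Definition pV1 i x := mon i.*2 (1 + x) + (dmon i.*2 (1 + x) + dmon i.*2 (1 - x)) / 2.
Definition pV2 i x := if i is j.+1 then pV j x else 0.

Lemma d1D x : is_derive x 1 (fun s : R => 1 + s) 1.
Proof. by apply: is_derive_eq (dD (dC x 1) (dI x)) _; rewrite add0r. Qed.

Lemma d1B x : is_derive x 1 (fun s : R => 1 - s) (- 1).
Proof. by apply: is_derive_eq (dB (dC x 1) (dI x)) _; rewrite sub0r. Qed.

Lemma monD_d d x : is_derive x 1 (fun s => mon d (1 + s)) (dmon d (1 + x)).
Proof. by apply: is_derive_eq (dcomp (mon_d d (1 + x)) (d1D x)) _; rewrite mulr1. Qed.

Lemma monB_d d x : is_derive x 1 (fun s => mon d (1 - s)) (- dmon d (1 - x)).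
Proof. by apply: is_derive_eq (@dcomp _ (mon d) (fun s => 1 - s) x _ _ (mon_d d (1 - x)) (d1B x)) _; rewrite mulrN1. Qed.

Lemma pU_d i x : is_derive x 1 (pU i) (pU1 i x). Proof. exact: monD_d. Qed.
Lemma pU1_d i x : is_derive x 1 (pU1 i) (pU2 i x). Proof. exact: monD_d. Qed.

Lemma pV_d i x : is_derive x 1 (pV i) (pV1 i x).
Proof.
have := dD (monD_d i.*2.+1 x) (dZ 2^-1 (dB (monD_d i.*2 x) (monB_d i.*2 x))).
rewrite (_ : (fun t => _) = pV i); last by apply/funext => z; rewrite /pV [_ / 2]mulrC.
by move=> h; apply: is_derive_eq h _; rewrite /pV1 /=; ring.
Qed.

Lemma pV1_d i x : is_derive x 1 (pV1 i) (pV2 i x).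
Proof.
case: i => [|i].
  have -> : pV1 0 = fun=> 1 :> R.
    by apply/funext => z; rewrite /pV1 /= /mon expr0 fact0 divr1 addr0 mul0r addr0.
  exact: dC.
have := dD (monD_d i.*2.+2 x) (dZ 2^-1 (dD (monD_d i.*2.+1 x) (monB_d i.*2.+1 x))).
rewrite (_ : (fun t => _) = pV1 i.+1); last by apply/funext => z; rewrite /pV1 [_ / 2]mulrC.
by move=> h; apply: is_derive_eq h _; rewrite /pV2 /pV /=; ring.
Qed.

Lemma pU2S i : pU2 i.+1 = pU i. Proof. by []. Qed.
Lemma pUN1 i : pU i (-1) = 0.
Proof. by rewrite /pU /mon subrr expr0n mul0r. Qed.
Lemma pU_pV0 i : pU i 0 = pV i 0.
Proof. by rewrite /pV subr0 addr0 subrr mul0r addr0 /pU addr0. Qed.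

Lemma pU_cts i : continuous (pU i). Proof. exact: is_derive_cts (pU_d i). Qed.
Lemma pV_cts i : continuous (pV i). Proof. exact: is_derive_cts (pV_d i). Qed.
Lemma pU1_cts i : continuous (pU1 i). Proof. exact: is_derive_cts (pU1_d i). Qed.
Lemma pV1_cts i : continuous (pV1 i). Proof. exact: is_derive_cts (pV1_d i). Qed.

Lemma pU2_cts i : continuous (pU2 i).
Proof. case: i => [|i]; last exact: pU_cts. by move=> x; exact: cvg_cst. Qed.
Lemma pV2_cts i : continuous (pV2 i).
Proof. case: i => [|i]; last exact: pV_cts. by move=> x; exact: cvg_cst. Qed.

Lemma prim_toL2 (F f : R -> R) b c t : continuous f ->
  (forall s : R, is_derive s 1 F (f s)) -> b <= t -> t <= c ->
  F b + Int b t (toL2 b c f) = F t.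
Proof.
move=> cf dF bt tc; rewrite -(FTC2D bt cf dF); congr (_ + _); apply: eq_I => s /andP[bs st].
by rewrite toL2E ?bs ?(le_trans st) //; exact: cts_sqiT.
Qed.

(** [opA (Q i.+1) = Q i], [opA (Q 0) = 0] (up to the condition at [1]), and the eigenfunction
    [Ef m] is the sum of the [(- m ^+ 2) ^+ i *: Q i]. *)
Definition Q i : H R := mkH (pU i) (pV i) (pU i 0).
Definition Qp i : @PW R := (toL2 (-1) 0 (pU1 i), toL2 0 1 (pV1 i)).

Lemma JU_Qp i t : -1 <= t -> t <= 0 -> JU (Qp i) t = pU i t.
Proof.
move=> t1 t0; rewrite /JU; have := prim_toL2 (@pU1_cts i) (pU_d i) t1 t0.
by rewrite pUN1.
Qed.

Lemma JV_Qp i t : 0 <= t -> t <= 1 -> JV (Qp i) t = pV i t.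
Proof.
move=> t0 t1; rewrite /JV JU_Qp ?leN10 // pU_pV0.
exact: (prim_toL2 (@pV1_cts i) (pV_d i) t0 t1).
Qed.

Lemma pU_sqi i : sqi (-1) 0 (pU i). Proof. exact: cts_sqiT (@pU_cts i). Qed.
Lemma pV_sqi i : sqi 0 1 (pV i). Proof. exact: cts_sqiT (@pV_cts i). Qed.

Lemma Q_J i : Heq (Q i) (J (Qp i)).
Proof.
apply: Heq_mkH; rewrite ?JU_Qp ?leN10 //.
- exact: JU_sqi.
- exact: JV_sqi.
- apply: eq_aeq => t /andP[t1 t2]; rewrite /Q /Hu /= toL2E ?(ltW t1) ?(ltW t2) //.
    by rewrite JU_Qp ?ltW.
  exact: pU_sqi.
- apply: eq_aeq => t /andP[t1 t2]; rewrite /Q /Hv /= toL2E ?(ltW t1) ?(ltW t2) //.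
    by rewrite JV_Qp ?ltW.
  exact: pV_sqi.
Qed.

Definition bflat bc i : R := if bc is Dirichlet then pV i 1 else pV1 i 1.
Definition mom bc n i : R := Hdot (Q i) (e_ bc n).

(** Green's formula: [pdot_Ef] and [pdot_Ef2] evaluate the same energy pairing. The condition on the
    eigenfunction cancels one boundary term at 1, and the other is the product of [beta] and
    [bflat]. *)
Lemma mom_green bc n i :
  Hdot (mkH (pU2 i) (pV2 i) (pV1 i 0 - pU1 i 0)) (e_ bc n) =
  - mu bc n ^+ 2 * mom bc n i + beta bc (mu bc n) * bflat bc i.
Proof.
have m0 := @mu_neq0 R bc n; have mb := @mu_bc R bc n.
have s1 : sqi (-1) 0 (pU2 i) by exact: cts_sqiT (@pU2_cts i).
have s2 : sqi 0 1 (pV2 i) by exact: cts_sqiT (@pV2_cts i).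
have e1 : pU1 i (-1) + Int (-1) 0 (pU2 i) = pU1 i 0.
  exact: FTC2D leN10 (@pU2_cts i) (pU1_d i).
have e2 : pV1 i 0 + Int 0 1 (pV2 i) = pV1 i 1.
  exact: FTC2D ler01 (@pV2_cts i) (pV1_d i).
have h1 := pdot_Ef (Qp i) m0.
have a1 : aeq (-1) 0 (Qp i).1 (fun t => pU1 i (-1) + Int (-1) t (pU2 i)).
  apply: eq_aeq => t /andP[t1 t2]; rewrite toL2E ?(ltW t1) ?(ltW t2) //.
    by rewrite (FTC2D (ltW t1) (@pU2_cts i) (pU1_d i)).
  exact: cts_sqiT (@pU1_cts i).
have a2 : aeq 0 1 (Qp i).2 (fun t => pV1 i 0 + Int 0 t (pV2 i)).
  apply: eq_aeq => t /andP[t1 t2]; rewrite toL2E ?(ltW t1) ?(ltW t2) //.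
    by rewrite (FTC2D (ltW t1) (@pV2_cts i) (pV1_d i)).
  exact: cts_sqiT (@pV1_cts i).
have h2 := pdot_Ef2 m0 s1 s2 a1 a2.
rewrite e1 e2 h1 -(Hdot_Heq _ (Q_J i)) JV_Qp // in h2.
rewrite /mom -[e_ bc n]/(Ef (mu bc n)); clear h1 m0 a1 a2; move: (mu bc n) mb h2 => m.
by case: (bc); rewrite /bcE /beta /bflat => ->; rewrite mulr0 addr0; lra.
Qed.

(** The equation [opA (Q i.+1) = Q i] in moment form, with the flux through 1; [mom_0] starts the
    recursion. *)
Lemma mom_S bc n i : mom bc n i =
  - mu bc n ^+ 2 * mom bc n i.+1 + beta bc (mu bc n) * bflat bc i.+1.
Proof.
rewrite -mom_green /mom /Q pU2S; congr (Hdot (mkH _ _ _) _).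
by rewrite /pV1 /pU1 /pU subr0 addr0 /=; field.
Qed.

Lemma mom_0 bc n : 0 = - mu bc n ^+ 2 * mom bc n 0 + beta bc (mu bc n) * bflat bc 0.
Proof.
rewrite -mom_green; have -> : pV1 0 0 - pU1 0 0 = 0 :> R.
  by rewrite /pV1 /pU1 /=; ring.
rewrite HdotC Hdot_mkH; [|exact: sqi_cst|exact: sqi_cst].
rewrite (@eq_I _ _ _ _ (fun=> 0)) ?I0; last by move=> *; rewrite mulr0.
rewrite (@eq_I _ 0 1 _ (fun=> 0)) ?I0; last by move=> *; rewrite mulr0.
by rewrite mulr0 !addr0.
Qed.

(** Since [|1 + x| <= 2], the monomials of degree [2i] are at most [4^i / (2i)!]; the further [2^i]
    pays for the factor [2i] lost when one of them is differentiated. *)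
Definition qb i : R := 8 ^+ i / i.*2`!%:R.

Lemma qb_ge0 i : 0 <= qb i.
Proof. by rewrite divr_ge0 ?exprn_ge0 // ltW // fact_gt0R. Qed.

Lemma four_le_qb i : 4 ^+ i / i.*2`!%:R <= qb i :> R.
Proof.
rewrite ler_wpM2r ?invr_ge0 ?(ltW (fact_gt0R _)) // lerXn2r ?nnegrE //.
by rewrite ler_nat.
Qed.

Lemma exp2_double i : 2 ^+ i.*2 = 4 ^+ i :> R.
Proof. by rewrite -mul2n exprM; congr (_ ^+ i); ring. Qed.

Lemma mon2_le i (x X : R) : `|x| <= 2 -> `|mon i.*2 x| <= qb i.
Proof.
move=> x2; apply: le_trans (mon_le _ x2) (le_trans _ (four_le_qb i)).
by rewrite exp2_double.
Qed.

Lemma mon2S_le i (x : R) : `|x| <= 2 -> `|mon i.*2.+1 x| <= 2 * qb i.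
Proof.
move=> x2; apply: le_trans (mon_le _ x2) _.
apply: le_trans (_ : 2 * (4 ^+ i / i.*2`!%:R) <= _); last by rewrite ler_wpM2l // four_le_qb.
rewrite exprS exp2_double mulrA ler_wpM2l ?mulr_ge0 ?exprn_ge0 //.
by rewrite lef_pV2 ?posrE ?fact_gt0R // ler_nat factS leq_pmull.
Qed.

Lemma double_le_exp2 i : (i.*2 <= 2 ^ i)%N.
Proof.
elim: i => // -[|i] IH //; rewrite expnS doubleS; lia.
Qed.

Lemma dmon2_le i (x : R) : `|x| <= 2 -> `|dmon i.*2 x| <= qb i.
Proof.
case: i => [|i] x2; first by rewrite /= normr0 qb_ge0.
rewrite /= ; apply: le_trans (mon_le _ x2) _.
rewrite ler_pdivrMr ?fact_gt0R // /qb mulrAC ler_pdivlMr ?fact_gt0R //.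
rewrite doubleS factS natrM mulrA ler_wpM2r ?(ltW (fact_gt0R _)) //.
rewrite -!natrX -natrM ler_nat.
have -> : (8 ^ i.+1 = 2 ^ i.*2.+2 * 2 ^ i.+1)%N.
  by rewrite -expnD -[8%N]/((2 ^ 3)%N) -expnM; congr (_ ^ _)%N; lia.
by apply: leq_mul; [rewrite leq_exp2l|have := double_le_exp2 i.+1; rewrite doubleS].
Qed.

Lemma pU_le i t : -1 <= t -> t <= 0 -> `|pU i t| <= 3 * qb i.
Proof.
move=> t1 t2; have q0 := qb_ge0 i; apply: le_trans (@mon2S_le i (1 + t) _) _; last by lra.
by rewrite ler_norml; lra.
Qed.

Lemma pV_le i t : 0 <= t -> t <= 1 -> `|pV i t| <= 3 * qb i.
Proof.
move=> t1 t2; have h1 : `|1 + t| <= 2 by rewrite ler_norml; lra.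
have h2 : `|1 - t| <= 2 by rewrite ler_norml; lra.
have := mon2S_le i h1; have := @mon2_le i _ 0 h1; have := @mon2_le i _ 0 h2.
by rewrite /pV !ler_norml => /andP[? ?] /andP[? ?] /andP[? ?]; lra.
Qed.

Lemma bflat_le bc i : `|bflat bc i| <= 3 * qb i.
Proof.
case: bc => /=; first exact: pV_le.
have h1 : `|1 + 1 : R| <= 2 by rewrite ler_norml; lra.
have h2 : `|1 - 1 : R| <= 2 by rewrite ler_norml; lra.
have := @mon2_le i _ 0 h1; have := dmon2_le i h1; have := dmon2_le i h2.
have := qb_ge0 i.
by rewrite /pV1 !ler_norml => ? /andP[? ?] /andP[? ?] /andP[? ?]; lra.
Qed.

Lemma Q_norm i : Hnorm (Q i) <= 6 * qb i.
Proof.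
have q0 := qb_ge0 i.
rewrite -(@ler_pXn2r _ 2) ?nnegrE ?Hnorm_ge0 ?mulr_ge0 // HnormE.
rewrite Hdot_mkH2; [|exact: pU_sqi|exact: pV_sqi|exact: pU_sqi|exact: pV_sqi].
have sq (z : R) : `|z| <= 3 * qb i -> z * z <= 9 * qb i ^+ 2.
  by rewrite ler_norml => /andP[? ?]; nra.
have iU : Int (-1) 0 (fun t => pU i t * pU i t) <= 9 * qb i ^+ 2.
  apply: le_trans (le_I _ (itg_cst _ _ (9 * qb i ^+ 2)) _) _.
  - by apply: sqiM; exact: pU_sqi.
  - by move=> t /andP[t1 t2]; apply: sq; exact: pU_le.
  - by rewrite I_cst; lra.
have iV : Int 0 1 (fun t => pV i t * pV i t) <= 9 * qb i ^+ 2.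
  apply: le_trans (le_I _ (itg_cst _ _ (9 * qb i ^+ 2)) _) _.
  - by apply: sqiM; exact: pV_sqi.
  - by move=> t /andP[t1 t2]; apply: sq; exact: pV_le.
  - by rewrite I_cst; lra.
have := sq _ (pU_le i leN10 (lexx _)); nra.
Qed.

End FlatBasis.

(** * Convergence of the flat series *)

Section FlatSequences.
Context {R : realType}.
Implicit Types (bc : boundary) (t x G W : R) (y : H R) (g w : R^nat).
Local Notation mu := (@mu R).
Local Notation e_ := (@e_ R).
Local Notation qb := (@qb R).

Lemma eq_cvg_series (a b : R^nat) (l : R) : (forall k, a k = b k) ->
  series a @ \oo --> l -> series b @ \oo --> l.
Proof. by move=> ab; rewrite (_ : a = b) //; exact/funext. Qed.

Lemma cvg_seriesM (k : R) (a : R^nat) (l : R) : series a @ \oo --> l ->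
  series (fun i => k * a i) @ \oo --> k * l.
Proof.
move=> h; apply: cvg_trans (cvgMr h); apply: near_eq_cvg; near=> n.
by rewrite /series /= mulr_sumr.
Unshelve. all: by end_near.
Qed.

(** [fg i] is the size allowed for the [i]-th derivative of the flat output; it compensates the
    size [qb i] of [Q i], see [fg_qb]. *)
Definition fg i : R := 32^-1 ^+ i * i.*2`!%:R.
Definition flatg G g := forall i, `|g i| <= G * fg i.
Definition flatw W w := forall i, `|w i| <= W * qb i.

Lemma fg_gt0 i : 0 < fg i.
Proof. by rewrite mulr_gt0 ?exprn_gt0 ?fact_gt0R // invr_gt0. Qed.

Lemma fg_qb i : fg i * qb i = 4^-1 ^+ i.
Proof.
rewrite /fg -[qb i]/(8 ^+ i / i.*2`!%:R) mulrC mulrA mulrAC -(mulrA (8 ^+ i)) mulVf ?gt_eqF ?fact_gt0R // mulr1.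
by rewrite -exprMn; congr (_ ^+ i); field.
Qed.

Lemma flatg_ge0 G g : flatg G g -> 0 <= G.
Proof. by move/(_ 0%N)/(le_trans (normr_ge0 _)); rewrite pmulr_lge0 // fg_gt0. Qed.

Lemma qb_gt0 i : 0 < qb i.
Proof. by rewrite divr_gt0 ?exprn_gt0 ?fact_gt0R. Qed.

Lemma flatw_ge0 W w : flatw W w -> 0 <= W.
Proof. by move/(_ 0%N)/(le_trans (normr_ge0 _)); rewrite pmulr_lge0 // qb_gt0. Qed.

Lemma flat_term G W g w i : flatg G g -> flatw W w ->
  `|g i * w i| <= G * W * 4^-1 ^+ i.
Proof.
move=> hg hw; rewrite normrM -fg_qb; apply: le_trans (_ : (G * fg i) * (W * qb i) <= _).
  by apply: ler_pM.
by rewrite le_eqVlt; apply/orP; left; apply/eqP; ring.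
Qed.

Lemma cvg_quarter (C : R) : series (fun i => C * 4^-1 ^+ i) @ \oo --> C / (1 - 4^-1).
Proof.
by apply: cvg_geometric_series; rewrite ger0_norm ?invr_ge0 // invf_lt1 // ltr1n.
Qed.

Lemma is_cvg_quarter (C : R) : cvgn (series (fun i => C * 4^-1 ^+ i)).
Proof. exact: cvgP (cvg_quarter (C := C)). Qed.

Lemma flat_cvg G W g w : flatg G g -> flatw W w -> cvgn (series (fun i => g i * w i)).
Proof.
move=> hg hw; apply: (abs_cvg_series _ (@is_cvg_quarter (G * W))) => i.
exact: flat_term.
Qed.

Lemma flat_lim_le G W g w : flatg G g -> flatw W w ->
  `|limn (series (fun i => g i * w i))| <= 2 * (G * W).
Proof.
move=> hg hw.
have := lim_series_norm_le (fun i => flat_term i hg hw) (@is_cvg_quarter (G * W)).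
rewrite (cvg_lim _ (cvg_quarter (C := G * W))) // => /le_trans; apply.
have := mulr_ge0 (flatg_ge0 hg) (flatw_ge0 hw).
have -> : G * W / (1 - 4^-1) = 4 / 3 * (G * W) by field.
by lra.
Qed.

Lemma leq_exp2S n : (n.+1 <= 2 ^ n)%N.
Proof. by elim: n => // n IH; rewrite expnS; lia. Qed.

Lemma fact_double_shift1 n : (n.+1.*2`! <= 4 * 4 ^ n * n.*2`!)%N.
Proof.
rewrite doubleS !factS mulnA leq_mul2r; apply/orP; right.
have -> : (4 * 4 ^ n = 2 * 2 ^ n * (2 * 2 ^ n))%N.
  by rewrite -[4%N]/((2 * 2)%N) expnMn; ring.
have := leq_exp2S n; move: (2 ^ n)%N => z zn; apply: leq_mul; lia.
Qed.

Lemma fact_double_shift2 n : (n.+2.*2`! <= 256 * 16 ^ n * n.*2`!)%N.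
Proof.
apply: leq_trans (fact_double_shift1 n.+1) _.
apply: leq_trans (leq_mul (leqnn _) (fact_double_shift1 n)) _.
rewrite mulnA leq_mul2r expnS; apply/orP; right.
rewrite -[16%N]/((4 * 4)%N) expnMn; lia.
Qed.

(** The origin of 512: a shift by two derivatives costs [(2i+4)! <= 256 * 16^i * (2i)!], and
    [16 / 512 = 1 / 32] is the ratio of [fg]. Two shifts are what [is_derive_series] consumes. *)
Lemma gev_flat (P : R -> Prop) A F t : gev P A 512^-1 F -> P t ->
  [/\ flatg A (F^~ t), flatg A (fun i => F i.+1 t) & flatg A (fun i => F i.+2 t)].
Proof.
move=> hF Pt; have A0 := gev_ge0 hF Pt.
have [r rE] : exists r : R, r = 512^-1 by exists 512^-1.
have r0 : 0 < r by rewrite rE; lra.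
have pw (n : nat) (c : R) : 0 < c -> c * r <= 32^-1 -> r ^+ n * c ^+ n <= 32^-1 ^+ n.
  move=> c0 cr; rewrite -exprMn; apply: lerXn2r; rewrite ?nnegrE.
  - by rewrite mulr_ge0 // ltW.
  - by rewrite invr_ge0.
  - by rewrite mulrC.
move: hF; rewrite -rE => {}hF.
have key n i (c d : nat) : (0 < d)%N -> ((i + n).*2`! <= c * d ^ i * i.*2`!)%N ->
    d%:R * r <= 32^-1 -> c%:R * r ^+ n <= 1 -> `|F (i + n)%N t| <= A * fg i.
  move=> d0 hfact dr cr; apply: le_trans (hF _ _ Pt) _; rewrite -mulrA ler_wpM2l //.
  apply: le_trans (_ : r ^+ (i + n) * (c * d ^ i * i.*2`!)%:R <= _).
    by rewrite ler_wpM2l ?exprn_ge0 ?(ltW r0) // ler_nat.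
  rewrite !natrM natrX mulrA ler_wpM2r ?(ltW (fact_gt0R _)) // exprD.
  have -> : r ^+ i * r ^+ n * (c%:R * d%:R ^+ i) = (c%:R * r ^+ n) * (r ^+ i * d%:R ^+ i) by ring.
  rewrite -[leRHS]mul1r; apply: ler_pM; rewrite ?mulr_ge0 ?exprn_ge0 ?(ltW r0) //.
  by apply: pw; rewrite ?ltr0n.
split=> i.
- have := key 0%N i 1%N 1%N; rewrite addn0; apply => //.
  + by rewrite exp1n !mul1n.
  + by rewrite rE; lra.
  + by rewrite expr0 mulr1.
- have := key 1%N i 4%N 4%N; rewrite addn1; apply => //.
  + exact: fact_double_shift1.
  + by rewrite rE; lra.
  + by rewrite expr1 rE; lra.
- have := key 2%N i 256%N 16%N; rewrite addn2; apply => //.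
  + exact: fact_double_shift2.
  + by rewrite rE; lra.
  + by rewrite rE expr2; lra.
Qed.

Section Pairing.
Variables (tau A W : R) (F : nat -> R -> R) (w : R^nat).
Hypothesis hF : gev (fun t => tau < t) A 512^-1 F.
Hypothesis jF : jet (fun t => tau < t) F.
Hypothesis hw : flatw W w.

(** The moments, the control and the inner products of the state all have this form, with weights
    [mom], [bflat] and [Hdot y (Q i)], each bounded by a multiple of [qb]. *)
Definition pairing (t : R) := limn (series (fun i => F i t * w i)).

Lemma pairing_d t : tau < t ->
  is_derive t 1 pairing (limn (series (fun i => F i.+1 t * w i))).
Proof.
move=> tt; have near_t s : `|s - t| < t - tau -> tau < s.
  by rewrite ltr_norml => /andP[? ?]; lra.
have dmulr n i (s : R) : tau < s -> is_derive s 1 (fun s => F n s * w i) (F n.+1 s * w i).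
  move=> ts; have := dZ (w i) (jF n ts); rewrite mulrC.
  by rewrite (_ : (fun t => w i * F n t) = (fun t => F n t * w i)) // funeqE => z; rewrite mulrC.
apply: (@is_derive_series _ _ (fun i s => F i.+1 s * w i) (fun i s => F i.+2 s * w i)
  (fun i => A * W * 4^-1 ^+ i) t (t - tau)).
- by rewrite subr_gt0.
- by move=> k s /near_t ts; exact: dmulr.
- by move=> k s /near_t ts; exact: dmulr.
- by move=> k s /near_t ts; have [_ _ h] := gev_flat hF ts; exact: (flat_term k h hw).
- exact: is_cvg_quarter.
- by move=> s /near_t ts; have [h _ _] := gev_flat hF ts; exact: flat_cvg h hw.
- by have [_ h _] := gev_flat hF tt; exact: flat_cvg h hw.
Qed.

Lemma pairing_le t : tau < t -> `|pairing t| <= 2 * (A * W).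
Proof. by move=> tt; have [h _ _] := gev_flat hF tt; exact: flat_lim_le h hw. Qed.

Lemma pairing_lip s t : tau < s -> tau < t -> `|pairing t - pairing s| <= 2 * (A * W) * `|t - s|.
Proof.
have wl : forall s t : R, tau < s -> s <= t ->
    `|pairing t - pairing s| <= 2 * (A * W) * `|t - s|.
  move=> {}s {}t ts; rewrite le_eqVlt => /predU1P[->|st].
    by rewrite !subrr normr0 mulr0.
  have dp (x : R) : x \in `]s, t[ ->
      is_derive x 1 pairing (limn (series (fun i => F i.+1 x * w i))).
    by rewrite in_itv /= => /andP[sx _]; apply: pairing_d; exact: lt_trans sx.
  have cp : {within `[s, t], continuous pairing}.
    apply: derivable_within_continuous => x; rewrite in_itv /= => /andP[sx _].
    by have [] := pairing_d (lt_le_trans ts sx).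
  have [c] := MVT st dp cp.
  rewrite in_itv /= => /andP[sc _] ->; rewrite normrM ler_wpM2r //.
  by have [_ h _] := gev_flat hF (lt_trans ts sc); exact: flat_lim_le h hw.
move=> ts tt; have [st|/ltW st] := leP s t; first exact: wl.
by rewrite distrC (distrC t); exact: wl.
Qed.

End Pairing.

Lemma Int_flat b c p u y (f : R -> R) G g : itg b c f -> (forall i, continuous (p i)) ->
  (forall i x, b <= x -> x <= c -> `|p i x| <= 3 * qb i) -> flatg G g ->
  (forall x, b <= x -> x <= c -> series (fun i => g i * p i x) @ \oo --> u x) ->
  itg b c (fun x => f x * u x) /\
  series (fun i => g i * Int b c (fun x => f x * p i x)) @ \oo -->
    Int b c (fun x => f x * u x).
Proof.
move=> jf cp hp hg hu; have wp x : b <= x -> x <= c -> flatw 3 (p^~ x).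
  by move=> bx xc i; exact: hp.
have ifp i : itg b c (fun x => f x * p i x).
  apply: (@le_itg _ _ _ _ (fun x => 3 * qb i * `|f x|)).
  - apply: measurable_funM; first exact: itg_meas.
    by apply: cts_meas; apply: continuous_subspaceT; exact: cp.
  - by move=> x /andP[bx xc]; rewrite normrM mulrC ler_wpM2r // hp.
  - exact/itgZ/itg_norm.
have [] := @Int_series _ b c (fun i x => g i * (f x * p i x)) (fun x => f x * u x)
  (fun i => Int b c (fun x => `|f x|) * (G * 3) * 4^-1 ^+ i).
- by move=> i; apply: itgZ.
- move=> i; rewrite -mulrA mulrC -IZ; last exact: itg_norm.
  apply: le_I => [||x /andP[bx xc]]; [exact/itg_norm/itgZ|exact/itgZ/itg_norm|].
  rewrite mulrCA normrM mulrC ler_wpM2r //; exact: (flat_term i hg (wp x bx xc)).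
- exact: is_cvg_quarter.
- move=> x /andP[bx xc]; have := hu x (ltW bx) (ltW xc) => h.
  by apply: eq_cvg_series (cvg_seriesM (k := f x) h) => i; rewrite mulrCA.
- by move=> h1 h; split => //; apply: eq_cvg_series h => i; rewrite IZ.
Qed.

Lemma flat_dot G g u v y : flatg G g -> sqi (-1) 0 u -> sqi 0 1 v ->
  (forall x, -1 <= x -> x <= 0 -> series (fun i => g i * pU i x) @ \oo --> u x) ->
  (forall x, 0 <= x -> x <= 1 -> series (fun i => g i * pV i x) @ \oo --> v x) ->
  series (fun i => g i * Hdot y (Q i)) @ \oo --> Hdot y (mkH u v (u 0)).
Proof.
move=> hg su sv hu hv; rewrite Hdot_mkH //.
have [_ h1] := Int_flat y (sqi_itg (L2_sqi (Hu y))) (@pU_cts R) (@pU_le R) hg hu.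
have [_ h2] := Int_flat y (sqi_itg (L2_sqi (Hv y))) (@pV_cts R) (@pV_le R) hg hv.
have h3 := cvg_seriesM (k := Hz y) (hu 0 leN10 (lexx _)).
apply: cvg_trans (cvgD (cvgD h1 h2) h3); apply: near_eq_cvg; near=> n.
rewrite !fctE /series /= -!big_split /=; apply: eq_bigr => i _.
rewrite Hdot_mkH; [|exact: pU_sqi|exact: pV_sqi].
by rewrite [Hz y * (_ * _)]mulrCA !mulrDr.
Unshelve. all: by end_near.
Qed.

(** The sum is built pointwise as a pair of bounded functions, and termwise integration identifies
    its inner products. *)
Lemma flat_ex G g : flatg G g ->
  exists w : H R, forall y, series (fun i => g i * Hdot y (Q i)) @ \oo --> Hdot y w.
Proof.
move=> hg; pose u x := limn (series (fun i => g i * pU i x)).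
pose v x := limn (series (fun i => g i * pV i x)).
have sq b c p (l : R -> R) : b <= c -> (forall i, continuous (p i)) ->
    (forall i x, b <= x -> x <= c -> `|p i x| <= 3 * qb i) ->
    (forall x, l x = limn (series (fun i => g i * p i x))) -> sqi b c l.
  move=> bc cp hp lE; have wp x : b <= x -> x <= c -> flatw 3 (p^~ x).
    by move=> bx xc i; exact: hp.
  (* Testing against the constant 1 yields the measurability of the pointwise sum. *)
  have [] := @Int_flat b c p l 0 (fun=> 1) G g (itg_cst _ _ _) cp hp hg.
    by move=> x bx xc; rewrite lE; exact: flat_cvg hg (wp x bx xc).
  move=> /itg_meas ml _.
  have {}ml : measurable_fun `[b, c] l.
    by apply: eq_measurable_fun ml => x _; rewrite mul1r.
  split => //; apply: (@itg_bnd _ _ _ _ ((2 * (G * 3)) ^+ 2)); first exact: measurable_funX.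
  move=> x /andP[bx xc]; rewrite normrX lerXn2r ?nnegrE ?mulr_ge0 ?(flatg_ge0 hg) //.
  by rewrite lE; exact: flat_lim_le hg (wp x bx xc).
have su : sqi (-1) 0 u by exact: (sq _ _ pU u leN10 (@pU_cts R) (@pU_le R)).
have sv : sqi 0 1 v by exact: (sq _ _ pV v ler01 (@pV_cts R) (@pV_le R)).
exists (mkH u v (u 0)) => y; apply: (@flat_dot G g u v y hg su sv) => x x0 x1.
- by apply: (flat_cvg (W := 3) hg) => i; exact: pU_le.
- by apply: (flat_cvg (W := 3) hg) => i; exact: pV_le.
Qed.

(** One term of the series of [expR (32 * l)] gives [l^i <= expR (32 * l) * i! / 32^i], and
    [i! <= (2i)!]. *)
Lemma flatg_eigen (l : R) : 0 <= l -> flatg (expR (32 * l)) (fun i => (- l) ^+ i).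
Proof.
move=> l0 i; rewrite normrX normrN ger0_norm // /fg.
have := ler_exprn_fact i (mulr_ge0 (ler0n R 32) l0).
rewrite ler_pdivrMr ?fact_gt0R // exprMn => h.
have f : i`!%:R <= i.*2`!%:R :> R by rewrite ler_nat; apply: leq_fact; rewrite -addnn leq_addr.
have z0 : 0 < 32 ^+ i :> R by exact: exprn_gt0.
have -> : (32^-1 : R) ^+ i = (32 ^+ i)^-1 by rewrite exprVn.
rewrite mulrCA mulrC ler_pdivlMr // mulrC; apply: le_trans h _.
by rewrite ler_wpM2l ?expR_ge0.
Qed.

Lemma neg_sqr_exp m i : (- m ^+ 2) ^+ i = (-1) ^+ i * m ^+ i.*2 :> R.
Proof. by rewrite -[- m ^+ 2]mulN1r exprMn -exprM mul2n. Qed.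

Lemma cvg_mon_odd m x : m != 0 ->
  series (fun i => (- m ^+ 2) ^+ i * mon i.*2.+1 x) @ \oo --> m^-1 * sin (m * x).
Proof.
move=> m0; apply: eq_cvg_series (cvg_seriesM (k := m^-1) (@cvg_sin_coeff' R (m * x))) => i.
rewrite /sin_coeff' -exprnP /mon neg_sqr_exp exprMn (exprS m); have := @fact_gt0R R i.*2.+1.
move: (_`!%:R) ((-1) ^+ i) (m ^+ i.*2) (x ^+ i.*2.+1) => f a b c f0; field.
by rewrite m0 gt_eqF.
Qed.

Lemma cvg_mon_even m x :
  series (fun i => (- m ^+ 2) ^+ i * mon i.*2 x) @ \oo --> cos (m * x).
Proof.
apply: eq_cvg_series (@cvg_cos_coeff' R (m * x)) => i.
by rewrite /cos_coeff' /mon neg_sqr_exp exprMn !mulrA.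
Qed.

Lemma cvg_mon_evenB m x :
  series (fun i => (- m ^+ 2) ^+ i * (mon i.*2 (1 + x) - mon i.*2 (1 - x))) @ \oo -->
  cos (m * (1 + x)) - cos (m * (1 - x)).
Proof.
apply: cvg_trans (cvgB (cvg_mon_even (x := 1 + x) (m := m)) (cvg_mon_even (x := 1 - x) (m := m))).
apply: near_eq_cvg; near=> n; rewrite !fctE /series /= -sumrB.
by apply: eq_bigr => i _; rewrite mulrBr.
Unshelve. all: by end_near.
Qed.

Lemma cvg_pU m x : m != 0 -> series (fun i => (- m ^+ 2) ^+ i * pU i x) @ \oo --> eu m x.
Proof. by move=> m0; exact: cvg_mon_odd. Qed.

Lemma cvg_pV m x : m != 0 -> series (fun i => (- m ^+ 2) ^+ i * pV i x) @ \oo --> ev m x.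
Proof.
move=> m0; have -> : ev m x = m^-1 * sin (m * (1 + x)) +
    2^-1 * (cos (m * (1 + x)) - cos (m * (1 - x))).
  have -> : m * (1 + x) = m + m * x by ring.
  have -> : m * (1 - x) = m - m * x by ring.
  rewrite /ev (_ : m * (1 + x) = m + m * x); last by ring.
  by rewrite cosD cosB; field.
apply: cvg_trans (cvgD (cvg_mon_odd (x := 1 + x) m0)
  (cvg_seriesM (k := 2^-1) (cvg_mon_evenB (m := m) (x := x)))).
apply: near_eq_cvg; near=> n.
rewrite !fctE /series /= -big_split /=; apply: eq_bigr => i _.
by rewrite /pV; field.
Unshelve. all: by end_near.
Qed.

(** When the flat output is a single decaying exponential, the flat series is the corresponding
    eigenfunction. *)
Lemma mom_eigen bc k n :
  series (fun i => (- mu bc k ^+ 2) ^+ i * mom bc n i) @ \oo --> Hdot (e_ bc k) (e_ bc n).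
Proof.
have m0 := @mu_neq0 R bc k.
have := @flat_dot _ _ (eu (mu bc k)) (ev (mu bc k)) (e_ bc n) (flatg_eigen (sqr_ge0 (mu bc k)))
  (eu_sqi m0) (ev_sqi m0).
move=> /(_ (fun x _ _ => cvg_pU (x := x) m0) (fun x _ _ => cvg_pV (x := x) m0)).
rewrite eu0 -/(Ef _) HdotC; apply: eq_cvg_series => i.
by rewrite HdotC.
Qed.

Lemma mom_flatw bc n : flatw (6 * Hnorm (e_ bc n)) (mom bc n).
Proof.
move=> i; apply: le_trans (Hdot_le _ _) _.
by rewrite mulrAC ler_wpM2r ?Hnorm_ge0 // Q_norm.
Qed.

Lemma Q_flatw y : flatw (6 * Hnorm y) (fun i => Hdot y (Q i)).
Proof.
move=> i; rewrite HdotC; apply: le_trans (Hdot_le _ _) _.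
by rewrite mulrAC ler_wpM2r ?Hnorm_ge0 // Q_norm.
Qed.

Lemma bflat_flatw bc : flatw 3 (bflat bc).
Proof. exact: bflat_le. Qed.

End FlatSequences.

(** * The controlled trajectory *)

Section FlatSolution.
Context {R : realType}.
Variables (bc : boundary) (S : R -> H R -> H R) (T : R) (y0 : H R).
Hypothesis SG : generated_semigroup bc S.
Implicit Types (s t : R) (y : H R).
Local Notation mu := (@mu R bc).
Local Notation e_ := (@e_ R bc).
Local Notation nrm := (@nrm R bc).

Variables (t1 t2 tau c0 : R).
Hypothesis tau0 : 0 < tau.
Hypothesis tau1 : tau < t1.
Hypothesis t12 : t1 < t2.
Hypothesis t2T : t2 <= T.
Hypothesis c00 : 0 < c0.
Hypothesis c0E : c0 * (tau / 2) = 1.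
Local Notation P := (fun t : R => tau < t).

Let t10 : 0 < t1. Proof. exact: lt_trans tau1. Qed.
Let t1T : t1 <= T. Proof. exact: ltW (lt_le_trans t12 t2T). Qed.

(** The [n]-th time derivative of the contribution of mode [k] to the slope at [-1], where the
    eigenfunction has slope 1. *)
Definition hterm k n t := coef bc y0 k * ((- mu k ^+ 2) ^+ n * expR (- mu k ^+ 2 * t)).
Definition hmaj k := `|heat bc y0 (tau / 2) k|.

Lemma hmaj_summable : cvgn (series hmaj).
Proof.
have := @rapid_heat R bc y0 _ (divr_gt0 tau0 (ltr0n _ 2)) 0%N.
by under [fun k => _]eq_fun do rewrite expr0 mulr1.
Qed.

(** The decay up to time [tau] is split in two: one half makes the sum over the modes converge, the
    other turns [l ^+ n] into [c0 ^+ n * n!] with [c0 = 2 / tau]. *)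
Lemma hterm_le k n t : tau < t -> `|hterm k n t| <= hmaj k * (c0 ^+ n * n`!%:R).
Proof.
move=> tt; rewrite /hterm /hmaj /heat; move: (coef bc y0 k) => cc.
move: (mu k ^+ 2) (sqr_ge0 (mu k)) => l l0.
rewrite normrM normrM normrX normrN (ger0_norm l0) normrM.
rewrite !(ger0_norm (expR_ge0 _)) -mulrA ler_wpM2l //.
apply: le_trans (_ : l ^+ n * expR (- l * tau) <= _).
  by rewrite ler_wpM2l ?exprn_ge0 // ler_expR !mulNr lerN2 ler_wpM2l // ltW.
have -> : expR (- l * tau) = expR (- l * (tau / 2)) * expR (- (l * (tau / 2))).
  by rewrite -expRD; congr expR; field.
rewrite mulrCA ler_wpM2l ?expR_ge0 // expRN ler_pdivrMr ?expR_gt0 //.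
have := ler_exprn_fact n (mulr_ge0 l0 (ltW (divr_gt0 tau0 (ltr0n _ 2)))).
rewrite ler_pdivrMr ?fact_gt0R // exprMn => h.
have -> : l ^+ n = c0 ^+ n * (l ^+ n * (tau / 2) ^+ n).
  by rewrite mulrCA -exprMn c0E expr1n mulr1.
by rewrite -[leRHS]mulrA ler_wpM2l ?exprn_ge0 ?(ltW c00) // [leRHS]mulrC.
Qed.

Lemma hmaj_cvg (C : R) : cvgn (series (fun k => hmaj k * C)).
Proof.
have h := cvg_seriesM (k := C) hmaj_summable; apply: cvgP (_ : _ --> C * limn (series hmaj)).
by apply: eq_cvg_series h => k; rewrite mulrC.
Qed.

Lemma hmaj_lim (C : R) : limn (series (fun k => hmaj k * C)) = limn (series hmaj) * C.
Proof.
apply/cvg_lim => //; rewrite mulrC.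
by apply: eq_cvg_series (cvg_seriesM (k := C) hmaj_summable) => k; rewrite mulrC.
Qed.

Definition heat_jet n t := limn (series (fun k => hterm k n t)).

Lemma hterm_cvg n t : tau < t -> cvgn (series (fun k => hterm k n t)).
Proof. by move=> tt; apply: (abs_cvg_series _ (@hmaj_cvg (c0 ^+ n * n`!%:R))) => k; exact: hterm_le. Qed.

Lemma heat_jet_jet : jet P heat_jet.
Proof.
have dterm k n (t : R) : is_derive t 1 (hterm k n) (hterm k n.+1 t).
  have dl : is_derive t 1 (fun s => - mu k ^+ 2 * s) (- mu k ^+ 2) := dlin0 _ t.
  have := dZ (coef bc y0 k) (dZ ((- mu k ^+ 2) ^+ n)
    (@dcomp _ expR (fun s => - mu k ^+ 2 * s) t _ _ (is_derive_expR _) dl)).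
  by move=> h; apply: is_derive_eq h _; rewrite /hterm [(- mu k ^+ 2) ^+ n.+1]exprS; ring.
move=> n t tt; have nt s : `|s - t| < t - tau -> tau < s.
  by rewrite ltr_norml => /andP[? ?]; lra.
apply (@is_derive_series _ (fun k => hterm k n) (fun k => hterm k n.+1) (fun k => hterm k n.+2)
  (fun k => hmaj k * (c0 ^+ n.+2 * n.+2`!%:R)) t (t - tau)).
- by rewrite subr_gt0.
- by move=> k s _; exact: dterm.
- by move=> k s _; exact: dterm.
- by move=> k s /nt ts; exact: hterm_le.
- exact: hmaj_cvg.
- by move=> s /nt ts; exact: hterm_cvg.
- exact: hterm_cvg.
Qed.

Lemma heat_jet_gev r : 0 < r -> exists A, gev P A r heat_jet.
Proof.
move=> r0; exists (limn (series hmaj) * expR (c0 / r)); apply: gev_of_fact => //; first exact: ltW.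
move=> n t tt; rewrite -mulrA -hmaj_lim.
by apply: lim_series_norm_le => [k|]; [exact: hterm_le|exact: hmaj_cvg].
Qed.

Section Control.
Variables (A : R) (g : nat -> R -> R).
Hypothesis g_jet : jet P g.
Hypothesis g_gev : gev P A 512^-1 g.
Hypothesis g_t1 : forall n, g n t1 = heat_jet n t1.
Hypothesis g_t2 : forall n t, t2 <= t -> g n t = 0.

Definition flat_input := pairing g (bflat bc).
Definition flat_moment n := pairing g (mom bc n).
Definition control t := if t <= t1 then 0 else flat_input t.
(** Characterised by its inner products; for [tau < t], [flat_ex] shows that the default value 0 is
    not the one selected by absence. *)
Definition flat_state t : H R := xget 0 [set w | forall y, series (fun i => g i t * Hdot y (Q i)) @ \oo --> Hdot y w].
Definition trajectory t := if t <= t1 then S t y0 else flat_state t.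

Lemma Hdot_flat_state y t : tau < t -> Hdot y (flat_state t) = pairing g (fun i => Hdot y (Q i)) t.
Proof.
move=> tt; have [gt _ _] := gev_flat g_gev tt; have [w hw] := flat_ex gt.
suff h : series (fun i => g i t * Hdot y (Q i)) @ \oo --> Hdot y (flat_state t).
  by rewrite -(cvg_lim _ h).
by rewrite /flat_state; case: xgetP => [z _ hz|/(_ w)].
Qed.

Lemma flat_state_e n t : tau < t -> Hdot (flat_state t) (e_ n) = flat_moment n t.
Proof.
move=> tt; rewrite HdotC Hdot_flat_state // /flat_moment /pairing /mom; congr (limn (series _)).
by apply/funext => i; rewrite HdotC.
Qed.

Lemma flat_moment_d n t : tau < t ->
  is_derive t 1 (flat_moment n) (- mu n ^+ 2 * flat_moment n t + beta bc (mu n) * flat_input t).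
Proof.
move=> tt; apply: is_derive_eq (pairing_d g_gev g_jet (mom_flatw bc n) tt) _.
have [gt _ _] := gev_flat g_gev tt.
have h1 := flat_cvg gt (mom_flatw bc n); have h2 := flat_cvg gt (bflat_flatw bc).
(* By [mom_S] the term of index [i.+1] is [g i.+1 t * mom bc n i], and by [mom_0] the term of index
   0 vanishes: shifting the series gives the derivative. *)
pose a i := g i t * (- mu n ^+ 2 * mom bc n i + beta bc (mu n) * bflat bc i).
have ha : series a @ \oo --> - mu n ^+ 2 * flat_moment n t + beta bc (mu n) * flat_input t.
  apply: cvg_trans (cvgD (cvg_seriesM (k := - mu n ^+ 2) h1)
    (cvg_seriesM (k := beta bc (mu n)) h2)).
  apply: near_eq_cvg; near=> j; rewrite !fctE /series /= -big_split /=.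
  by apply: eq_bigr => i _; rewrite /a; ring.
have := cvg_series_S' (cvgP _ ha); rewrite (cvg_lim _ ha) // {2}/a -mom_0 mulr0 subr0.
move=> h; apply/cvg_lim => //; apply: eq_cvg_series h => i.
by rewrite /a -mom_S.
Unshelve. all: by end_near.
Qed.

Lemma fact_sqr_le i : (i`! * i`! <= i.*2`!)%N.
Proof.
have := bin_fact (leq_addr i i); rewrite addnK addnn => <-.
by rewrite leq_pmull // bin_gt0 -addnn leq_addr.
Qed.

(** The double series is exchanged by truncation in the eigenfunction index [k]. *)
Lemma flat_moment_t1 n : flat_moment n t1 = expR (- mu n ^+ 2 * t1) * Hdot y0 (e_ n).
Proof.
have Pt1 : tau < t1 by exact: tau1.
pose d k := heat bc y0 t1 k.
pose SK K := \sum_(0 <= k < K) d k * Hdot (e_ k) (e_ n).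
have hS K : series (fun i => (\sum_(0 <= k < K) hterm k i t1) * mom bc n i) @ \oo --> SK K.
  elim: K => [|K IH].
    rewrite /SK big_nil; apply: cvg_near_cst; near=> j; rewrite /series /= big1 // => i _.
    by rewrite big_nil mul0r.
  rewrite /SK big_nat_recr //= -/(SK K).
  apply: cvg_trans (cvgD IH (cvg_seriesM (k := d K) (mom_eigen (bc := bc) (k := K) (n := n)))).
  apply: near_eq_cvg; near=> j; rewrite !fctE /series /= -big_split /=.
  apply: eq_bigr => i _; rewrite big_nat_recr //= mulrDl /d /heat /hterm.
  by congr (_ + _); ring.
have [gt _ _] := gev_flat g_gev Pt1.
have hM : series (fun i => heat_jet i t1 * mom bc n i) @ \oo --> flat_moment n t1.
  have := flat_cvg gt (mom_flatw bc n); apply: eq_cvg_series => i.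
  by rewrite g_t1.
pose C := expR (32 * c0); pose W := 6 * Hnorm (e_ n).
pose tail K := limn (series hmaj) - series hmaj K.
(* The omitted modes have [i]-th derivative at most [tail K * c0^i * i!], and
   [c0^i * i! <= e^(32 c0) * fg i]; hence the flat series of the remainder is controlled by
   [tail K]. *)
have err K : `|flat_moment n t1 - SK K| <= 2 * (tail K * C * W).
  have flatK : flatg (tail K * C) (fun i => heat_jet i t1 - \sum_(0 <= k < K) hterm k i t1).
    move=> i; apply: le_trans (series_tail K (fun k => hterm_le k i Pt1) (@hmaj_cvg _)) _.
    rewrite hmaj_lim; have -> : series (fun k => hmaj k * (c0 ^+ i * i`!%:R)) K =
      series hmaj K * (c0 ^+ i * i`!%:R) by rewrite /series /= mulr_suml.
    rewrite -mulrBl -mulrA ler_wpM2l //.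
      by rewrite subr_ge0; apply: ler_series_lim; [by move=> k; rewrite /hmaj|exact: hmaj_summable].
    rewrite /fg /C; have := ler_exprn_fact i (mulr_ge0 (ler0n R 32) (ltW c00)).
    rewrite ler_pdivrMr ?fact_gt0R // exprMn => h.
    have f2 : i`!%:R * i`!%:R <= i.*2`!%:R :> R by rewrite -natrM ler_nat fact_sqr_le.
    have z0 : 0 < 32 ^+ i :> R by exact: exprn_gt0.
    have -> : (32^-1 : R) ^+ i = (32 ^+ i)^-1 by rewrite exprVn.
    have -> : expR (32 * c0) * ((32 ^+ i)^-1 * i.*2`!%:R) =
      expR (32 * c0) * i.*2`!%:R / 32 ^+ i by rewrite mulrCA mulrC.
    rewrite ler_pdivlMr // mulrC mulrA.
    apply: le_trans (ler_wpM2r (ltW (fact_gt0R i)) h) _.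
    by rewrite -mulrA ler_wpM2l ?expR_ge0.
  have := flat_lim_le flatK (mom_flatw bc n); apply: le_trans; rewrite le_eqVlt.
  apply/orP; left; apply/eqP; congr `|_|; apply/esym/cvg_lim => //.
  apply: cvg_trans (cvgB hM (@hS K)); apply: near_eq_cvg; near=> j.
  by rewrite !fctE /series /= -sumrB; apply: eq_bigr => i _; rewrite mulrBl.
have SKM : SK @ \oo --> flat_moment n t1.
  have tl : tail K @[K --> \oo] --> 0.
    rewrite -(subrr (limn (series hmaj))); apply: cvgB; [exact: cvg_cst|exact: hmaj_summable].
  have bl : 2 * (tail K * C * W) @[K --> \oo] --> 0.
    rewrite -[X in _ --> X](mulr0 2) -(mul0r W) -[X in _ * (X * W)](mul0r C).
    by apply: cvgMr; apply: cvgMl; exact: cvgMl.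
  apply/cvgrPdist_le => e e0; have /cvgrPdist_le/(_ e e0) := bl.
  apply: filterS => K; rewrite sub0r normrN => h.
  by apply: le_trans (err K) (le_trans (ler_norm _) h).
have SKn : SK @ \oo --> d n * nrm n.
  apply: cvg_near_cst; near=> K; have nK : (n < K)%N by near: K; exact: nbhs_infty_gt.
  exact: sum_ortho.
rewrite (cvg_unique _ SKM SKn) // /d /heat /coef mulrAC divfK ?(@nrm_neq0 R) //.
exact: mulrC.
Unshelve. all: by end_near.
Qed.

Lemma flat_input_cts s : {within `[t1, s], continuous flat_input}.
Proof.
apply: derivable_within_continuous => t; rewrite in_itv /= => /andP[tt _].
by have [] := pairing_d g_gev g_jet (bflat_flatw bc) (lt_le_trans tau1 tt).
Qed.

Lemma flat_input_bound t : t1 <= t -> `|flat_input t| <= 2 * (A * 3).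
Proof. by move=> tt; apply: (pairing_le g_gev (bflat_flatw bc)); exact: lt_le_trans tt. Qed.

Lemma control_bound t : `|control t| <= 2 * (A * 3).
Proof.
rewrite /control; have [_|/ltW tt] := leP t t1; last exact: flat_input_bound.
by rewrite normr0 (le_trans (normr_ge0 _) (flat_input_bound (lexx t1))).
Qed.

Lemma control_meas : measurable_fun `[0, T] control.
Proof.
have -> : `[0, T]%classic = `[0, t1]%classic `|` `]t1, T]%classic.
  by rewrite -itv_bndbnd_setU // bnd_simp ?(ltW t10).
apply/measurable_funU => //; split.
  apply: (@eq_measurable_fun _ _ _ _ _ (fun=> 0 : R)); last exact: measurable_cst.
  by move=> t; rewrite inE /= in_itv /= /control => /andP[_ ->].
apply: (@eq_measurable_fun _ _ _ _ _ flat_input).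
  by move=> t; rewrite inE /= in_itv /= /control => /andP[tt _]; rewrite leNgt tt.
apply: measurable_funS (cts_meas (@flat_input_cts T)) => //.
by apply: subset_itv; rewrite bnd_simp.
Qed.

Lemma control_sqi : sqi 0 T control.
Proof.
split; first exact: control_meas.
apply: (@itg_bnd _ _ _ _ ((2 * (A * 3)) ^+ 2)); first exact: measurable_funX control_meas.
move=> t _; rewrite normrX lerXn2r ?nnegrE ?control_bound //.
exact: le_trans (control_bound 0).
Qed.

Lemma control_prod_itg s h : s <= T -> continuous h -> itg 0 s (fun t => control t * h t).
Proof.
by move=> sT ch; apply: sqiM; [exact: sqi_sub control_sqi|exact: cts_sqiT].
Qed.

(** Duhamel's formula for each coefficient. The control vanishes up to [t1], and at [t1] the flat
    moments agree with the free evolution. *)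
Lemma trajectory_coef s n : 0 <= s -> s <= T ->
  Hdot (trajectory s) (e_ n) = expR (- mu n ^+ 2 * s) * Hdot y0 (e_ n) +
    beta bc (mu n) * Int 0 s (fun t => control t * expR (- mu n ^+ 2 * (s - t))).
Proof.
move=> s0 sT; rewrite /trajectory; have [st|st] := leP s t1.
  rewrite (S_coef SG) // (@eq_I _ _ _ _ (fun=> 0)) ?I0 ?mulr0 ?addr0 //.
  by move=> t /andP[_ ts]; rewrite /control (le_trans ts st) mul0r.
have Ps : tau < s by exact: lt_trans st.
rewrite flat_state_e //; set l := mu n ^+ 2; set b := beta _ _.
have ch : continuous (fun t => expR (- l * (s - t))).
  move=> t; have dl : is_derive t 1 (fun u => - l * (s - u)) (- l * (0 - 1)).
    exact: dZ (dB (dC t s) (dI t)).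
  exact: is_derive_cvg (@dcomp _ expR (fun u => - l * (s - u)) t _ _ (is_derive_expR _) dl).
rewrite (@I_split _ t1 0 s) ?(ltW t10) ?(ltW st) //; last exact: control_prod_itg.
rewrite (@eq_I _ 0 t1 _ (fun=> 0)) ?I0 ?add0r; last first.
  by move=> t /andP[_ ts]; rewrite /control ts mul0r.
have mf : measurable_fun `[t1, s] (fun t => control t * expR (- l * (s - t))).
  by apply: itg_meas; apply: itg_sub (@control_prod_itg s _ sT ch); rewrite ?(ltW t10).
have cf0 : {within `[t1, s], continuous (fun t => flat_input t * expR (- l * (s - t)))}.
  move=> t; apply: cvgM; first exact: flat_input_cts.
  exact: continuous_subspaceT ch _.
rewrite (@Int_aeq _ t1 s _ (fun t => flat_input t * expR (- l * (s - t)))) //; last 2 first.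
- exact: cts_meas.
- by apply: eq_aeq => t /andP[tt _]; rewrite /control leNgt tt.
rewrite -IZ; last exact: cts_itg cf0.
(* The integrating factor [expR (- l * (s - t))] turns the scalar equation of [flat_moment_d] into
   an exact derivative. *)
suff e : Int t1 s (fun t => b * (flat_input t * expR (- l * (s - t)))) =
    flat_moment n s * expR (- l * (s - s)) - flat_moment n t1 * expR (- l * (s - t1)).
  rewrite e subrr mulr0 expR0 mulr1 flat_moment_t1 -/l.
  have -> : expR (- l * s) = expR (- l * t1) * expR (- l * (s - t1)).
    by rewrite -expRD; congr expR; ring.
  ring.
apply: (@FTC2_in _ t1 s (fun t => flat_moment n t * expR (- l * (s - t)))
  (fun t => b * (flat_input t * expR (- l * (s - t)))) (ltW st)).
- by move=> t; apply: cvgM; [exact: cvg_cst|exact: cf0].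
- move=> t /andP[tt _]; have Pt : tau < t by exact: lt_le_trans tt.
  have dl : is_derive t 1 (fun u => - l * (s - u)) (- l * (0 - 1)).
    exact: dZ (dB (dC t s) (dI t)).
  have := dM (flat_moment_d n Pt)
    (@dcomp _ expR (fun u => - l * (s - u)) t _ _ (is_derive_expR _) dl).
  by move=> h; apply: is_derive_eq h _; rewrite -/l -/b; ring.
Qed.

(** The difference is tested against itself, and one factor of its norm is divided out. *)
Lemma flat_state_lip s t : tau < s -> tau < t -> Hnorm (flat_state t - flat_state s) <= 12 * A * `|t - s|.
Proof.
move=> Ps Pt; set w := flat_state t - flat_state s.
have [->|w0] := eqVneq (Hnorm w) 0.
  by rewrite !mulr_ge0 //; exact: (gev_ge0 g_gev Ps).
have {}w0 : 0 < Hnorm w by rewrite lt_neqAle eq_sym w0 Hnorm_ge0.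
rewrite -(ler_pM2l w0) -expr2 HnormE {2}/w HdotBr !Hdot_flat_state //.
apply: le_trans (ler_norm _) (le_trans (pairing_lip g_gev g_jet (Q_flatw w) Ps Pt) _).
by rewrite le_eqVlt; apply/orP; left; apply/eqP; ring.
Qed.

Lemma flat_state_t1 : Heq (flat_state t1) (S t1 y0).
Proof.
apply: (eq_by_coefs (bc := bc)) => n.
by rewrite flat_state_e ?tau1 // flat_moment_t1 (S_coef SG) // ltW.
Qed.

(** Each piece has a uniform modulus; two times on either side of [t1] are compared through the
    common state at [t1]. *)
Lemma trajectory_cts e : 0 < e -> exists2 d : R, 0 < d & forall s t, 0 <= s -> 0 <= t ->
  `|s - t| < d -> Hnorm (trajectory s - trajectory t) <= e.
Proof.
move=> e0; have A0 : 0 <= A := gev_ge0 g_gev tau1.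
have [d d0 hd] := S_continuity SG y0 (divr_gt0 e0 (ltr0n R 2)).
pose d' := e / 2 / (12 * A + 1).
have a1 : 0 < 12 * A + 1 by rewrite ltr_wpDl ?mulr_ge0.
have d'0 : 0 < d' by rewrite !divr_gt0.
have zle s t : tau < s -> tau < t -> `|s - t| < d' -> Hnorm (flat_state s - flat_state t) <= e / 2.
  move=> Ps Pt std; apply: le_trans (flat_state_lip Pt Ps) _.
  move: std; rewrite /d' ltr_pdivlMr //; have := normr_ge0 (s - t); nra.
exists (Num.min d d'); first by rewrite lt_min d0.
have wl s t : 0 <= s -> s <= t1 -> t1 < t -> `|s - t| < Num.min d d' ->
    Hnorm (trajectory s - trajectory t) <= e.
  move=> s0 st1 t1t; rewrite lt_min => /andP[h1 h2]; rewrite /trajectory st1 (lt_geF t1t).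
  have st : s <= t by exact: le_trans (ltW t1t).
  rewrite ler0_norm ?subr_le0 // opprB in h1; rewrite ler0_norm ?subr_le0 // opprB in h2.
  have -> : S s y0 - flat_state t = (S s y0 - S t1 y0) + (S t1 y0 - flat_state t) by rewrite addrA subrK.
  apply: le_trans (HnormD _ _) _; rewrite [leRHS](splitr e); apply: lerD.
    apply: hd => //; first exact: ltW.
    by rewrite ler0_norm ?subr_le0 // opprB; apply: le_lt_trans h1; lra.
  rewrite -(Hnorm_Heq (HeqB flat_state_t1 (Heq_refl (flat_state t)))); apply: zle; rewrite ?tau1 //.
    exact: lt_trans t1t.
  by rewrite ler0_norm ?subr_le0 ?(ltW t1t) // opprB; apply: le_lt_trans h2; lra.
move=> s t s0 t0 std; have [st1|st1] := leP s t1; have [tt1|tt1] := leP t t1.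
- rewrite /trajectory st1 tt1; apply: le_trans (hd s t s0 t0 _) _; last by lra.
  by move: std; rewrite lt_min => /andP[].
- exact: wl.
- by rewrite HnormB; apply: wl => //; rewrite distrC.
- rewrite /trajectory (lt_geF st1) (lt_geF tt1); apply: le_trans (zle _ _ _ _ _) _; last by lra.
  + exact: lt_trans st1.
  + exact: lt_trans tt1.
  + by move: std; rewrite lt_min => /andP[].
Qed.

Lemma trajectory_T : Heq (trajectory T) 0.
Proof.
apply: Hdot_eq0; have t1lT : t1 < T by exact: lt_le_trans t12 t2T.
rewrite /trajectory leNgt t1lT /= Hdot_flat_state; last exact: lt_trans t1lT.
rewrite /pairing (_ : (fun i => _) = fun=> 0).
  by rewrite (_ : series _ = fun=> 0) ?lim_cst //; apply/funext => n; rewrite /series /= big1.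
by apply/funext => i; rewrite g_t2 // mul0r.
Qed.

Lemma control_ex : exists (f : R -> R) (Y : R -> H R),
  [/\ sqi 0 T f /\ exists B, forall t, `|f t| <= B,
      forall s n, 0 <= s -> s <= T -> Hdot (Y s) (e_ n) =
        expR (- mu n ^+ 2 * s) * Hdot y0 (e_ n) +
        beta bc (mu n) * Int 0 s (fun t => f t * expR (- mu n ^+ 2 * (s - t))),
      forall e, 0 < e -> exists2 d : R, 0 < d & forall s t, 0 <= s -> 0 <= t ->
        `|s - t| < d -> Hnorm (Y s - Y t) <= e
    & Heq (Y T) 0].
Proof.
exists control, trajectory; split.
- by split; [exact: control_sqi|exists (2 * (A * 3)); exact: control_bound].
- by move=> s n; exact: trajectory_coef.
- exact: trajectory_cts.
- exact: trajectory_T.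
Qed.

End Control.

Lemma flat_solution_aux : exists (f : R -> R) (Y : R -> H R),
  [/\ sqi 0 T f /\ exists B, forall t, `|f t| <= B,
      forall s n, 0 <= s -> s <= T -> Hdot (Y s) (e_ n) =
        expR (- mu n ^+ 2 * s) * Hdot y0 (e_ n) +
        beta bc (mu n) * Int 0 s (fun t => f t * expR (- mu n ^+ 2 * (s - t))),
      forall e, 0 < e -> exists2 d : R, 0 < d & forall s t, 0 <= s -> 0 <= t ->
        `|s - t| < d -> Hnorm (Y s - Y t) <= e
    & Heq (Y T) 0].
Proof.
(* Half of the ratio accepted by [gev_flat], because the product with the cutoff doubles it. *)
have [r rE] : exists r : R, r = 512^-1 / 2 by exists (512^-1 / 2).
have r0 : 0 < r by rewrite rE; lra.
have K0 : 0 < 4 / r by rewrite divr_gt0.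
have [phi [phi_jet [A1 phi_gev] phi1 phi0 phi2]] := cutoff K0 t12.
have [A2 hg] := heat_jet_gev r0.
have e4 : 4 / (4 / r) = r by rewrite invf_div mulrC divfK.
have r2 : 2 * r = 512^-1 by rewrite rE mulrC divfK.
have pg : gev P A1 r phi by move=> n t _; rewrite -{1}e4; exact: phi_gev.
have pj : jet P phi by move=> n t _; exact: phi_jet.
have gg := jetM_gev (ltW r0) pg hg; rewrite r2 in gg.
apply: (control_ex (jetM_jet pj heat_jet_jet) gg) => [n|n t t2t].
  (* At [t1] the cutoff is 1 and its derivatives vanish, so a single Leibniz term remains. *)
  rewrite /jetM big_ord_recl /= bin0 subn0 phi1 // !mul1r big1 ?addr0 // => i _.
  by rewrite phi0 // mul0r mulr0.
by rewrite /jetM big1 // => i _; rewrite phi2 // mul0r mulr0.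
Qed.

End FlatSolution.

Lemma flat_solution {R : realType} bc (S : R -> H R -> H R) (T : R) (y0 : H R) :
  generated_semigroup bc S -> 0 < T -> exists (f : R -> R) (Y : R -> H R),
  [/\ sqi 0 T f /\ exists B, forall t, `|f t| <= B,
      forall s n, 0 <= s -> s <= T -> Hdot (Y s) (e_ bc n) =
        expR (- mu bc n ^+ 2 * s) * Hdot y0 (e_ bc n) +
        beta bc (mu bc n) * Int 0 s (fun t => f t * expR (- mu bc n ^+ 2 * (s - t))),
      forall e, 0 < e -> exists2 d : R, 0 < d & forall s t, 0 <= s -> 0 <= t ->
        `|s - t| < d -> Hnorm (Y s - Y t) <= e
    & Heq (Y T) 0].
Proof.
(* The times are [tau = T/6], [t1 = T/3], [t2 = 2T/3], and [12 / T] is [2 / tau]. *)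
move=> SG T0; apply: (@flat_solution_aux _ bc S T y0 SG (T / 3) (2 * (T / 3)) (T / 6) (12 / T)).
- by rewrite divr_gt0.
- by lra.
- by lra.
- by lra.
- by rewrite divr_gt0.
- by field; rewrite gt_eqF.
Qed.

(** * The transposition identity *)

Section Duality.
Context {R : realType}.
Variables (bc : boundary) (S : R -> H R -> H R).
Hypothesis SG : generated_semigroup bc S.
Implicit Types (s t : R) (x y eta : H R).
Local Notation mu := (@mu R bc).
Local Notation e_ := (@e_ R bc).
Local Notation nrm := (@nrm R bc).

Lemma proj_norm_le x K : Hnorm (proj bc x K) <= Hnorm x.
Proof.
rewrite -(@ler_pXn2r _ 2) ?nnegrE ?Hnorm_ge0 // !HnormE; apply: le_trans (Bessel bc x K).
rewrite Hdot_projr le_eqVlt; apply/orP; left; apply/eqP.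
by rewrite /series /=; apply: eq_big_nat => n /andP[_ nK]; rewrite Hdot_proj.
Qed.

(** [S h x] lies in the energy space and tends to [x]. *)
Lemma Parseval_all x y :
  series (fun n => Hdot x (e_ n) * Hdot y (e_ n) / nrm n) @ \oo --> Hdot x y.
Proof.
apply/cvgrPdist_le => e e0; have y0 := Hnorm_ge0 y.
have e3 : 0 < e / 3 / (Hnorm y + 1) by rewrite !divr_gt0 //; lra.
have [d d0 hd] := S_continuity SG x e3.
pose h := d / 2; have h0 : 0 < h by rewrite divr_gt0.
have hx : Hnorm (x - S h x) * Hnorm y <= e / 3.
  have xe : Hnorm (x - S h x) <= e / 3 / (Hnorm y + 1).
    rewrite -(Hnorm_Heq (HeqB (sg_0 SG x) (Heq_refl (S h x)))); apply: hd => //; first exact: ltW.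
    by rewrite sub0r normrN gtr0_norm // /h ltr_pdivrMr //; lra.
  move: xe; rewrite ler_pdivlMr; last by lra.
  by have := Hnorm_ge0 (x - S h x); nra.
have /cvgrPdist_le/(_ (e / 3)) := Parseval (y := y) (S_inW SG x h0).
rewrite divr_gt0 // => /(_ isT); apply: filterS => K.
rewrite -!Hdot_projr => hK.
have -> : Hdot x y - Hdot (proj bc x K) y = Hdot (x - S h x) y +
    (Hdot (S h x) y - Hdot (proj bc (S h x) K) y) - Hdot (proj bc (x - S h x) K) y.
  suff -> : Hdot (proj bc (x - S h x) K) y = Hdot (proj bc x K) y - Hdot (proj bc (S h x) K) y.
    by rewrite HdotB; ring.
  rewrite !Hdot_projr /series /= -sumrB; apply: eq_bigr => n _.
  by rewrite HdotB; ring.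
have b1 : `|Hdot (x - S h x) y| <= e / 3 by apply: le_trans (Hdot_le _ _) hx.
have b2 : `|Hdot (proj bc (x - S h x) K) y| <= e / 3.
  apply: le_trans (Hdot_le _ _) (le_trans _ hx).
  by rewrite ler_wpM2r // proj_norm_le.
apply: le_trans (ler_normB _ _) _; apply: le_trans (lerD (ler_normD _ _) (lexx _)) _.
lra.
Qed.

Lemma cvg_series_inv_sqr : cvgn (series (fun k => (k.+1%:R ^+ 2)^-1 : R)).
Proof.
apply: (@bounded_cvg_series _ _ 2) => [k|n]; first by rewrite invr_ge0 sqr_ge0.
(* Comparison with a telescoping bound, strong enough to pass by induction. *)
suff h : series (fun k => (k.+1%:R ^+ 2)^-1) n <= 2 - 2 / n.+1%:R :> R.
  apply: le_trans h _; have : 0 <= 2 / n.+1%:R :> R by rewrite divr_ge0.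
  by move: (2 / _) => z z0; lra.
elim: n => [|n IH]; first by rewrite series0E divr1 subrr.
rewrite seriesSE; apply: le_trans (lerD IH (lexx _)) _.
rewrite -[n.+2%:R]natr1; have : 1 <= n.+1%:R :> R by rewrite ler1n.
move: (n.+1%:R) => z z1.
suff : (z ^+ 2)^-1 <= 2 / z - 2 / (z + 1) by lra.
have -> : 2 / z - 2 / (z + 1) = 2 / (z * (z + 1)) by field; lra.
rewrite -[X in X <= _]mul1r ler_pdivrMr ?exprn_gt0 //; last by lra.
rewrite mulrAC ler_pdivlMr; last by nra.
nra.
Qed.

Lemma inv_sqr_mu_le k : (mu k ^+ 2)^-1 <= ebound bc ^+ 2 * (k.+1%:R ^+ 2)^-1 :> R.
Proof.
have m0 := @mu_gt0 R bc k; have m00 := @mu_gt0 R bc 0.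
have h : k.+1%:R <= mu k * ebound bc.
  rewrite -natr1 /ebound mulrDr mulr1 addrC; apply: lerD.
    by rewrite -(divff (lt0r_neq0 m00)) ler_wpM2r ?invr_ge0 ?(ltW m00) //; exact: (@mu_le R bc).
  exact: (@mu_ge_nat R bc k).
rewrite ler_pdivlMr ?exprn_gt0 // mulrC ler_pdivrMr ?exprn_gt0 // -exprMn mulrC.
by rewrite lerXn2r ?nnegrE ?mulr_ge0 ?(ltW m0) ?(ltW (@ebound_gt0 R bc)) // mulrC.
Qed.

(** Bessel's inequality and the summability of [1 / mu^2], combined by completing a square; [nrm_ge]
    compensates for the missing normalisation. The datum [eta] need only be in [H], although its
    observation may blow up at the final time. *)
Lemma coef_inv_summable eta : cvgn (series (fun k => `|coef bc eta k| * (mu k ^+ 2)^-1)).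
Proof.
pose a k := Hdot eta (e_ k) ^+ 2 / nrm k; pose b k := (k.+1%:R ^+ 2)^-1 : R.
pose C := ebound bc ^+ 2 : R.
have hc : series (fun k => a k + 4 * C * b k) @ \oo -->
    limn (series a) + 4 * C * limn (series b).
  apply: cvg_trans (cvgD (Bessel_cvg (bc := bc) (x := eta)) (cvg_seriesM (k := 4 * C) cvg_series_inv_sqr)).
  by apply: near_eq_cvg; near=> n; rewrite !fctE /series /= -big_split.
apply: abs_cvg_series (cvgP _ hc) => k.
have N0 := @nrm_gt0 R bc k; have l0 : 0 < mu k ^+ 2 by rewrite exprn_gt0 // (@mu_gt0 R).
have Nl := @nrm_ge R bc k; have lC := inv_sqr_mu_le k.
rewrite ger0_norm; last by rewrite mulr_ge0 // invr_ge0 ltW.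
rewrite /coef normrM normfV (gtr0_norm N0) /a -(real_normK (num_real (Hdot eta (e_ k)))).
have z0 := normr_ge0 (Hdot eta (e_ k)).
apply: le_trans (_ : `|Hdot eta (e_ k)| ^+ 2 / nrm k + 4 * (mu k ^+ 2)^-1 <= _); last first.
  by rewrite lerD2l -mulrA ler_wpM2l.
move: (`|_|) (nrm k) (mu k ^+ 2) N0 l0 Nl z0 => z N l N0 l0 Nl z0.
have iN : N^-1 <= 4 * l.
  by rewrite -[N^-1]mul1r ler_pdivrMr // mulrC -ler_pdivrMr ?mulr_gt0 // mul1r.
have i0 : 0 < l^-1 by rewrite invr_gt0.
have n0 : 0 < N^-1 by rewrite invr_gt0.
have li : l * l^-1 = 1 by rewrite divff ?gt_eqF.
have h1 : z * l^-1 <= z ^+ 2 + l^-1 ^+ 2 by have := sqr_ge0 (z - l^-1); nra.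
have h2 : N^-1 * l^-1 ^+ 2 <= 4 * l^-1.
  have -> : 4 * l^-1 = 4 * l * l^-1 ^+ 2 by rewrite expr2 mulrA -(mulrA 4) li mulr1.
  by rewrite ler_wpM2r ?sqr_ge0.
have -> : z / N / l = N^-1 * (z * l^-1) by ring.
apply: le_trans (ler_wpM2l (ltW n0) h1) _.
by rewrite mulrDr mulrC lerD2l.
Unshelve. all: by end_near.
Qed.

Section Pairing.
Variables (y0 : H R) (T B : R) (f : R -> R) (Y : R -> H R).
Hypothesis fs : sqi 0 T f.
Hypothesis fB : forall t, `|f t| <= B.
Hypothesis Yc : forall s n, 0 <= s -> s <= T -> Hdot (Y s) (e_ n) =
  expR (- mu n ^+ 2 * s) * Hdot y0 (e_ n) +
  beta bc (mu n) * Int 0 s (fun t => f t * expR (- mu n ^+ 2 * (s - t))).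

Lemma expR_affine_d (l s t : R) :
  is_derive t 1 (fun u => expR (- l * (s - u))) (l * expR (- l * (s - t))).
Proof.
have dl : is_derive t 1 (fun u => - l * (s - u)) (- l * (0 - 1)).
  exact: dZ (dB (dC t s) (dI t)).
have := @dcomp _ expR (fun u => - l * (s - u)) t _ _ (is_derive_expR _) dl.
by move=> h; apply: is_derive_eq h _; ring.
Qed.

Lemma expR_affine_cts (l s : R) : continuous (fun t => expR (- l * (s - t))).
Proof. by move=> t; exact: is_derive_cvg (expR_affine_d l s t). Qed.

Lemma Int_expR_le (l s : R) : 0 < l -> 0 <= s -> Int 0 s (fun t => expR (- l * (s - t))) <= l^-1.
Proof.
move=> l0 s0.
have dp (t : R) : is_derive t 1 (fun u => l^-1 * expR (- l * (s - u))) (expR (- l * (s - t))).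
  by apply: is_derive_eq (dZ l^-1 (expR_affine_d l s t)) _; rewrite mulrA mulVf ?mul1r // gt_eqF.
have := FTC2D s0 (@expR_affine_cts l s) dp.
rewrite subrr mulr0 expR0 mulr1 => <-; by rewrite lerDr mulr_ge0 ?expR_ge0 // invr_ge0 ltW.
Qed.

(** With [f] and [beta] bounded, each mode contributes at most a constant times [|coef| / mu^2], one
    [1 / mu^2] coming from the time integral of the exponential. *)
Lemma control_integral s eta : 0 <= s -> s <= T ->
  itg 0 s (fun t => f t * ctr bc (S (s - t) eta)) /\
  series (fun n => coef bc eta n * beta bc (mu n) *
    Int 0 s (fun t => f t * expR (- mu n ^+ 2 * (s - t)))) @ \oo -->
  Int 0 s (fun t => f t * ctr bc (S (s - t) eta)).
Proof.
move=> s0 sT; have fs' : sqi 0 s f by exact: sqi_sub fs.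
have B0 : 0 <= B by exact: le_trans (fB 0).
pose b0 : R := 3 + (mu 0)^-1.
have ife n : itg 0 s (fun t => f t * expR (- mu n ^+ 2 * (s - t))).
  by apply: sqiM => //; apply: cts_sqiT; exact: expR_affine_cts.
pose h n t := coef bc eta n * beta bc (mu n) * (f t * expR (- mu n ^+ 2 * (s - t))).
have [] := @Int_series _ 0 s h (fun t => f t * ctr bc (S (s - t) eta))
  (fun k => B * b0 * (`|coef bc eta k| * (mu k ^+ 2)^-1)).
- by move=> n; apply: itgZ; exact: ife.
- move=> n; have l0 : 0 < mu n ^+ 2 by rewrite exprn_gt0 // (@mu_gt0 R).
  pose C := `|coef bc eta n| * b0 * B.
  have C0 : 0 <= C by rewrite !mulr_ge0 // addr_ge0 // invr_ge0 ltW // (@mu_gt0 R).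
  apply: le_trans (_ : Int 0 s (fun t => C * expR (- mu n ^+ 2 * (s - t))) <= _).
    apply: le_I; first exact/itg_norm/itgZ.
      by apply: itgZ; apply: sqi_itg; apply: cts_sqiT; exact: expR_affine_cts.
    move=> t _; rewrite /h (normrM (_ * _)) (normrM (coef _ _ _)) (normrM (f t)).
    rewrite (ger0_norm (expR_ge0 _)) mulrA.
    rewrite ler_wpM2r ?expR_ge0 // /C; apply: ler_pM => //.
    by rewrite ler_wpM2l //; exact: beta_bound.
  rewrite IZ; last by apply: sqi_itg; apply: cts_sqiT; exact: expR_affine_cts.
  apply: le_trans (ler_wpM2l C0 (Int_expR_le l0 s0)) _.
  by rewrite le_eqVlt; apply/orP; left; apply/eqP; rewrite /C; ring.
- exact: cvgP _ (cvg_seriesM (k := B * b0) (@coef_inv_summable eta)).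
- move=> t /andP[t0 ts]; have st0 : 0 < s - t by rewrite subr_gt0.
  have := cvg_seriesM (k := f t) (ctr_heat SG (x := eta) st0).
  by apply: eq_cvg_series => n; rewrite /h /heat; ring.
- move=> h1 h2; split => //; apply: eq_cvg_series h2 => n.
  by rewrite /h IZ //; exact: ife.
Qed.

Lemma duality s eta : 0 <= s -> s <= T ->
  Hdot (Y s) eta = Hdot y0 (S s eta) + Int 0 s (fun t => f t * ctr bc (S (s - t) eta)).
Proof.
move=> s0 sT; have [_ h2] := control_integral eta s0 sT.
apply: cvg_unique (Parseval_all (x := Y s) (y := eta)) _ => //.
apply: cvg_trans (cvgD (Parseval_all (x := y0) (y := S s eta)) h2).
apply: near_eq_cvg; near=> n; rewrite !fctE /series /= -big_split /=.
apply: eq_bigr => k _; rewrite (S_coef SG) // Yc // /coef; ring.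
Unshelve. all: by end_near.
Qed.

End Pairing.

End Duality.

(** * Null controllability in the two cases *)

Section Solutions.
Context {R : realType}.
Implicit Types (bc : boundary) (x : H R).

Lemma IntE (a b : R) f : Int a b f = \int[lebesgue_measure]_(t in `[a, b]) f t.
Proof. by rewrite Int.unlock. Qed.

Lemma inW0 bc : inW bc (0 : H R) /\ Wnorm (0 : H R) = 0.
Proof.
have J0 : Heq (0 : H R) (J 0).
  have := J_linear (R := R) (-1) 0 0; rewrite scaler0 addr0 scaleN1r addNr.
  exact: Heq_sym.
have [W0 Wn _ _] := inW_intro J0 (@Wp0 R bc); split => //.
by move: Wn; rewrite pdot0 => /eqP; rewrite sqrf_eq0 => /eqP.
Qed.

(** Serves both topologies: [F] is the norm of [H] in the Neumann case and the dual norm, at most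
    twice it by [Poincare], in the Dirichlet case. *)
Lemma within_continuity (T s : R) (Y : R -> H R) (F : R -> R) : 0 <= s -> s <= T ->
  (forall e, 0 < e -> exists2 d : R, 0 < d & forall s t, 0 <= s -> 0 <= t ->
     `|s - t| < d -> Hnorm (Y s - Y t) <= e) ->
  (forall t, 0 <= F t <= 2 * Hnorm (Y t - Y s)) ->
  F t @[t --> within `[0, T] (nbhs s)] --> (0 : R).
Proof.
move=> s0 sT hY hF; apply/cvgrPdist_le => e e0.
have [d d0 hd] := hY _ (divr_gt0 e0 (ltr0n R 2)).
exists d => //= t std; rewrite in_itv /= => /andP[t0 _].
have /andP[F0 F1] := hF t; rewrite sub0r normrN ger0_norm //.
apply: le_trans F1 _; rewrite HnormB; have := hd s t s0 t0 std; lra.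
Qed.

Lemma Neumann_controllable (S : R -> H R -> H R) (T : R) (y0 : H R) :
  0 < T -> generated_semigroup Neumann S -> exists (f : L2 0 T) (y : R -> H R),
    solution_Neumann S y0 f y /\ Heq (y T) 0.
Proof.
move=> T0 SG; have [f [Y [[fs [B fB]] Yc Ycts YT]]] := flat_solution y0 SG T0.
exists (toL2 0 T f), Y; split => //; split.
  move=> s; rewrite in_itv /= => /andP[s0 sT]; apply: (within_continuity s0 sT Ycts) => t.
  by rewrite Hnorm_ge0 /=; have := Hnorm_ge0 (Y t - Y s); lra.
move=> s eta; rewrite in_itv /= => /andP[s0 sT].
rewrite (duality SG fs fB Yc eta s0 sT); congr (_ + _).
rewrite -IntE; apply: eq_I => t /andP[t0 ts].
by rewrite toL2E // t0 (le_trans ts).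
Qed.

(** The state, as an element of the dual, is represented by a trajectory in [H] through the pivot
    inner product. *)
Lemma Dirichlet_controllable (S : R -> H R -> H R) (T : R) (y0 : H R) :
  0 < T -> generated_semigroup Dirichlet S -> exists (f : L2 0 T) (y : R -> H R -> R),
    solution_Dirichlet S y0 f y /\ forall eta, inW Dirichlet eta -> y T eta = 0.
Proof.
move=> T0 SG; have [f [Y [[fs [B fB]] Yc Ycts YT]]] := flat_solution y0 SG T0.
have bound x y : inW Dirichlet y -> `|Hdot x y| <= 2 * Hnorm x * Wnorm y.
  move=> yW; apply: le_trans (Hdot_le _ _) _; rewrite mulrAC mulrC ler_wpM2r ?Hnorm_ge0 //.
  exact: Poincare yW.
exists (toL2 0 T f), (fun s => Hdot (Y s)); split; last first.
  by move=> eta _; rewrite (Hdot_Heq _ YT) Hdot0.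
split.
- move=> s _; split.
    by move=> a x y _ _; rewrite HdotC Hdot_linear !(HdotC (Y s)).
  by exists (2 * Hnorm (Y s)) => x; exact: bound.
- move=> s; rewrite in_itv /= => /andP[s0 sT]; apply: (within_continuity s0 sT Ycts) => t.
  have [W0 Wn0] := inW0 Dirichlet.
  set A := [set `|(Hdot (Y t) \- Hdot (Y s)) x| | x in [set x | inW Dirichlet x /\ Wnorm x <= 1]].
  (* The value at 0 makes the set nonempty and its supremum nonnegative; with the upper bound, the
     supremum is a genuine one. *)
  have A0 : A 0.
    by exists 0; [split => //; rewrite Wn0|rewrite /= HdotC Hdot0 HdotC Hdot0 subrr normr0].
  have Aub : ubound A (2 * Hnorm (Y t - Y s)).
    move=> _ [x [xW x1] <-]; rewrite /= -HdotB; apply: le_trans (bound _ _ xW) _.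
    by rewrite ler_piMr // mulr_ge0 ?Hnorm_ge0.
  rewrite -/(dual_norm _ _) /dual_norm -/A; apply/andP; split.
    by apply: ub_le_sup => //; exists (2 * Hnorm (Y t - Y s)).
  by apply: ge_sup => //; exists 0.
- move=> s eta; rewrite in_itv /= => /andP[s0 sT] _.
  rewrite (duality SG fs fB Yc eta s0 sT); congr (_ + _).
  have [ic _] := control_integral SG fs fB eta s0 sT.
  rewrite -mulN1r -IntE -IZ.
    by apply: eq_I => t /andP[t0 ts]; rewrite toL2E ?t0 ?(le_trans ts) // /ctr; ring.
  have := itgZ (-1) ic; apply: eq_itg => t /andP[t0 ts].
  by rewrite toL2E ?t0 ?(le_trans ts) // /ctr; ring.
Qed.

End Solutions.

Theorem proposition1p0p1 (R : realType) (T : R) (T_gt0 : 0 < T) :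
  (forall S : R -> H R -> H R, generated_semigroup Dirichlet S ->
    forall y0 : H R, exists (f : L2 0 T) (y : R -> H R -> R),
      solution_Dirichlet S y0 f y /\
      forall eta, inW Dirichlet eta -> y T eta = 0) /\
  (forall S : R -> H R -> H R, generated_semigroup Neumann S ->
    forall y0 : H R, exists (f : L2 0 T) (y : R -> H R),
      solution_Neumann S y0 f y /\ Heq (y T) 0).
Proof.
split=> S SG y0; [exact: Dirichlet_controllable|exact: Neumann_controllable].
Qed.
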